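(* Let $a<b$ be real numbers and let $B(t)\in\mathbb{R}^{n\times n}$ be symmetric positive semi-definite and continuous in $t\in[a,b]$. Let $r\ge 2$ and $n_\Omega\ge r+4$ be integers, let $\Omega\in\mathbb{R}^{n\times n_\Omega}$ be a Gaussian random matrix (not depending on $t$), and let $$\widehat{B}_\Omega(t)=(B(t)\Omega)\,(\Omega^\top B(t)\Omega)^\dagger\,(B(t)\Omega)^\top .$$ Then, for any $\gamma\ge 1$, the bound $$\int_a^b\big|\mathrm{Tr}(B(t))-\mathrm{Tr}(\widehat{B}_\Omega(t))\big|\,dt\;\le\;\gamma^2(1+r)\int_a^b\sum_{i=r+1}^n\sigma_i(B(t))\,dt$$ holds with probability at least $1-\gamma^{-(n_\Omega-r)}$.
   Context: A Gaussian random matrix is a random matrix whose entries are independent standard normal random variables. $M^\dagger$ denotes the Moore-Penrose pseudoinverse. $\sigma_1(M)\ge\sigma_2(M)\ge\cdots\ge\sigma_n(M)\ge0$ denote the singular values of $M\in\mathbb{R}^{n\times n}$. $\widehat{B}_\Omega(t)$ is the Nyström approximation of $B(t)$; the same realization of $\Omega$ is used for all $t$. *)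

(* Defs.v *)
From HB Require Import structures.
From mathcomp Require Import all_boot all_order all_algebra.
From mathcomp Require Import all_classical all_reals all_analysis.

Set Implicit Arguments.
Unset Strict Implicit.
Unset Printing Implicit Defensive.

Import Order.TTheory GRing.Theory Num.Theory.
Import numFieldNormedType.Exports.

Local Open Scope classical_set_scope.
Local Open Scope ring_scope.

Definition symmetric_psd (R : realType) (n : nat) (M : 'M[R]_n) : Prop :=
  M^T = M /\ forall x : 'cV[R]_n, 0 <= (x^T *m M *m x) 0 0.

(* The singular values of M, in decreasing order, are the nonnegative square
   roots of the eigenvalues of M^T M counted with algebraic multiplicity. *)
Definition is_singular_values (R : realType) (n : nat) (M : 'M[R]_n)
    (s : 'rV[R]_n) : Prop :=
  [/\ forall i, 0 <= s 0 i,
      forall i j : 'I_n, (i <= j)%N -> s 0 j <= s 0 i &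
      char_poly (M^T *m M) = \prod_(i < n) ('X - (s 0 i ^+ 2)%:P)].

(* Exactly one s satisfies is_singular_values M, so the default 0 is never
   used.  Indices start at 0: sigma M i is the (i+1)-st largest singular
   value. *)
Definition sigma (R : realType) (n : nat) (M : 'M[R]_n) (i : 'I_n) : R :=
  xget 0 (is_singular_values M) 0 i.

(* The four Penrose equations. *)
Definition is_pseudoinverse (R : realType) (m n : nat) (A : 'M[R]_(m, n))
    (X : 'M[R]_(n, m)) : Prop :=
  [/\ A *m X *m A = A, X *m A *m X = X,
      (A *m X)^T = A *m X & (X *m A)^T = X *m A].

(* Exactly one X satisfies is_pseudoinverse A, so the default 0 is never
   used.  MathComp's pinvmx is only a partial inverse, not this one. *)
Definition pseudoinverse (R : realType) (m n : nat) (A : 'M[R]_(m, n)) :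
    'M[R]_(n, m) :=
  xget 0 (is_pseudoinverse A).

Definition nystrom (R : realType) (n k : nat) (B : 'M[R]_n)
    (Om : 'M[R]_(n, k)) : 'M[R]_n :=
  (B *m Om) *m pseudoinverse (Om^T *m B *m Om) *m (B *m Om)^T.

Definition mutually_independent (d : measure_display) (T : measurableType d)
    (R : realType) (P : probability T R) (I : finType) (X : I -> T -> R) :
    Prop :=
  forall (J : {set I}) (A : I -> set R), (forall i, measurable (A i)) ->
    P [set w | forall i, i \in J -> A i (X i w)] =
    (\prod_(i in J) P (X i @^-1` A i))%E.

Definition gaussian_matrix (d : measure_display) (T : measurableType d)
    (R : realType) (P : probability T R) (m n : nat)
    (Om : T -> 'M[R]_(m, n)) : Prop :=
  [/\ forall i j, measurable_fun setT (fun w => Om w i j),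
      forall i j (A : set R), measurable A ->
        P ((fun w => Om w i j) @^-1` A) = normal_prob (0 : R) 1 A &
      mutually_independent P
        (fun (ij : 'I_m * 'I_n) (w : T) => Om w ij.1 ij.2)].

(* Main.v *)
(* Fix t, diagonalize B(t) and let W = V Omega, which is again Gaussian.  Split
   W into its first r rows W1 and the others W2, and put x = W2 W1^+ (well
   defined almost surely).  The trace of a Schur complement is a minimum, and
   the competitor given by W1^+ yields
     Tr (B - Bhat) <= sum_(i > r) sigma_i (1 + sum_j x_ij^2).
   Given W1, x_ij is normal of standard deviation the norm of column j of W1^+,
   which is the inverse distance of row j of W1 to the span of the other rows,
   i.e. the inverse norm of a standard Gaussian vector of dimension
   nOmega - r + 1.  With k = nOmega - r this makes E |x_ij|^k <= 1, so that by
   Jensen's inequality for x^(k/2)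
     E (Tr (B - Bhat))^(k/2) <= ((1 + r) sum_(i > r) sigma_i)^(k/2).
   A Minkowski argument carries this bound through the integral over t, and
   Markov's inequality concludes. *)
Require Import Defs.
From HB Require Import structures.
From mathcomp Require Import all_boot all_order all_algebra.
From mathcomp Require Import all_classical all_reals all_analysis.
From mathcomp Require Import measurable_realfun perm complex ring lra zify.

Set Implicit Arguments.
Unset Strict Implicit.
Unset Printing Implicit Defensive.

Import Order.TTheory GRing.Theory Num.Theory.
Import numFieldNormedType.Exports.

Local Open Scope classical_set_scope.
Local Open Scope ring_scope.

(** * Trace of the Nystrom error *)

(** The order k = nOmega - r is the largest integer for which a standard Gaussian vector of
    dimension k + 1 has a finite inverse moment, and at that order the moment of x_ij collapses to a
    moment of order 0; hence the bound by exactly 1. Three obstacles shape the rest. The tail sum of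
    singular values is not shown to be measurable in t, so (E X_t^(k/2))^(2/k), with X_t the trace
    error at time t, stands in for it: it is measurable by Tonelli and lies below the target. The
    pseudoinverse is discontinuous, so joint measurability of the error comes from regularized
    inverses that converge to it. The Minkowski step is carried out by hand: the tangent line of
    x^(k/2) at gamma^2, applied to X_t divided by its bound, is integrated over t, and Markov's
    inequality is applied to the resulting weighted integral of X_t^(k/2). Rotation invariance needs
    no determinant: elimination shows that an invertible linear substitution multiplies integrals by
    some constant, and testing with the function 1 shows that this constant is 1 for an isometry. *)

Section orthogonal.
Variable R : realType.

Definition sqn n (v : 'rV[R]_n) : R := \sum_i v 0 i ^+ 2.

Lemma sqnE n (v : 'rV[R]_n) : (v *m v^T) 0 0 = sqn v.
Proof. by rewrite mxE; apply: eq_bigr => i _; rewrite mxE expr2. Qed.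

Lemma sqn_ge0 n (v : 'rV[R]_n) : 0 <= sqn v.
Proof. by apply: sumr_ge0 => i _; exact: sqr_ge0. Qed.

Lemma sqn_eq0 n (v : 'rV[R]_n) : (sqn v == 0) = (v == 0).
Proof.
apply/eqP/eqP => [v0|->]; last first.
  by rewrite /sqn big1// => i _; rewrite mxE expr0n.
apply/rowP => i; rewrite mxE; apply/eqP; rewrite -sqrf_eq0; apply/eqP.
by apply: (psumr_eq0P _ v0) => // j _; exact: sqr_ge0.
Qed.

Lemma sqn_gt0 n (v : 'rV[R]_n) : (0 < sqn v) = (v != 0).
Proof. by rewrite lt0r sqn_ge0 andbT sqn_eq0. Qed.

Definition orthomx n (Q : 'M[R]_n) := Q *m Q^T = 1%:M.

Lemma orthomxT n (Q : 'M[R]_n) : orthomx Q -> Q^T *m Q = 1%:M.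
Proof. exact: mulmx1C. Qed.

Lemma orthomx_tr n (Q : 'M[R]_n) : orthomx Q -> orthomx Q^T.
Proof. by rewrite /orthomx trmxK => /orthomxT. Qed.

Lemma orthomxM n (P Q : 'M[R]_n) : orthomx P -> orthomx Q -> orthomx (P *m Q).
Proof.
by move=> oP oQ; rewrite /orthomx trmx_mul mulmxA -(mulmxA P) oQ mulmx1.
Qed.

Lemma orthomx_block m n (P : 'M[R]_m) (Q : 'M[R]_n) :
  orthomx P -> orthomx Q -> orthomx (block_mx P 0 0 Q).
Proof.
move=> oP oQ; rewrite /orthomx tr_block_mx mulmx_block !trmx0 !mulmx0 !mul0mx.
by rewrite !addr0 !add0r oP oQ -scalar_mx_block.
Qed.

Lemma orthomx1 n : orthomx (1%:M : 'M[R]_n).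
Proof. by rewrite /orthomx trmx1 mulmx1. Qed.

Lemma sqn_orthomx n (Q : 'M[R]_n) (v : 'rV[R]_n) :
  orthomx Q -> sqn (v *m Q) = sqn v.
Proof.
by move=> oQ; rewrite -!sqnE trmx_mul mulmxA -(mulmxA v) oQ mulmx1.
Qed.

Lemma sqn_row_mx m n (u : 'rV[R]_m) (v : 'rV[R]_n) :
  sqn (row_mx u v) = sqn u + sqn v.
Proof. by rewrite -!sqnE tr_row_mx mul_row_col mxE. Qed.

(** Reflection across the hyperplane orthogonal to w = u - v: equal norms give <u, w> = |w|^2 / 2,
    so u goes to u - w = v. *)
Lemma householder n (u v : 'rV[R]_n) : sqn u = sqn v ->
  exists2 Q : 'M[R]_n, orthomx Q & u *m Q = v.
Proof.
move=> uv; have [->|neq] := eqVneq u v.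
  by exists 1%:M; [exact: orthomx1|rewrite mulmx1].
pose w := u - v.
have w0 : sqn w != 0 by rewrite sqn_eq0 subr_eq0.
exists (1%:M - (2 / sqn w) *: (w^T *m w)).
  have tE : (1%:M - (2 / sqn w) *: (w^T *m w))^T = 1%:M - (2 / sqn w) *: (w^T *m w).
    by rewrite linearB/= linearZ/= trmx_mul trmxK trmx1.
  rewrite /orthomx tE mulmxBr mulmx1 mulmxBl mul1mx.
  rewrite -scalemxAl -scalemxAr.
  have -> : w^T *m w *m (w^T *m w) = sqn w *: (w^T *m w).
    rewrite mulmxA -(mulmxA w^T) [w *m w^T]mx11_scalar sqnE.
    by rewrite mul_mx_scalar scalemxAl.
  rewrite scalerA scalerA -mulrA divfK// mulrDr mulr1 scalerDl.
  by rewrite opprB addrK subrK.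
have -> : u *m (1%:M - (2 / sqn w) *: (w^T *m w)) = u - (2 / sqn w * (u *m w^T) 0 0) *: w.
  rewrite mulmxBr mulmx1 -scalemxAr mulmxA [u *m w^T]mx11_scalar mul_scalar_mx.
  by rewrite scalerA; congr (_ - (_ * _) *: _); rewrite [RHS]mxE eqxx mulr1n.
have -> : 2 / sqn w * (u *m w^T) 0 0 = 1.
  have mxB (M N : 'M[R]_1) : (M - N) 0 0 = M 0 0 - N 0 0 by rewrite !mxE.
  have e1 : (u *m v^T) 0 0 = (v *m u^T) 0 0.
    by rewrite -[in RHS](trmxK v) -trmx_mul [RHS]mxE.
  have e2 : sqn w = sqn u - (u *m v^T) 0 0 - (v *m u^T) 0 0 + sqn v.
    by rewrite -!sqnE /w linearB/= mulmxBl !mulmxBr !mxB; lra.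
  have e3 : (u *m w^T) 0 0 = sqn w / 2.
    by rewrite e2 -uv /w linearB/= mulmxBr mxB sqnE e1; lra.
  by rewrite e3; field.
by rewrite scale1r /w opprB addrC subrK.
Qed.

Lemma sqn_e0 n (x : R) : sqn (row_mx (x%:M : 'rV_1) (0 : 'rV[R]_n)) = x ^+ 2.
Proof.
by rewrite sqn_row_mx /sqn big_ord1 mxE eqxx mulr1n big1 ?addr0// => i _; rewrite mxE expr0n.
Qed.

Lemma householder_e0 n (v : 'rV[R]_(1 + n)) :
  exists2 Q : 'M[R]_(1 + n), orthomx Q &
    v *m Q = row_mx (Num.sqrt (sqn v))%:M 0.
Proof. by apply: householder; rewrite sqn_e0 sqr_sqrtr ?sqn_ge0. Qed.

(** An LQ factorization by induction on the rows: a reflection sends the first row to the first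
    axis, and the other rows are treated within the remaining columns. The last N - r columns of [Q]
    are thus orthogonal to every row of [O]. *)
Lemma lower_triangularize r N (O : 'M[R]_(r, N)) : (r <= N)%N ->
  exists2 Q : 'M[R]_N, orthomx Q & forall i (j : 'I_N), (r <= j)%N -> (O *m Q) i j = 0.
Proof.
elim: r N O => [|r IH] [|N] O rN //.
- by exists 1%:M => [|[]]//; exact: orthomx1.
- by exists 1%:M => [|[]]//; exact: orthomx1.
pose O' : 'M[R]_(1 + r, 1 + N) := O.
have [Q1 oQ1 eQ1] := householder_e0 (usubmx O').
have [Q2 oQ2 eQ2] := IH N (rsubmx (dsubmx O' *m Q1)) rN.
have oB : orthomx (block_mx (1%:M : 'M[R]_1) 0 0 Q2).
  by apply: orthomx_block => //; exact: orthomx1.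
exists (Q1 *m block_mx (1%:M : 'M[R]_1) 0 0 Q2); first exact: orthomxM.
move=> i j ltj; rewrite mulmxA.
have -> : O *m Q1 = col_mx (row_mx (Num.sqrt (sqn (usubmx O')))%:M 0)
                           (row_mx (lsubmx (dsubmx O' *m Q1)) (rsubmx (dsubmx O' *m Q1))).
  rewrite hsubmxK -eQ1 -mul_col_mx vsubmxK //.
rewrite (@mul_col_mx _ 1 r) !(@mul_row_block _ _ 1 N 1 N) !mulmx0 !mulmx1 !mul0mx !addr0 !add0r.
have ltj' (j1 : 'I_1) : j = j1 :> nat -> False by case: j1 ltj => -[|//] ? /= ltj e; rewrite e in ltj.
rewrite mxE; case: splitP => i' _; rewrite mxE; case: splitP => j' ej; try by case: (ltj' _ ej).
  by rewrite mxE.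
by rewrite eQ2//; rewrite ej in ltj.
Qed.

(** Over the complex numbers there is an eigenvector x + iy with eigenvalue a + ib. Symmetry gives
    <xA, y> = <yA, x>, that is b (|x|^2 + |y|^2) = 0, so b = 0 and whichever of x and y is nonzero
    is a real eigenvector. *)
Lemma symmetric_eigenvector n (A : 'M[R]_n.+1) : A^T = A ->
  exists a, exists2 v : 'rV[R]_n.+1, v != 0 & v *m A = a *: v.
Proof.
move=> sA.
have [z /eigenvalueP[v vA v0]] :
    exists z, eigenvalue (map_mx (@real_complex_def R (Phant R)) A) z.
  by apply: eigenvalue_closed.
pose x := map_mx (@complex.Re R) v; pose y := map_mx (@complex.Im R) v.
pose a := complex.Re z; pose b := complex.Im z.
have ReM (u : R[i]) (c : R) : complex.Re (u * (c%:C)%C) = complex.Re u * c.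
    by case: u => u1 u2 /=; rewrite mulr0 subr0.
  have ImM (u : R[i]) (c : R) : complex.Im (u * (c%:C)%C) = complex.Im u * c.
    by case: u => u1 u2 /=; rewrite mulr0 add0r.
have ex : x *m A = a *: x - b *: y.
  apply/rowP => i; move/rowP/(_ i)/(congr1 (@complex.Re R)): vA.
  rewrite !mxE raddf_sum/= => vA.
  transitivity (complex.Re (z * v 0 i)); last by rewrite /a /b; case: (z) (v 0 i) => ? ? [].
  by rewrite -vA; apply: eq_bigr => k _; rewrite !mxE ReM.
have ey : y *m A = a *: y + b *: x.
  apply/rowP => i; move/rowP/(_ i)/(congr1 (@complex.Im R)): vA.
  rewrite !mxE raddf_sum/= => vA.
  transitivity (complex.Im (z * v 0 i)); last by rewrite /a /b; case: (z) (v 0 i) => ? ? [].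
  by rewrite -vA; apply: eq_bigr => k _; rewrite !mxE ImM.
have sAxy (p q : 'rV[R]_n.+1) : (p *m A *m q^T) 0 0 = (q *m A *m p^T) 0 0.
  by rewrite -[in RHS]sA -(trmxK q) -!trmx_mul trmxK mulmxA [RHS]mxE.
have [x0|y0] : x != 0 \/ y != 0.
  apply/orP; rewrite -negb_and; apply: contra v0 => /andP[/eqP x0 /eqP y0].
  apply/eqP/rowP => i; move/rowP/(_ i): x0; move/rowP/(_ i): y0; rewrite !mxE.
  by case: (v 0 i) => ? ? /= -> ->.
all: have b0 : b = 0.
all: try (have mxB (M N : 'M[R]_1) (c d : R) : (c *: M - d *: N) 0 0 = c * M 0 0 - d * N 0 0 by rewrite !mxE).
all: try (have mxD (M N : 'M[R]_1) (c d : R) : (c *: M + d *: N) 0 0 = c * M 0 0 + d * N 0 0 by rewrite !mxE).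
all: try (have xyC : (x *m y^T) 0 0 = (y *m x^T) 0 0 by rewrite -[in RHS](trmxK y) -trmx_mul [RHS]mxE).
all: try (have := sAxy x y; rewrite ex ey mulmxBl mulmxDl -!scalemxAl mxB mxD xyC !sqnE => exy).
all: try (have /eqP : b * (sqn x + sqn y) = 0 by lra).
all: try (rewrite mulf_eq0 => /orP[/eqP//|];
      rewrite paddr_eq0 ?sqn_ge0// !sqn_eq0 ?(negbTE x0) ?(negbTE y0) ?andbF//).
- by exists a, x => //; rewrite ex b0 scale0r subr0.
- by exists a, y => //; rewrite ey b0 scale0r addr0.
Qed.

(** Deflation: once the eigenvector is rotated onto the first axis, the first row of [C] is (a, 0),
    symmetry clears its first column, and induction applies to the remaining block. *)
Lemma spectral_unsorted n (A : 'M[R]_n) : A^T = A ->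
  exists2 V : 'M[R]_n, orthomx V & exists l : 'rV[R]_n, V *m A *m V^T = diag_mx l.
Proof.
elim: n A => [|n IH] A sA.
  by exists 1%:M; [exact: orthomx1|exists 0; rewrite [LHS]flatmx0 [RHS]flatmx0].
have [a [v v0 vA]] := symmetric_eigenvector sA.
have [Q oQ vQ] := @householder_e0 n v.
set s := Num.sqrt _ in vQ.
have s0 : s != 0 by rewrite sqrtr_eq0 -ltNge sqn_gt0.
pose C : 'M[R]_(1 + n) := Q^T *m A *m Q.
have sC : C^T = C by rewrite /C !trmx_mul trmxK sA mulmxA.
have urC : usubmx C = row_mx a%:M 0.
  have : row_mx s%:M 0 *m C = s *: row_mx a%:M 0.
    rewrite /C -vQ !mulmxA -(mulmxA v) (oQ : Q *m Q^T = _) mulmx1 vA -scalemxAl vQ.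
    by rewrite !scale_row_mx !scaler0 !scale_scalar_mx mulrC.
  rewrite -{1}(vsubmxK C) mul_row_col mul0mx addr0 mul_scalar_mx => /(congr1 (fun M => s^-1 *: M)).
  by rewrite !scalerA mulVf// !scale1r.
have eC : C = block_mx a%:M 0 0 (drsubmx C).
  rewrite -{1}[C]submxK; congr block_mx.
  - by rewrite /ulsubmx urC row_mxKl.
  - by rewrite /ursubmx urC row_mxKr.
  - by rewrite -[dlsubmx C]trmxK trmx_dlsub sC /ursubmx urC row_mxKr trmx0.
have [|V oV [l Vl]] := IH (drsubmx C); first by rewrite trmx_drsub sC.
exists (block_mx (1%:M : 'M[R]_1) 0 0 V *m Q^T).
  apply: (@orthomxM (1 + n)); last exact: orthomx_tr.
  exact: (@orthomx_block 1 n _ _ (orthomx1 1) oV).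
exists (row_mx a%:M l).
rewrite trmx_mul trmxK !mulmxA -(mulmxA _ Q^T) -(mulmxA _ _ Q) -/C eC.
rewrite (@tr_block_mx _ 1 n 1 n) !trmx0 trmx1 !(@mulmx_block _ 1 n 1 n 1 n).
rewrite !mulmx0 !mul0mx !mulmx1 !mul1mx !addr0 !add0r Vl.
have aE : diag_mx (a%:M : 'rV_1) = a%:M.
  by apply/matrixP=> i j; rewrite !ord1 !mxE eqxx.
by rewrite mul0mx -{1}aE -diag_mx_row.
Qed.

Lemma spectral_sorted n (A : 'M[R]_n) : A^T = A ->
  exists2 V : 'M[R]_n, orthomx V & exists2 l : 'rV[R]_n,
    V *m A *m V^T = diag_mx l & forall i j : 'I_n, (i <= j)%N -> l 0 j <= l 0 i.
Proof.
move=> /spectral_unsorted[V oV [l Vl]].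
pose t := [tuple l 0 i | i < n].
pose t' := sort_tuple >=%O t.
have /tuple_permP[p pt] : perm_eq t' t by rewrite perm_sort.
exists (perm_mx p *m V).
  apply: orthomxM => //; rewrite /orthomx tr_perm_mx -perm_mxM mulgV perm_mx1 //.
exists (\row_i l 0 (p i)).
  rewrite trmx_mul !mulmxA -(mulmxA _ V) -(mulmxA _ (V *m A)) Vl tr_perm_mx.
  rewrite -row_permE -col_permE; apply/matrixP => i j.
  by rewrite !mxE (inj_eq perm_inj).
move=> i j ij; rewrite !mxE.
have tE k : l 0 (p k) = nth 0 t' k.
  by rewrite pt -tnth_nth !tnth_mktuple.
rewrite !tE; have st : sorted >=%O t' by apply: sort_sorted => x y; exact: ge_total.
have ge_tr : transitive (>=%O : rel R) by move=> x y z yx zx; exact: le_trans zx yx.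
by apply: (sorted_leq_nth ge_tr (lexx : reflexive (>=%O : rel R)) 0 st) => //;
  rewrite inE size_tuple ltn_ord.
Qed.

Lemma char_poly_orthomx n (V D : 'M[R]_n) : orthomx V ->
  char_poly (V^T *m D *m V) = char_poly D.
Proof.
move=> /orthomxT oV; rewrite /char_poly /char_poly_mx.
have -> : 'X%:M - map_mx polyC (V^T *m D *m V) =
    map_mx polyC V^T *m ('X%:M - map_mx polyC D) *m map_mx polyC V.
  rewrite mulmxBr mulmxBl -!map_mxM; congr (_ - _).
  by rewrite mul_mx_scalar -scalemxAl -map_mxM oV map_mx1 scalemx1.
rewrite !det_mulmx mulrC mulrA -det_mulmx -map_mxM.
by rewrite (mulmx1C oV) map_mx1 det1 mul1r.
Qed.

Lemma symmetric_psdP n (M : 'M[R]_n) : symmetric_psd M ->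
  M^T = M /\ forall x : 'rV[R]_n, 0 <= (x *m M *m x^T) 0 0.
Proof. by move=> [sM pM]; split=> // x; have := pM x^T; rewrite trmxK. Qed.

(** The characteristic polynomial of M^T M = M^2 fixes the multiset of squared singular values;
    decreasing order and nonnegativity then fix the vector. Hence whatever [xget] selects in [sigma]
    is the sorted spectrum [l]. *)
Lemma spectral_psd n (M : 'M[R]_n) : symmetric_psd M ->
  exists2 V : 'M[R]_n, orthomx V & exists2 l : 'rV[R]_n,
    M = V^T *m diag_mx l *m V &
    (forall i, 0 <= l 0 i) /\ forall i, sigma M i = l 0 i.
Proof.
move=> /symmetric_psdP[sM pM]; have [V oV [l Vl sl]] := spectral_sorted sM.
have eM : M = V^T *m diag_mx l *m V.
  by rewrite -Vl !mulmxA (orthomxT oV) mul1mx -mulmxA (orthomxT oV) mulmx1.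
have l0 i : 0 <= l 0 i.
  have := pM (row i V); rewrite -row_mul tr_row.
  have -> : (row i (V *m M) *m col i V^T) 0 0 = (V *m M *m V^T) i i.
    by rewrite -row_mul !mxE; apply: eq_bigr => k _; rewrite !mxE.
  by rewrite Vl mxE eqxx mulr1n.
exists V => //; exists l => //; split=> // i.
have isl : is_singular_values M l.
  split=> //; rewrite sM eM -!mulmxA (mulmxA V V^T) (oV : V *m V^T = _) mul1mx.
  rewrite (mulmxA (diag_mx l)) mulmxA char_poly_orthomx// char_poly_trig; last first.
    by rewrite mulmx_diag diag_mx_is_trig.
  by apply: eq_bigr => j _; rewrite mulmx_diag !mxE eqxx mulr1n expr2.
rewrite /sigma; suff -> : xget 0 (is_singular_values M) = l by [].
have: is_singular_values M (xget 0 (is_singular_values M)) by apply: xgetPex; exists l.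
move: (xget _ _) => s [s0 ss cs]; case: isl => _ _; rewrite cs => E.
pose sq (v : 'rV[R]_n) := [seq v 0 j ^+ 2 | j <- enum 'I_n].
have /prod_XsubC_eq pE : \prod_(x <- sq s) ('X - x%:P) = \prod_(x <- sq l) ('X - x%:P).
  have bE v : \prod_(x <- sq v) ('X - x%:P) = \prod_(k < n) ('X - (v 0 k ^+ 2)%:P).
    by rewrite /sq big_map big_enum.
  by rewrite !bE.
have srt (v : 'rV[R]_n) : (forall j, 0 <= v 0 j) -> (forall j k : 'I_n, (j <= k)%N -> v 0 k <= v 0 j) ->
    sorted >=%O (sq v).
  move=> v0 sv; apply: (@homo_sorted _ _ _ (fun j k : 'I_n => (j < k)%N)).
    move=> j k jk; suff : v 0 k ^+ 2 <= v 0 j ^+ 2 by [].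
    by rewrite ler_sqr ?nnegrE// sv// ltnW.
  have := iota_ltn_sorted 0 n; rewrite -val_enum_ord sorted_map; exact.
have eqs : sq s = sq l.
  apply: (@sorted_eq _ >=%O) pE; rewrite ?srt//.
  - by move=> x y z yx zx; exact: le_trans zx yx.
  - by move=> x y /andP[xy yx]; apply/le_anti/andP; split.
apply/rowP => j.
have /eqP : s 0 j ^+ 2 = l 0 j ^+ 2.
  have ej (v : 'rV[R]_n) : nth 0 (sq v) j = v 0 j ^+ 2.
    by rewrite (nth_map j) ?size_enum_ord// nth_ord_enum.
  by rewrite -!ej eqs.
by rewrite eqrXn2// => /eqP.
Qed.

Lemma pseudoinverseP n (M : 'M[R]_n) : symmetric_psd M ->
  is_pseudoinverse M (pseudoinverse M).
Proof.
move=> pM; apply: xgetPex.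
have [V oV [l -> _]] := spectral_psd pM.
have VV := orthomxT oV.
(* The inverse of 0 is 0, so inverting [l] entrywise inverts the nonzero eigenvalues and keeps the
   kernel. *)
exists (V^T *m diag_mx (map_mx GRing.inv l) *m V).
have mulV (D E : 'M[R]_n) : V^T *m D *m V *m (V^T *m E *m V) = V^T *m (D *m E) *m V.
  by rewrite !mulmxA -(mulmxA _ V V^T) (oV : V *m V^T = _) mulmx1.
have lE : diag_mx l *m diag_mx (map_mx GRing.inv l) = diag_mx (\row_i (l 0 i != 0)%:R).
  rewrite mulmx_diag; congr diag_mx; apply/rowP => i; rewrite !mxE.
  by case: eqVneq => [->|l0]; rewrite ?mul0r// mulfV.
have lC : diag_mx (map_mx GRing.inv l) *m diag_mx l = diag_mx (\row_i (l 0 i != 0)%:R).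
  by rewrite -lE diag_mxC.
split; rewrite !mulV ?lE ?lC.
- congr (_ *m _ *m _); rewrite mulmx_diag; congr diag_mx; apply/rowP => i; rewrite !mxE.
  by case: eqVneq => [->|l0]; rewrite ?mul0r// mul1r.
- congr (_ *m _ *m _); rewrite mulmx_diag; congr diag_mx; apply/rowP => i; rewrite !mxE.
  by case: eqVneq => [->|l0]; rewrite ?mul0r ?invr0// mul1r.
- by rewrite !trmx_mul trmxK tr_diag_mx mulmxA.
- by rewrite !trmx_mul trmxK tr_diag_mx mulmxA.
Qed.

Lemma gram_eq0 m n (M : 'M[R]_(m, n)) : M^T *m M = 0 -> M = 0.
Proof.
move=> M0; apply/trmx_inj; rewrite trmx0; apply/row_matrixP => i; rewrite row0.
apply/eqP; rewrite -sqn_eq0; apply/eqP; move/matrixP/(_ i i): M0; rewrite !mxE => <-.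
by apply: eq_bigr => k _; rewrite !mxE expr2.
Qed.

Lemma psd_factor n (M : 'M[R]_n) : symmetric_psd M -> exists S : 'M[R]_n, M = S^T *m S.
Proof.
move=> /spectral_psd[V oV [l -> [l0 _]]].
exists (diag_mx (map_mx Num.sqrt l) *m V).
rewrite trmx_mul tr_diag_mx !mulmxA -[in RHS](mulmxA V^T) mulmx_diag.
by congr (_ *m diag_mx _ *m _); apply/rowP => i; rewrite !mxE -expr2 sqr_sqrtr.
Qed.

(** Completing the square in [Y]. When [A] is positive semi-definite, Y = D^T minimizes the left
    side, and the last trace is the excess over the minimum. *)
Lemma tr_square_expand n N (B : 'M[R]_n) (Om : 'M[R]_(n, N)) (A : 'M[R]_N)
    (D : 'M[R]_(n, N)) (Y : 'M[R]_(N, n)) :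
  B^T = B -> A = Om^T *m B *m Om -> B *m Om = D *m A ->
  \tr ((1%:M - Om *m Y)^T *m B *m (1%:M - Om *m Y)) =
  \tr B - \tr (D *m A *m D^T) + \tr ((Y - D^T)^T *m A *m (Y - D^T)).
Proof.
move=> sB eA BOm.
have tA : A^T = A by rewrite eA !trmx_mul trmxK sB mulmxA.
have trC : \tr (Y^T *m A *m D^T) = \tr (D *m A *m Y).
  by rewrite -mxtrace_tr !trmx_mul !trmxK tA mulmxA.
have tr1 : \tr ((Om *m Y)^T *m B) = \tr (D *m A *m Y).
  by rewrite -mxtrace_tr trmx_mul trmxK sB mulmxA BOm.
have tr2 : \tr (B *m (Om *m Y)) = \tr (D *m A *m Y) by rewrite mulmxA BOm.
have tr3 : \tr ((Om *m Y)^T *m B *m (Om *m Y)) = \tr (Y^T *m A *m Y).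
  by rewrite trmx_mul eA !mulmxA.
have expand m p (U V : 'M[R]_(m, p)) (M : 'M[R]_m) :
    \tr ((U - V)^T *m M *m (U - V)) =
    \tr (U^T *m M *m U) - \tr (U^T *m M *m V) - \tr (V^T *m M *m U) + \tr (V^T *m M *m V).
  rewrite (linearB (@trmx R m p))/= mulmxBl mulmxBl mulmxBr mulmxBr.
  by rewrite (linearB (@mxtrace R p))/= !(linearB (@mxtrace R p))/=; ring.
by rewrite !expand trmx1 !mul1mx !mulmx1 trmxK tr1 tr2 tr3 trC; ring.
Qed.

Section nystrom_algebra.
Variables (n N : nat) (B : 'M[R]_n) (Om : 'M[R]_(n, N)).
Hypothesis pB : symmetric_psd B.

Let C := B *m Om.
Let A := Om^T *m B *m Om.
Let D := C *m pseudoinverse A.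

Let sB : B^T = B. Proof. by case: pB. Qed.

Lemma psd_congr m (Y : 'M[R]_(n, m)) : symmetric_psd (Y^T *m B *m Y).
Proof.
split; first by rewrite !trmx_mul trmxK sB mulmxA.
by move=> x; have [_ /(_ (Y *m x))] := pB; rewrite trmx_mul !mulmxA.
Qed.

Lemma psd_tr m (M : 'M[R]_m) : symmetric_psd M -> 0 <= \tr M.
Proof.
move=> [_ pM]; apply: sumr_ge0 => i _.
have := pM (delta_mx i 0); by rewrite trmx_delta -rowE -colE !mxE.
Qed.

Let pA : symmetric_psd A. Proof. exact: psd_congr. Qed.

Let tA : A^T = A. Proof. by case: pA. Qed.

(** With B = S^T S and Z = Om (A^+ A - 1), the Gram matrix of S Z is (A^+ A - 1)^T A (A^+ A - 1),
    which vanishes because A A^+ A = A. So S Z = 0 and hence B Z = 0. *)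
Lemma mul_pseudoinverse_range : C = D *m A.
Proof.
have [AXA _ _ _] := pseudoinverseP pA.
have [S eS] := psd_factor pB.
pose Z := Om *m (pseudoinverse A *m A - 1%:M).
have SZ : S *m Z = 0.
  apply: gram_eq0; rewrite trmx_mul mulmxA -(mulmxA Z^T) -eS.
  rewrite /Z trmx_mul -!mulmxA (mulmxA Om^T) (mulmxA (Om^T *m B)) -/A.
  by rewrite [A *m _]mulmxBr mulmx1 (mulmxA A) AXA subrr mulmx0.
apply/esym/eqP; rewrite -subr_eq0 /D /C -!mulmxA -[X in _ - B *m X]mulmx1 -!mulmxBr.
by rewrite -/Z eS -mulmxA SZ mulmx0.
Qed.

Lemma nystrom_quadratic : nystrom B Om = D *m A *m D^T.
Proof.
rewrite /nystrom -/C -/A -/D.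
by rewrite [in LHS]mul_pseudoinverse_range trmx_mul tA mulmxA.
Qed.

Lemma tr_quadratic (Y : 'M[R]_(N, n)) :
  \tr ((1%:M - Om *m Y)^T *m B *m (1%:M - Om *m Y)) =
  \tr B - \tr (nystrom B Om) + \tr ((Y - D^T)^T *m A *m (Y - D^T)).
Proof.
rewrite nystrom_quadratic; apply: tr_square_expand => //.
exact: mul_pseudoinverse_range.
Qed.

(** The gap is the value of the quadratic form at its minimum point Y = D^T, which is the trace of a
    positive semi-definite matrix. *)
Lemma nystrom_gap_ge0 : 0 <= \tr B - \tr (nystrom B Om).
Proof.
have := psd_tr (psd_congr (1%:M - Om *m D^T)).
by rewrite tr_quadratic subrr trmx0 !mul0mx mxtrace0 addr0.
Qed.

Lemma nystrom_gap_le (Y : 'M[R]_(N, n)) : \tr B - \tr (nystrom B Om) <=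
  \tr ((1%:M - Om *m Y)^T *m B *m (1%:M - Om *m Y)).
Proof.
rewrite tr_quadratic lerDl; apply: psd_tr.
have := psd_congr (Om *m (Y - D^T)).
by rewrite trmx_mul /A !mulmxA.
Qed.

End nystrom_algebra.

Lemma psd_gram m n (M : 'M[R]_(m, n)) : symmetric_psd (M^T *m M).
Proof.
split; first by rewrite trmx_mul trmxK.
move=> x; rewrite mulmxA -trmx_mul -mulmxA mxE; apply: sumr_ge0 => i _.
by rewrite !mxE -expr2 sqr_ge0.
Qed.

Lemma psd_add_scalar_unit n (M : 'M[R]_n) e : symmetric_psd M -> 0 < e ->
  M + e%:M \in unitmx.
Proof.
move=> /symmetric_psdP[_ pM] e0; rewrite -row_free_unit; apply: inj_row_free => v v0.
apply/eqP; rewrite -sqn_eq0 eq_le sqn_ge0 andbT -(pmulr_rle0 _ e0).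
have := congr1 (fun w => (w *m v^T) 0 0) v0.
rewrite mul0mx [RHS]mxE mulmxDr mulmxDl mul_mx_scalar -scalemxAl.
by rewrite [LHS]mxE [X in _ + X]mxE sqnE; have := pM v; lra.
Qed.

(** Turns full row rank into the non-vanishing of a determinant, which is a measurable condition,
    and makes M^T (M M^T)^-1 a right inverse. *)
Lemma row_free_gram_unit m n (M : 'M[R]_(m, n)) : row_free M = (M *m M^T \in unitmx).
Proof.
apply/idP/idP => [fM|]; last first.
  rewrite -row_free_unit -!kermx_eq0 => /eqP k0.
  by rewrite -submx0 -k0; apply/sub_kermxP; rewrite mulmxA mulmx_ker mul0mx.
rewrite -row_free_unit; apply: inj_row_free => v v0.
have : v *m M = 0.
  by apply/eqP; rewrite -sqn_eq0 -sqnE trmx_mul mulmxA -(mulmxA v) v0 mul0mx mxE.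
by move/eqP; rewrite mulmx_free_eq0// => /eqP.
Qed.

(** This is W2 W1^+ when [W1] has full row rank. Otherwise [invmx] returns its argument and the
    value has no meaning. *)
Definition lstsq r m N (W1 : 'M[R]_(r, N)) (W2 : 'M[R]_(m, N)) : 'M[R]_(m, r) :=
  W2 *m (W1^T *m invmx (W1 *m W1^T)).

(** For Y = G V1, with V1 the first r rows of [V] and V2 the others, the top block of V (1 - Om Y)
    vanishes, so the leading eigenvalues drop out. The bottom block V2 - x V1 has rows of squared
    norm 1 + |x_i|^2, since the rows of [V] are orthonormal. *)
Lemma nystrom_gap_lstsq r m N (V : 'M[R]_(r + m)) (l : 'rV[R]_(r + m))
    (Om : 'M[R]_(r + m, N)) (B := V^T *m diag_mx l *m V) (W := V *m Om) :
  symmetric_psd B -> orthomx V -> row_free (usubmx W) ->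
  \tr B - \tr (nystrom B Om) <= \sum_(i < m) l 0 (rshift r i) *
    (1 + \sum_(j < r) (lstsq (usubmx W) (dsubmx W) i j) ^+ 2).
Proof.
move=> pB oV fW; set x := lstsq _ _.
pose G := (usubmx W)^T *m invmx (usubmx W *m (usubmx W)^T).
have WG : usubmx W *m G = 1%:M by rewrite mulmxA mulmxV// -row_free_gram_unit.
apply: (le_trans (nystrom_gap_le Om pB (G *m usubmx V))).
pose F := dsubmx V - x *m usubmx V.
have EE : V *m (1%:M - Om *m (G *m usubmx V)) = col_mx 0 F.
  have WGc : W *m G = col_mx 1%:M x by rewrite -{1}(vsubmxK W) mul_col_mx WG.
  have -> : V *m (1%:M - Om *m (G *m usubmx V)) = V - W *m G *m usubmx V.
    by rewrite mulmxBr mulmx1 /W !mulmxA.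
  by rewrite WGc mul_col_mx mul1mx -{1}(vsubmxK V) opp_col_mx add_col_mx subrr.
have key E : \tr (E^T *m B *m E) = \tr (diag_mx l *m ((V *m E) *m (V *m E)^T)).
  by rewrite mulmxA [RHS]mxtrace_mulC trmx_mul /B !mulmxA.
rewrite key EE.
rewrite /mxtrace (eq_bigr (fun k => l 0 k * (col_mx 0 F *m (col_mx 0 F)^T) k k)); last first.
  by move=> k _; rewrite mul_diag_mx mxE.
rewrite big_split_ord/= big1 ?add0r => [|i _]; last first.
  by rewrite tr_col_mx mul_col_row block_mxEul trmx0 mulmx0 mxE mulr0.
apply: ler_sum => i _; rewrite le_eqVlt; apply/orP; left; apply/eqP; congr (_ * _).
rewrite tr_col_mx mul_col_row block_mxEdr.
have [VV1 VV2 VV3] : [/\ usubmx V *m (usubmx V)^T = 1%:M,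
    dsubmx V *m (dsubmx V)^T = 1%:M & dsubmx V *m (usubmx V)^T = 0].
  have := oV; rewrite /orthomx -{1 2}(vsubmxK V) tr_col_mx mul_col_row.
  by rewrite (@scalar_mx_block _ r m) => /eq_block_mx[].
rewrite /F linearB/= mulmxBl !mulmxBr VV2 trmx_mul !mulmxA VV3 mul0mx subr0.
rewrite -(mulmxA x) -[usubmx V *m _]trmxK trmx_mul trmxK VV3 trmx0 mulmx0 sub0r opprK.
rewrite -(mulmxA x) VV1 mulmx1 2!mxE eqxx mulr1n; congr (_ + _).
by rewrite mxE; apply: eq_bigr => j _; rewrite expr2 [x^T j i]mxE.
Qed.

(** With M = A + e, the identity A - A M^-1 A = e A M^-1 reduces the claim to bounds on tr (D A M^-1
    D^T), where A M^-1 has its spectrum in [0, 1]. *)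
Lemma regularized_inverse_bound n N (A : 'M[R]_N) (D : 'M[R]_(n, N)) e :
  symmetric_psd A -> 0 < e ->
  0 <= \tr (D *m A *m D^T) - \tr (D *m A *m invmx (A + e%:M) *m (D *m A)^T) <= e * \tr (D *m D^T).
Proof.
move=> pA e0; set M := A + e%:M.
have uM : M \in unitmx by exact: psd_add_scalar_unit.
have tA : A^T = A by case: pA.
have tM : M^T = M by rewrite linearD/= tA tr_scalar_mx.
have tMV : (invmx M)^T = invmx M by rewrite trmx_inv tM.
have eA : A = M - e%:M by rewrite addrK.
have AMe : A *m invmx M = 1%:M - e *: invmx M.
  by rewrite {1}eA mulmxBl mulmxV// mul_scalar_mx.
have MAe : invmx M *m A = 1%:M - e *: invmx M.
  by rewrite {1}eA mulmxBr mulVmx// mul_mx_scalar.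
have AMA : A - A *m invmx M *m A = e *: (A *m invmx M).
  by rewrite AMe mulmxBl mul1mx -scalemxAl MAe opprB addrC subrK.
pose Z := invmx M *m D^T.
have ZD : Z^T = D *m invmx M by rewrite trmx_mul trmxK tMV.
have trZA : 0 <= \tr (Z^T *m A *m Z) by apply/psd_tr/psd_congr.
have trZ : 0 <= \tr (Z^T *m Z) by apply/psd_tr/psd_gram.
have trZAA : 0 <= \tr (Z^T *m A *m A *m Z).
  by have := psd_tr (psd_gram (A *m Z)); rewrite trmx_mul tA !mulmxA.
have -> : \tr (D *m A *m D^T) - \tr (D *m A *m invmx M *m (D *m A)^T) =
    e * \tr (D *m (A *m invmx M) *m D^T).
  rewrite -mxtraceZ scalemxAl scalemxAr -AMA mulmxBr mulmxBl linearB/=.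
  by rewrite trmx_mul tA !mulmxA.
have DZ : D = Z^T *m M by rewrite ZD mulmxKV.
have MZ : D^T = M *m Z by rewrite mulKVmx.
have up : \tr (D *m (A *m invmx M) *m D^T) =
    \tr (D *m D^T) - e * (\tr (Z^T *m A *m Z) + e * \tr (Z^T *m Z)).
  rewrite AMe mulmxBr mulmx1 mulmxBl linearB/= -scalemxAr -scalemxAl linearZ/=.
  congr (_ - e * _); rewrite -ZD [in LHS]MZ mulmxA mulmxDr mulmxDl linearD/=.
  by rewrite mul_mx_scalar -scalemxAl linearZ.
have lo : \tr (D *m (A *m invmx M) *m D^T) =
    \tr (Z^T *m A *m A *m Z) + e * \tr (Z^T *m A *m Z).
  rewrite mulmxA -mulmxA -/Z [in LHS]DZ mulmxDr mulmxDl mulmxDl linearD/=.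
  by rewrite mul_mx_scalar -!scalemxAl linearZ.
apply/andP; split; first by rewrite mulr_ge0 ?(ltW e0)// lo addr_ge0// mulr_ge0 ?(ltW e0).
rewrite ler_pM2l// up lerBlDr lerDl mulr_ge0 ?(ltW e0)// addr_ge0// mulr_ge0 ?(ltW e0)//.
Qed.

Section regularized.
Variables (n N : nat) (B : 'M[R]_n) (Om : 'M[R]_(n, N)).
Hypothesis pB : symmetric_psd B.
Let C := B *m Om.
Let A := Om^T *m B *m Om.

(** The pseudoinverse is not continuous. Approximating it pointwise by true inverses is what makes
    the Nystrom trace measurable. *)
Lemma nystrom_regularized_cvg :
  (fun k => \tr (C *m invmx (A + (k.+1%:R^-1)%:M) *m C^T)) @ \oo --> \tr (nystrom B Om).
Proof.
pose D := C *m pseudoinverse A; pose K := \tr (D *m D^T).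
have CDA : C = D *m A := mul_pseudoinverse_range Om pB.
have k0 k : 0 < k.+1%:R^-1 :> R by rewrite invr_gt0.
have bnd k := regularized_inverse_bound D (psd_congr pB Om) (k0 k).
apply: (@squeeze_cvgr _ _ _ _ (fun k => \tr (nystrom B Om) - k.+1%:R^-1 * K) (fun=> \tr (nystrom B Om))).
- apply: nearW => k; rewrite nystrom_quadratic// -/D CDA.
  have /andP[] := bnd k; rewrite -/A -/K => ? ?.
  by apply/andP; split; [rewrite lerBlDl -lerBlDr|rewrite -subr_ge0].
- have : (fun k => \tr (nystrom B Om) - k.+1%:R^-1 * K) @ \oo --> \tr (nystrom B Om) - 0 * K.
    apply: cvgB; first exact: cvg_cst.
    by apply: cvgM; [exact: cvg_harmonic|exact: cvg_cst].
  by rewrite mul0r subr0.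
- exact: cvg_cst.
Qed.

End regularized.

End orthogonal.

(** * Standard Gaussian vectors *)

Section density.
Local Open Scope ereal_scope.
Context d (T : measurableType d) (R : realType).
Variables (mu nu : {measure set T -> \bar R}) (p : T -> R).
Hypotheses (p0 : forall x, (0 <= p x)%R) (mp : measurable_fun setT p).
Hypothesis nuE : forall A, measurable A -> nu A = \int[mu]_(x in A) (p x)%:E.

Import HBNNSimple.

Let integral_density_nnsfun (h : {nnsfun T >-> R}) :
  \int[nu]_x (h x)%:E = \int[mu]_x ((h x)%:E * (p x)%:E).
Proof.
have mEp : measurable_fun [set: T] (EFin \o p) by apply/measurable_EFinP.
have mind r : measurable_fun [set: T] (EFin \o \1_(h @^-1` [set r]) : T -> \bar R).
  by apply/measurable_EFinP; exact: measurable_indic.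
under [LHS]eq_integral do rewrite fimfunE -fsumEFin//.
rewrite [LHS]ge0_integral_fsum//; last 2 first.
  - by move=> r; exact/measurable_EFinP/measurableT_comp.
  - by move=> n x _; rewrite EFinM nnfun_muleindic_ge0.
under [RHS]eq_integral.
  move=> x xD; rewrite fimfunE -fsumEFin// ge0_mule_fsuml; last first.
    by move=> r; rewrite EFinM nnfun_muleindic_ge0.
  over.
rewrite [RHS]ge0_integral_fsum//; last 2 first.
  - move=> r; apply: emeasurable_funM => //.
    by apply/measurable_EFinP; apply: measurable_funM.
  - by move=> n x _; apply: mule_ge0; [rewrite EFinM nnfun_muleindic_ge0|rewrite lee_fin].
apply: eq_fsbigr => r _; rewrite integralZl_indic_nnsfun//= integral_indic// setIT.
have [r0|r0] := leP 0%R r; last first.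
  rewrite preimage_nnfun0// measure0 mule0 integral0_eq// => x _.
  by rewrite indic0 mulr0 mul0e.
rewrite nuE// integral_mkcond -ge0_integralZl//; last 2 first.
- by apply/(measurable_restrictT _ _).1 => //; exact: measurable_funS mEp.
- by move=> x _; rewrite patchE; case: ifP => _; rewrite ?lee_fin.
by apply: eq_integral => x _; rewrite patchE indicE; case: ifP => _; rewrite ?mulr1 ?mulr0 ?mule0 ?mul0e.
Qed.

(** On simple functions this is [nuE] and linearity; monotone convergence on both sides does the
    rest. *)
Lemma integral_density f : measurable_fun setT f -> (forall x, 0 <= f x) ->
  \int[nu]_x f x = \int[mu]_x (f x * (p x)%:E).
Proof.
move=> mf f0.
have mEp : measurable_fun [set: T] (EFin \o p) by apply/measurable_EFinP.
pose h := nnsfun_approx measurableT mf.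
transitivity (lim (\int[nu]_x (h n x)%:E @[n --> \oo])).
  rewrite -monotone_convergence//=.
  - by apply: eq_integral => x _; apply/esym/cvg_lim => //=; exact: cvg_nnsfun_approx.
  - by move=> n; exact/measurable_EFinP/measurable_funTS.
  - by move=> n ? _; rewrite lee_fin.
  - by move=> ? _ ? ? mn; rewrite lee_fin; exact/lefP/nd_nnsfun_approx.
transitivity (lim (\int[mu]_x ((h n x)%:E * (p x)%:E) @[n --> \oo])).
  by under eq_fun do rewrite integral_density_nnsfun.
rewrite -monotone_convergence//=.
- apply: eq_integral => x _; apply/cvg_lim => //=.
  by apply: cvgeZr => //; exact: cvg_nnsfun_approx.
- by move=> n; apply: emeasurable_funM => //; exact/measurable_EFinP/measurable_funTS.
- by move=> n ? _; rewrite mule_ge0// lee_fin.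
- by move=> ? _ ? ? mn; rewrite lee_wpmul2r ?lee_fin//; exact/lefP/nd_nnsfun_approx.
Qed.

End density.

Section lebesgue_affine.
Local Open Scope ereal_scope.
Variable R : realType.
Notation leb := (@lebesgue_measure R).

(** By uniqueness of Lebesgue measure it suffices that |a| times the image measure under x -> a x +
    b gives each half-open interval its length. *)
Lemma integral_lebesgue_affine (a b : R) (f : R -> \bar R) : a != 0%R ->
  measurable_fun setT f -> (forall x, 0 <= f x) ->
  \int[leb]_x f (a * x + b)%R = `|a|^-1%:E * \int[leb]_x f x.
Proof.
move=> a0 mf f0.
pose g (x : measurableTypeR R) : measurableTypeR R := (a * x + b)%R.
have mg : measurable_fun setT g.
  by apply: measurable_funD => //; apply: measurable_funM.
have na : (0 <= `|a|)%R by [].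
have lebE A : measurable A -> leb A = mscale (NngNum na) (pushforward leb g) A.
  move=> mA; apply: lebesgue_measure_unique mA => //= _ [[u v] _ <-]/=.
  rewrite /mscale/= /pushforward.
  (* For a < 0 the preimage is closed on the left instead of the right, with the same length. *)
  have [agt0|ale0] := ltP 0%R a.
    have -> : g @^-1` `]u, v]%classic = `]((u - b) / a)%R, ((v - b) / a)%R]%classic.
      by apply/seteqP; split => x /=; rewrite !in_itv/= ltr_pdivrMr// ler_pdivlMr// ltrBlDr lerBrDr (mulrC x).
    rewrite !lebesgue_measure_itv/= !lte_fin ltr_pM2r ?invr_gt0// ltrD2r.
    case: ifP => _; last by rewrite mule0.
    by rewrite -!EFinB -EFinM gtr0_norm//; congr EFin; field.
  have alt0 : (a < 0)%R by rewrite lt_neqAle a0.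
  have -> : g @^-1` `]u, v]%classic = `[((v - b) / a)%R, ((u - b) / a)%R[%classic.
    by apply/seteqP; split => x /=; rewrite !in_itv/= ltr_ndivlMr// ler_ndivrMr// ltrBlDr lerBrDr (mulrC x) andbC.
  rewrite !lebesgue_measure_itv/= !lte_fin ltr_nM2r ?invr_lt0// ltrD2r.
  case: ifP => _; last by rewrite mule0.
  by rewrite -!EFinB -EFinM ltr0_norm//; congr EFin; field.
have -> : \int[leb]_x f x = \int[mscale (NngNum na) (pushforward leb g)]_x f x.
  by move=> m; apply: eq_measure_integral => A mA _; exact: (lebE m).
rewrite ge0_integral_mscale// ge0_integral_pushforward// muleA -EFinM/= mulVf ?normr_eq0// mul1e.
by [].
Qed.

End lebesgue_affine.

Lemma eq_mfun d d' (T : measurableType d) (T' : measurableType d') (f g : T -> T') :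
  f =1 g -> measurable_fun setT g -> measurable_fun setT f.
Proof. by move=> /funext ->. Qed.

(** * The coordinate sigma-algebra on matrices *)

Section matrix_measurable.
Context (R : realType) (m n : nat).

Definition mx_entries : set (set 'M[R]_(m, n)) :=
  \bigcup_(ij in [set: 'I_m * 'I_n])
    preimage_set_system setT (fun M : 'M[R]_(m, n) => (M ij.1 ij.2 : measurableTypeR R)) measurable.

Definition mx_measurable : set (set 'M[R]_(m, n)) := <<s mx_entries >>.

Let mx_measurable0 : mx_measurable set0. Proof. exact: sigma_algebra0. Qed.

Let mx_measurableC A : mx_measurable A -> mx_measurable (~` A).
Proof. exact: sigma_algebraC. Qed.

Let mx_measurable_bigcup (F : _^nat) : (forall i, mx_measurable (F i)) ->
  mx_measurable (\bigcup_i (F i)).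
Proof. exact: sigma_algebra_bigcup. Qed.

Definition mx_display : measure_display. Proof. exact. Qed.

HB.instance Definition _ := @isMeasurable.Build mx_display 'M[R]_(m, n)
  mx_measurable mx_measurable0 mx_measurableC mx_measurable_bigcup.

Lemma measurable_entry i j :
  measurable_fun setT (fun M : 'M[R]_(m, n) => (M i j : measurableTypeR R)).
Proof.
move=> _ A mA; rewrite setTI; apply: sub_sigma_algebra.
by exists (i, j) => //; exists A => //; rewrite setTI.
Qed.

Lemma measurable_mxP d (T : measurableType d) (f : T -> 'M[R]_(m, n)) :
  measurable_fun setT f <->
  forall i j, measurable_fun setT (fun w => (f w i j : measurableTypeR R)).
Proof.
split=> [mf i j|mf].
  exact: (measurableT_comp (measurable_entry i j) mf).
apply: (measurability mx_entries) => //.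
move=> _ [_ [[i j] _ [A mA <-]] <-].
by rewrite !setTI; have := mf i j measurableT A mA; rewrite setTI.
Qed.

End matrix_measurable.

(** * Gaussian measures by recursion on the dimension *)

Section gaussian_vector.
Local Open Scope ereal_scope.
Variable R : realType.
Notation leb := (@lebesgue_measure R).
Notation N01 := (normal_prob (0%R : R) 1%R : probability (measurableTypeR R) R).

Definition row_cons m (xv : measurableTypeR R * 'rV[R]_m) : 'rV[R]_m.+1 :=
  row_mx (xv.1%:M : 'M[R]_1) xv.2.

Lemma measurable_row_mx d (T : measurableType d) m1 m2
    (f : T -> 'rV[R]_m1) (g : T -> 'rV[R]_m2) :
  measurable_fun setT f -> measurable_fun setT g ->
  measurable_fun setT (fun w => row_mx (f w) (g w)).
Proof.
move=> /measurable_mxP mf /measurable_mxP mg; apply/measurable_mxP => i j.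
case: (split_ordP j) => k ->.
- by under eq_fun do rewrite row_mxEl; exact: mf.
- by under eq_fun do rewrite row_mxEr; exact: mg.
Qed.

Lemma measurable_row_cons m : measurable_fun setT (@row_cons m).
Proof.
have := @measurable_row_mx _ (measurableTypeR R * 'rV[R]_m)%type 1 m
  (fun xv => xv.1%:M) snd; apply => //.
apply/measurable_mxP => i j; rewrite !ord1.
under eq_fun do rewrite mxE eqxx mulr1n.
exact: measurable_fst.
Qed.

HB.instance Definition _ m :=
  isMeasurableFun.Build _ _ _ _ (@row_cons m) (@measurable_row_cons m).

(** The coordinates are added one at a time so that Tonelli's theorem gives inductions on the
    dimension; in dimension 0 the measure is a point mass. *)
Fixpoint gauss m : probability 'rV[R]_m R :=
  match m with
  | 0 => dirac (0%R : 'rV[R]_0)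
  | m'.+1 => distribution (N01 \x gauss m') (@row_cons m')
  end.

Lemma integral_gauss0 (F : 'rV[R]_0 -> \bar R) : measurable_fun setT F ->
  \int[gauss 0]_v F v = F 0%R.
Proof. by move=> mF; rewrite integral_dirac// diracT mul1e. Qed.

Lemma integral_gaussS m (F : 'rV[R]_m.+1 -> \bar R) :
  measurable_fun setT F -> (forall v, 0 <= F v) ->
  \int[gauss m.+1]_v F v = \int[N01]_x \int[gauss m]_v F (row_cons (x, v)).
Proof.
move=> mF F0; rewrite ge0_integral_distribution// fubini_tonelli1//.
  exact: measurableT_comp.
by move=> x; exact: F0.
Qed.

(** This order of integration serves maps that shift the first coordinate by an amount depending on
    the others. *)
Lemma integral_gaussS_swap m (F : 'rV[R]_m.+1 -> \bar R) :
  measurable_fun setT F -> (forall v, 0 <= F v) ->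
  \int[gauss m.+1]_v F v = \int[gauss m]_v \int[N01]_x F (row_cons (x, v)).
Proof.
move=> mF F0; rewrite ge0_integral_distribution// fubini_tonelli2//.
  exact: measurableT_comp.
by move=> x; exact: F0.
Qed.

Definition gdens : R -> R := normal_pdf 0%R 1%R.

Lemma gdensE x : gdens x = (normal_peak 1 * expR (- (x ^+ 2 / 2)))%R.
Proof. by rewrite /gdens normal_pdfE ?oner_eq0//= /normal_fun subr0 expr1n mulNr. Qed.

Lemma measurable_gdens : measurable_fun setT gdens.
Proof. exact: measurable_normal_pdf. Qed.

Lemma integral_N01 (f : R -> \bar R) : measurable_fun setT f -> (forall x, 0 <= f x) ->
  \int[N01]_x f x = \int[leb]_x (f x * (gdens x)%:E).
Proof.
move=> mf f0; apply: integral_density => // [x|]; first exact: normal_pdf_ge0.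
exact: measurable_gdens.
Qed.

(* Integration against Lebesgue measure, up to a constant factor, written so
   that only the probability measures [gauss m] are needed. *)
Fact jint_key : unit. Proof. by []. Qed.

Definition jint m : ('rV[R]_m -> \bar R) -> \bar R := locked_with jint_key
  (fun F => \int[gauss m]_v (F v * (expR (sqn v / 2))%:E)).

Lemma jintE m (F : 'rV[R]_m -> \bar R) :
  jint F = \int[gauss m]_v (F v * (expR (sqn v / 2))%:E).
Proof. by rewrite /jint unlock. Qed.

Lemma measurable_sqn m : measurable_fun setT (@sqn R m).
Proof.
apply: measurable_sum => i; apply: measurable_funX.
exact: measurable_entry.
Qed.

Let mexp m : measurable_fun setT (fun v : 'rV[R]_m => (expR (sqn v / 2))%:E).
Proof.
apply/measurable_EFinP; apply: measurableT_comp => //.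
by apply: measurable_funM => //; exact: measurable_sqn.
Qed.

Lemma sqn_row_cons m x (v : 'rV[R]_m) : sqn (row_cons (x, v)) = (x ^+ 2 + sqn v)%R.
Proof. by rewrite (@sqn_row_mx R 1 m) /= {1}/sqn big_ord1 mxE eqxx mulr1n. Qed.

Lemma measurable_jint d (T : measurableType d) m (G : T -> 'rV[R]_m -> \bar R) :
  measurable_fun setT (fun tv => G tv.1 tv.2) -> (forall t v, 0 <= G t v) ->
  measurable_fun setT (fun t => jint (G t)).
Proof.
move=> mG G0; apply: eq_mfun => [t|]; first exact: jintE.
apply: (@measurable_fun_fubini_tonelli_F _ _ _ _ _ _
  (fun tv => G tv.1 tv.2 * (expR (sqn tv.2 / 2))%:E)) => //.
- apply: emeasurable_funM => //.
  exact: (measurableT_comp (@mexp m) measurable_snd).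
- by move=> t; rewrite mule_ge0// lee_fin expR_ge0.
Qed.

Lemma jint_ge0 m (F : 'rV[R]_m -> \bar R) : (forall v, 0 <= F v) -> 0 <= jint F.
Proof.
by move=> F0; rewrite jintE; apply: integral_ge0 => v _; rewrite mule_ge0// lee_fin expR_ge0.
Qed.

Lemma gdens_expR x : (gdens x * expR (x ^+ 2 / 2) = normal_peak 1)%R.
Proof. by rewrite gdensE -mulrA -expRD addrC subrr expR0 mulr1. Qed.

Section jintS.
Variables (m : nat) (F : 'rV[R]_m.+1 -> \bar R).
Hypotheses (mF : measurable_fun setT F) (F0 : forall v, 0 <= F v).

Let mFe : measurable_fun setT (fun v => F v * (expR (sqn v / 2))%:E).
Proof. by apply: emeasurable_funM => //; exact: mexp. Qed.

Let Fe0 v : 0 <= F v * (expR (sqn v / 2))%:E.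
Proof. by rewrite mule_ge0// lee_fin expR_ge0. Qed.

Let peak0 : (0 <= normal_peak 1 :> R)%R. Proof. exact: normal_peak_ge0. Qed.

Let mFc : measurable_fun setT (fun xv => F (row_cons (xv.1, xv.2))).
Proof.
rewrite (_ : (fun xv => _) = F \o @row_cons m); last by apply/funext => -[].
exact: measurableT_comp.
Qed.

(** The weight exp (x^2 / 2) of the first coordinate cancels its Gaussian density up to the constant
    [normal_peak 1]. *)
Lemma jintS : jint F = (normal_peak 1)%:E * \int[leb]_x jint (fun v => F (row_cons (x, v))).
Proof.
have e1 : jint F = \int[leb]_x (\int[gauss m]_v
    (F (row_cons (x, v)) * (expR (sqn (row_cons (x, v)) / 2))%:E) * (gdens x)%:E).
  rewrite jintE integral_gaussS// integral_N01//; last by move=> x; exact: integral_ge0.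
  apply: (@measurable_fun_fubini_tonelli_F _ _ _ _ _ _
    (fun xv => F (row_cons (xv.1, xv.2)) * (expR (sqn (row_cons (xv.1, xv.2)) / 2))%:E));
    last by move=> xv; exact: Fe0.
  rewrite (_ : (fun xv => _) = (fun v => F v * (expR (sqn v / 2))%:E) \o @row_cons m).
    exact: measurableT_comp.
  by apply/funext => -[].
have mFx x : measurable_fun setT (fun v => F (row_cons (x, v))).
  exact: (measurableT_comp mFc (pair1_measurable x)).
have mj : measurable_fun setT (fun x : measurableTypeR R => jint (fun v => F (row_cons (x, v)))).
  exact: measurable_jint.
rewrite {}e1.
rewrite -ge0_integralZl//; last by move=> x _; exact: jint_ge0.
apply: eq_integral => x _.
have -> : \int[gauss m]_v (F (row_cons (x, v)) * (expR (sqn (row_cons (x, v)) / 2))%:E) =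
    (expR (x ^+ 2 / 2))%:E * jint (fun v => F (row_cons (x, v))).
  rewrite jintE -ge0_integralZl//.
  - apply: eq_integral => v _; rewrite sqn_row_cons mulrDl expRD EFinM.
    by rewrite muleCA.
  - by apply: emeasurable_funM => //; exact: mexp.
  - by move=> v _; rewrite mule_ge0// lee_fin expR_ge0.
by rewrite -(gdens_expR x) EFinM [LHS]muleC muleA.
Qed.

Lemma jintS_swap : jint F =
  jint (fun v => (normal_peak 1)%:E * \int[leb]_x F (row_cons (x, v))).
Proof.
rewrite !jintE integral_gaussS_swap//; apply: eq_integral => v _.
have mFv : measurable_fun setT (fun x : measurableTypeR R => F (row_cons (x, v))).
  exact: (measurableT_comp mFc (pair2_measurable v)).
rewrite integral_N01//; last first.
  rewrite (_ : (fun x => _) = (fun v => F v * (expR (sqn v / 2))%:E) \o (fun x => row_cons (x, v)))//.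
  apply: measurableT_comp => //.
  exact: (measurableT_comp (@measurable_row_cons m) (pair2_measurable v)).
have e1 : \int[leb]_x (F (row_cons (x, v)) * (expR (sqn (row_cons (x, v)) / 2))%:E * (gdens x)%:E) =
    \int[leb]_x ((normal_peak 1 * expR (sqn v / 2))%:E * F (row_cons (x, v))).
  apply: eq_integral => x _; rewrite sqn_row_cons mulrDl expRD.
  rewrite -muleA muleC -EFinM -(gdens_expR x); congr (_%:E * _); ring.
rewrite e1 ge0_integralZl//; last by rewrite lee_fin mulr_ge0 ?expR_ge0.
by rewrite EFinM muleAC.
Qed.

End jintS.

End gaussian_vector.

(** * Measurability of matrix operations *)

Section measurable_matrix_ops.
Context d (T : measurableType d) (R : realType).

Lemma measurable_invr : measurable_fun setT (fun x : measurableTypeR R => x^-1 : measurableTypeR R).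
Proof.
(* The inverse is not continuous at 0, but a real power of x^2 is measurable; at 0 both expressions
   are 0. *)
apply: (@eq_mfun _ _ (measurableTypeR R) (measurableTypeR R) _ (fun x : R => x * (x ^+ 2) `^ (-1))).
  move=> x; rewrite powR_inv1 ?sqr_ge0//.
  by have [->|x0] := eqVneq x 0; [rewrite invr0 mul0r|field].
apply: measurable_funM => //.
by apply: (measurableT_comp (measurable_powR _)) => //; exact: measurable_funX.
Qed.

Lemma measurable_mulmx m n p (f : T -> 'M[R]_(m, n)) (g : T -> 'M[R]_(n, p)) :
  measurable_fun setT f -> measurable_fun setT g ->
  measurable_fun setT (fun w => f w *m g w).
Proof.
move=> /measurable_mxP mf /measurable_mxP mg; apply/measurable_mxP => i j.
apply: eq_mfun => [w|]; first by rewrite mxE.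
by apply: measurable_sum => k; apply: measurable_funM; [exact: mf|exact: mg].
Qed.

Lemma measurable_addmx m n (f g : T -> 'M[R]_(m, n)) :
  measurable_fun setT f -> measurable_fun setT g ->
  measurable_fun setT (fun w => f w + g w).
Proof.
move=> /measurable_mxP mf /measurable_mxP mg; apply/measurable_mxP => i j.
apply: eq_mfun => [w|]; first by rewrite mxE.
by apply: measurable_funD; [exact: mf|exact: mg].
Qed.

Lemma measurable_trmx m n (f : T -> 'M[R]_(m, n)) :
  measurable_fun setT f -> measurable_fun setT (fun w => (f w)^T).
Proof.
move=> /measurable_mxP mf; apply/measurable_mxP => i j.
apply: eq_mfun => [w|]; first by rewrite mxE.
exact: mf.
Qed.

Lemma measurable_mxsub m n m' n' (f : T -> 'M[R]_(m, n)) (s : 'I_m' -> 'I_m) (t : 'I_n' -> 'I_n) :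
  measurable_fun setT f -> measurable_fun setT (fun w => mxsub s t (f w)).
Proof.
move=> /measurable_mxP mf; apply/measurable_mxP => i j.
apply: eq_mfun => [w|]; first by rewrite mxE.
exact: mf.
Qed.

Lemma measurable_reindex_mx m n m' n' (f : 'M[R]_(m, n) -> 'M[R]_(m', n'))
    (s : 'I_m' -> 'I_n' -> 'I_m) (t : 'I_m' -> 'I_n' -> 'I_n) :
  (forall M i j, f M i j = M (s i j) (t i j)) -> measurable_fun setT f.
Proof.
move=> fE; apply/measurable_mxP => i j.
apply: (@eq_mfun _ _ _ (measurableTypeR R) _ (fun M : 'M[R]_(m, n) => M (s i j) (t i j))).
  by move=> M; exact: fE.
exact: measurable_entry.
Qed.

Lemma measurable_lsubmx m n1 n2 : measurable_fun setT (@lsubmx R m n1 n2).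
Proof. by apply: measurable_reindex_mx => M i j; rewrite mxE. Qed.

Lemma measurable_rsubmx m n1 n2 : measurable_fun setT (@rsubmx R m n1 n2).
Proof. by apply: measurable_reindex_mx => M i j; rewrite mxE. Qed.

Lemma measurable_usubmx m1 m2 n : measurable_fun setT (@usubmx R m1 m2 n).
Proof. by apply: measurable_reindex_mx => M i j; rewrite mxE. Qed.

Lemma measurable_dsubmx m1 m2 n : measurable_fun setT (@dsubmx R m1 m2 n).
Proof. by apply: measurable_reindex_mx => M i j; rewrite mxE. Qed.

Lemma measurable_vec_mx m n : measurable_fun setT (@vec_mx R m n).
Proof. by apply: (measurable_reindex_mx (s := fun _ _ => ord0)) => M i j; rewrite mxE. Qed.

Lemma measurable_det n (f : T -> 'M[R]_n) :
  measurable_fun setT f -> measurable_fun setT (fun w => (\det (f w) : measurableTypeR R)).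
Proof.
move=> /measurable_mxP mf; apply: measurable_sum => s.
apply: measurable_funM => //; apply: measurable_prod => i _; exact: mf.
Qed.

Lemma measurable_invmx n (f : T -> 'M[R]_n) :
  measurable_fun setT f -> measurable_fun setT (fun w => invmx (f w)).
Proof.
move=> mf; have /measurable_mxP mfe := mf; apply/measurable_mxP => i j.
have mdet := measurable_det mf.
(* Cramer's rule where the determinant does not vanish; elsewhere [invmx] returns its argument. *)
rewrite (_ : (fun w => _) = (fun w => if \det (f w) != 0 then
    (\det (f w))^-1 * (\adj (f w)) i j else f w i j)); last first.
  by apply/funext => w; rewrite /invmx unitmxE unitfE; case: ifP => // _; rewrite mxE.
apply: measurable_fun_ifT => //.
- by apply: measurable_neg; apply: measurable_fun_eqr.
- apply: measurable_funM; first exact: (measurableT_comp measurable_invr).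
  apply: eq_mfun => [w|]; first by rewrite mxE.
  apply: measurable_funM => //.
  apply: measurable_det; apply/measurable_mxP => k l.
  apply: eq_mfun => [w|]; first by rewrite !mxE.
  exact: mfe.
Qed.

End measurable_matrix_ops.

(** * Linear substitutions by elimination *)

Section linear_change_of_variables.
Local Open Scope ereal_scope.
Variable R : realType.
Notation leb := (@lebesgue_measure R).

Lemma measurable_row_cons2 d (T : measurableType d) m (f : T -> R) (g : T -> 'rV[R]_m) :
  measurable_fun setT f -> measurable_fun setT g ->
  measurable_fun setT (fun t => row_cons (f t, g t)).
Proof.
move=> mf mg.
exact: (measurableT_comp (@measurable_row_cons R m) (measurable_fun_pair mf mg)).
Qed.

Lemma row_consP m (u : 'rV[R]_m.+1) : exists x v, u = row_cons (x, v).
Proof.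
exists (u ord0 ord0), (\row_j u ord0 (lift ord0 j)).
apply/rowP => i; rewrite mxE/=; case: splitP => j ij; rewrite !mxE.
  by rewrite !ord1 eqxx mulr1n; congr (u _ _); apply/val_inj; rewrite /= ij ord1.
by congr (u _ _); apply/val_inj; rewrite /= ij.
Qed.

Lemma row_consD m x y (u v : 'rV[R]_m) :
  (row_cons (x, u) + row_cons (y, v) = row_cons (x + y, u + v))%R.
Proof. by rewrite /row_cons/= (@add_row_mx R 1 1 m) -raddfD. Qed.

Lemma row_cons_block m x (v : 'rV[R]_m) a b c (S : 'M[R]_m) :
  (row_cons (x, v) *m block_mx (a%:M : 'M[R]_1) b c S =
   row_cons (x * a + (v *m c) 0 0, x *: b + v *m S))%R.
Proof.
rewrite /row_cons/= (@mul_row_block R 1 1 m 1 m) mul_scalar_mx scale_scalar_mx mul_scalar_mx.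
by rewrite [in LHS](mx11_scalar (v *m c)) -raddfD.
Qed.

Lemma jint_translate m (u : 'rV[R]_m) (F : 'rV[R]_m -> \bar R) :
  measurable_fun setT F -> (forall v, 0 <= F v) ->
  jint (fun v => F (v + u)%R) = jint F.
Proof.
elim: m u F => [|m IH] u F mF F0.
  by congr jint; apply/funext => v; congr F; apply/rowP => -[].
have [y [w ->]] := row_consP u.
have mFu : measurable_fun setT (fun v : 'rV[R]_m.+1 => F (v + row_cons (y, w))%R).
  by apply: measurableT_comp => //; exact: measurable_addmx.
rewrite !jintS//; congr (_ * _).
have mFx x : measurable_fun setT (fun v => F (row_cons (x, v))).
  by apply: measurableT_comp => //; exact: measurable_row_cons2.
under eq_integral.
  move=> x _; under eq_fun do rewrite row_consD.
  rewrite (IH w (fun v => F (row_cons (x + y, v)%R)))//.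
  over.
pose G (x : measurableTypeR R) := jint (fun v => F (row_cons (x, v))).
transitivity (\int[leb]_x G (1 * x + y)%R).
  by apply: eq_integral => x _; rewrite mul1r.
rewrite (integral_lebesgue_affine (f := G) y (oner_neq0 R)).
- by rewrite normr1 invr1 mul1e.
- apply: measurable_jint => //; apply: measurableT_comp => //.
  exact: measurable_row_cons2.
- by move=> x; exact: jint_ge0.
Qed.

(** The factor [k] plays the role of 1 / |det A|, but it is never identified with it. *)
Definition cv m (k : R) (A : 'M[R]_m) := forall F : 'rV[R]_m -> \bar R,
  measurable_fun setT F -> (forall v, 0 <= F v) ->
  jint (fun v => F (v *m A)) = k%:E * jint F.

Lemma cvM m k l (A B : 'M[R]_m) : cv k A -> cv l B -> cv (k * l)%R (A *m B).
Proof.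
move=> cA cB F mF F0.
have mFB : measurable_fun setT (fun v : 'rV[R]_m => F (v *m B)).
  by apply: measurableT_comp => //; exact: measurable_mulmx.
rewrite EFinM -muleA -cB// -cA//.
by congr jint; apply/funext => v; rewrite mulmxA.
Qed.

(** (x, v) becomes (x, v + x b): for fixed x this is a translation of v. *)
Lemma cv_shear_ur m (b : 'rV[R]_m) : cv 1%R (block_mx (1%:M : 'M[R]_1) b 0%R 1%:M).
Proof.
move=> F mF F0; rewrite mul1e !jintS//; last first.
  by apply: measurableT_comp => //; exact: measurable_mulmx.
congr (_ * _); apply: eq_integral => x _.
under eq_fun do rewrite row_cons_block mulr1 mulmx0 mulmx1 mxE addr0 addrC.
rewrite (jint_translate (x *: b) (F := fun v => F (row_cons (x, v))))//.
by apply: measurableT_comp => //; exact: measurable_row_cons2.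
Qed.

(** (x, v) becomes (x + v c, v): for fixed v this is a translation of x, so x has to be integrated
    innermost. *)
Lemma cv_shear_dl m (c : 'cV[R]_m) : cv 1%R (block_mx (1%:M : 'M[R]_1) 0%R c 1%:M).
Proof.
move=> F mF F0; rewrite mul1e !jintS_swap//; last first.
  by apply: measurableT_comp => //; exact: measurable_mulmx.
congr jint; apply/funext => v; congr (_ * _).
under eq_integral do rewrite row_cons_block mulmx1 scaler0 add0r.
pose G (x : measurableTypeR R) := F (row_cons (x, v)).
transitivity (\int[leb]_x G (1 * x + (v *m c)%R 0%R 0%R)%R).
  by apply: eq_integral => x _; rewrite mul1r mulr1.
rewrite (integral_lebesgue_affine (f := G) _ (oner_neq0 R)).
- by rewrite normr1 invr1 mul1e.
- by apply: measurableT_comp => //; exact: measurable_row_cons2.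
- by move=> x; exact: F0.
Qed.

Lemma cv_block m a k (S : 'M[R]_m) : a != 0%R -> (0 <= k)%R -> cv k S ->
  cv (`|a|^-1 * k)%R (block_mx (a%:M : 'M[R]_1) 0%R 0%R S).
Proof.
move=> a0 k0 cS F mF F0; rewrite !jintS//; last first.
  by apply: measurableT_comp => //; exact: measurable_mulmx.
have mFx x : measurable_fun setT (fun v => F (row_cons (x, v))).
  by apply: measurableT_comp => //; exact: measurable_row_cons2.
have mj : measurable_fun setT (fun x : measurableTypeR R => jint (fun v => F (row_cons (x, v)))).
  apply: measurable_jint => //; apply: measurableT_comp => //.
  exact: measurable_row_cons2.
pose G (x : measurableTypeR R) := jint (fun v => F (row_cons (x, v))).
rewrite muleCA; congr (_ * _).
transitivity (\int[leb]_x (k%:E * G (a * x + 0)%R)).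
  apply: eq_integral => x _.
  under eq_fun do rewrite row_cons_block scaler0 mulmx0 mxE addr0 add0r.
  by rewrite addr0 (mulrC a) (cS (fun v => F (row_cons ((x * a)%R, v)))).
have G0 x : 0 <= G x by exact: jint_ge0.
rewrite ge0_integralZl//; last first.
  apply: (measurableT_comp (f := G)) => //.
  by apply: measurable_funD => //; exact: measurable_funM.
rewrite (integral_lebesgue_affine (f := G) 0%R a0)//.
by rewrite muleA -EFinM mulrC.
Qed.

(** Induction on the dimension by block elimination: with a nonzero pivot the matrix is a lower
    shear, times a block diagonal matrix with the Schur complement, times an upper shear. *)
Lemma cv_unit m (A : 'M[R]_m) : A \in unitmx -> exists2 k, (0 < k)%R & cv k A.
Proof.
elim: m A => [A _|m IH A uA].
  exists 1%R => // F mF F0; rewrite mul1e; congr jint.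
  by apply/funext => v; congr F; apply/rowP => -[].
pose A' : 'M[R]_(1 + m) := A.
have uA' : A' \in unitmx by [].
suff pivot (C : 'M[R]_(1 + m)) : C \in unitmx -> ulsubmx C 0%R 0%R != 0%R ->
    exists2 k, (0 < k)%R & cv (m := m.+1) k C.
  have [a0|] := eqVneq (ulsubmx A' 0%R 0%R) 0%R; last exact: pivot.
  pose b := ursubmx A'.
  have b0 : sqn b != 0%R.
    rewrite sqn_eq0; apply/eqP => b0.
    have uA0 : usubmx A' = 0%R.
      rewrite -(hsubmxK (usubmx A')) -/(ulsubmx A') -/(ursubmx A') -/b b0.
      by rewrite [ulsubmx A']mx11_scalar a0 raddf0 row_mx0.
    have := uA'; rewrite -row_free_unit -(vsubmxK A') uA0 => /row_freeP[D].
    rewrite mul_col_mx mul0mx => /(congr1 usubmx).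
    rewrite col_mxKu (@scalar_mx_block R 1 m) /block_mx col_mxKu => /(congr1 lsubmx).
    by rewrite row_mxKl => /matrixP/(_ 0%R 0%R); rewrite !mxE eqxx mulr1n => /eqP; rewrite eq_sym oner_eq0.
  (* With a zero pivot, multiplying by the shear of column b^T makes the pivot b b^T = |b|^2. This
     is nonzero, since otherwise the first row of the matrix would vanish. *)
  pose c := b^T.
  pose T : 'M[R]_(1 + m) := block_mx 1%:M 0%R c 1%:M.
  pose T' : 'M[R]_(1 + m) := block_mx 1%:M 0%R (- c)%R 1%:M.
  have TT' : T *m T' = 1%:M.
    rewrite /T /T' mulmx_block !mulmx0 !mul0mx !mulmx1 !mul1mx !addr0 !add0r subrr.
    by rewrite -scalar_mx_block.
  have [uT uT'] := mulmx1_unit TT'.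
  have [||k k0 cAT] := pivot (A' *m T).
  - by rewrite unitmx_mul uA' uT.
  - rewrite -{1}[A']submxK /T mulmx_block block_mxKul mulmx1 -/b mxE a0 add0r sqnE.
    exact: b0.
  exists k => //; rewrite -[k]mulr1 -[A]/A' -[A']mulmx1 -TT' mulmxA.
  by apply: cvM => //; exact: cv_shear_dl.
move=> uC a0; set a := ulsubmx C 0%R 0%R in a0.
pose b := ursubmx C; pose c := dlsubmx C.
pose S := (drsubmx C - a^-1 *: (c *m b))%R.
have eC : C = block_mx 1%:M 0%R (a^-1 *: c)%R 1%:M *m block_mx a%:M 0%R 0%R S *m
              block_mx 1%:M (a^-1 *: b)%R 0%R 1%:M.
  rewrite !mulmx_block !mulmx0 !mul0mx !mulmx1 !mul1mx !addr0 !add0r.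
  rewrite -[in LHS](submxK C).
  rewrite [in LHS](mx11_scalar (ulsubmx C)) -/a -/b -/c.
  rewrite mul_scalar_mx -!scalemxAl mul_mx_scalar !scalerA mulfV// mulVf// !scale1r.
  by rewrite -scalemxAl scalerA mulVf// scale1r -scalemxAr /S addrC subrK.
have uS : S \in unitmx.
  move: uC; rewrite eC !unitmx_mul => /andP[/andP[_ +] _].
  by rewrite !unitmxE det_ublock unitrM => /andP[].
have [k k0 cS] := IH S uS.
exists (1 * (`|a|^-1 * k) * 1)%R.
  by rewrite mul1r mulr1 mulr_gt0// invr_gt0 normr_gt0.
rewrite eC; apply: cvM; last exact: cv_shear_ur.
by apply: cvM; [exact: cv_shear_dl|apply: cv_block => //; exact: ltW].
Qed.

End linear_change_of_variables.

(** * Rotation invariance of Gaussian measures *)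

Section gaussian_invariance.
Local Open Scope ereal_scope.
Variable R : realType.
Notation leb := (@lebesgue_measure R).
Notation N01 := (normal_prob (0%R : R) 1%R : probability (measurableTypeR R) R).

Let mexpN m : measurable_fun setT (fun v : 'rV[R]_m => (expR (- (sqn v / 2)))%:E).
Proof.
apply/measurable_EFinP; apply: measurableT_comp => //; apply: measurableT_comp => //.
by apply: measurable_funM => //; exact: measurable_sqn.
Qed.

Lemma gauss_jint m (F : 'rV[R]_m -> \bar R) :
  \int[gauss R m]_v F v = jint (fun v => F v * (expR (- (sqn v / 2)))%:E).
Proof.
rewrite jintE; apply: eq_integral => v _.
by rewrite -muleA -EFinM -expRD addNr expR0 mule1.
Qed.

(** An isometry preserves the Gaussian weight, so it scales every integral by the same unknown
    factor; the constant function 1 shows that the factor is 1. Asking for an isometry instead of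
    [orthomx] suits the action of a matrix on vectorized matrices. *)
Lemma integral_gauss_isometry m (A : 'M[R]_m) (F : 'rV[R]_m -> \bar R) :
  (forall v : 'rV[R]_m, sqn (v *m A) = sqn v) ->
  measurable_fun setT F -> (forall v, 0 <= F v) ->
  \int[gauss R m]_v F (v *m A) = \int[gauss R m]_v F v.
Proof.
move=> isoA mF F0.
have uA : A \in unitmx.
  rewrite -row_free_unit; apply: inj_row_free => v vA.
  by apply/eqP; rewrite -sqn_eq0 -isoA vA sqn_eq0.
have [k k0 cA] := cv_unit uA.
have key G : measurable_fun setT G -> (forall v, 0 <= G v) ->
    \int[gauss R m]_v G (v *m A) = k%:E * \int[gauss R m]_v G v.
  move=> mG G0; rewrite !gauss_jint -cA.
  - by congr jint; apply/funext => v; rewrite isoA.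
  - by apply: emeasurable_funM => //; exact: mexpN.
  - by move=> v; rewrite mule_ge0// lee_fin expR_ge0.
have g1 : \int[gauss R m]_v (1 : \bar R) = 1.
  by rewrite integral_cst// mul1e; exact: probability_setT.
have k1 : k%:E = 1 by have := key (cst 1) (@measurable_cst _ _ _ _ _ _) (fun=> lee01); rewrite /= g1 mule1.
by rewrite key// k1 mul1e.
Qed.

Lemma integral_gauss_orthomx m (A : 'M[R]_m) (F : 'rV[R]_m -> \bar R) :
  orthomx A -> measurable_fun setT F -> (forall v, 0 <= F v) ->
  \int[gauss R m]_v F (v *m A) = \int[gauss R m]_v F v.
Proof. by move=> oA; apply: integral_gauss_isometry => v; exact: sqn_orthomx. Qed.

Lemma cv_scalar m (a : R) : (0 < a)%R -> cv ((a^-1) ^+ m)%R (a%:M : 'M[R]_m).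
Proof.
move=> a0; elim: m => [|m IH].
  move=> F mF F0; rewrite expr0 mul1e; congr jint.
  by apply/funext => v; congr F; apply/rowP => -[].
rewrite exprS (_ : a%:M = block_mx (a%:M : 'M[R]_1) 0%R 0%R (a%:M : 'M[R]_m)); last first.
  exact: (@scalar_mx_block R 1 m).
have -> : a^-1%R = `|a|^-1%R by rewrite gtr0_norm.
apply: cv_block; rewrite ?gt_eqF// ?exprn_ge0//.
by rewrite gtr0_norm.
Qed.

Lemma row_cons_row_mx a b x (u : 'rV[R]_a) (v : 'rV[R]_b) :
  row_cons (x, row_mx u v) = row_mx (row_cons (x, u)) v.
Proof. by rewrite /row_cons/= (@row_mxA R 1 1 a b) castmx_id. Qed.

Lemma integral_gaussD a b (F : 'rV[R]_(a + b) -> \bar R) :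
  measurable_fun setT F -> (forall v, 0 <= F v) ->
  \int[gauss R (a + b)]_v F v =
  \int[gauss R a]_u \int[gauss R b]_v F (row_mx u v).
Proof.
elim: a F => [|a IH] F mF F0.
  have mF' : measurable_fun setT (fun u : 'rV[R]_0 => \int[gauss R b]_v F (row_mx u v)).
    apply: (@measurable_fun_fubini_tonelli_F _ _ _ _ _ _ (fun uv => F (row_mx uv.1 uv.2))) => //.
    by apply: measurableT_comp => //; exact: measurable_row_mx.
  rewrite integral_gauss0//; apply: eq_integral => v _; congr F.
  by apply/rowP => i; rewrite mxE; case: splitP => [[]//|j ij]; congr (v _ _); apply/val_inj.
have mF2 : measurable_fun setT (fun uv : 'rV[R]_a.+1 * 'rV[R]_b => F (row_mx uv.1 uv.2)).
  by apply: measurableT_comp => //; exact: measurable_row_mx.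
have mG : measurable_fun setT (fun u : 'rV[R]_a.+1 => \int[gauss R b]_v F (row_mx u v)).
  exact: (@measurable_fun_fubini_tonelli_F _ _ _ _ _ _ (fun uv => F (row_mx uv.1 uv.2))).
rewrite [RHS]integral_gaussS//; last by move=> u; exact: integral_ge0.
rewrite [LHS]integral_gaussS//; apply: eq_integral => x _.
rewrite (IH (fun w => F (row_cons (x, w)))); last 2 first.
  2: by move=> w; exact: F0.
  by apply: measurableT_comp => //; exact: measurable_row_cons2.
apply: eq_integral => u _; apply: eq_integral => v _; congr F.
by rewrite row_cons_row_mx.
Qed.

End gaussian_invariance.

(** * Absolute and inverse moments *)

Section gaussian_moments.
Local Open Scope ereal_scope.
Variable R : realType.
Notation leb := (@lebesgue_measure R).
Notation N01 := (normal_prob (0%R : R) 1%R : probability (measurableTypeR R) R).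

Lemma measurable_expR_sq (c : R) : measurable_fun setT
  (fun t : measurableTypeR R => expR (- ((c * t) ^+ 2 / 2)) : measurableTypeR R)%R.
Proof.
apply: measurableT_comp => //; apply: measurableT_comp => //.
by apply: measurable_funM => //; apply: measurable_funX; exact: measurable_funM.
Qed.

Lemma measurable_normX k : measurable_fun setT
  (fun t : measurableTypeR R => `|t| ^+ k : measurableTypeR R)%R.
Proof. by apply: measurable_funX; exact: normr_measurable. Qed.

Definition gmom k : \bar R := \int[leb]_t (`|t| ^+ k * expR (- (t ^+ 2 / 2)))%:E.

Let mgmom (c : R) k : measurable_fun setT (fun t : measurableTypeR R =>
  (`|t| ^+ k * expR (- ((c * t) ^+ 2 / 2)))%:E : \bar R).
Proof.
apply/measurable_EFinP; apply: measurable_funM; first exact: measurable_normX.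
exact: measurable_expR_sq.
Qed.

Let gmom0 (c : R) k t : 0 <= (`|t| ^+ k * expR (- ((c * t) ^+ 2 / 2)))%:E.
Proof. by rewrite lee_fin mulr_ge0 ?exprn_ge0 ?expR_ge0//. Qed.

(** Substitution t -> a t: k factors come from the power and one from dt. *)
Lemma gmom_scale k (a : R) : a != 0%R ->
  \int[leb]_t (`|t| ^+ k * expR (- ((a * t) ^+ 2 / 2)))%:E = (`|a|^-1 ^+ k.+1)%:E * gmom k.
Proof.
move=> a0.
pose G (t : measurableTypeR R) : \bar R := (`|t| ^+ k * expR (- (t ^+ 2 / 2)))%:E.
have mG : measurable_fun setT G.
  by apply: eq_mfun (mgmom 1%R k) => t; rewrite /G mul1r.
have G0 t : 0 <= G t by rewrite lee_fin mulr_ge0 ?exprn_ge0 ?expR_ge0//.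
have e1 : \int[leb]_t G (a * t + 0)%R = (`|a| ^+ k)%:E *
    \int[leb]_t (`|t| ^+ k * expR (- ((a * t) ^+ 2 / 2)))%:E.
  rewrite -ge0_integralZl.
  - by apply: eq_integral => t _; rewrite /G addr0 normrM exprMn -EFinM mulrA.
  - exact: measurableT.
  - exact: mgmom.
  - by move=> t _; exact: gmom0.
  - by rewrite lee_fin exprn_ge0.
have := integral_lebesgue_affine 0%R a0 mG G0; rewrite e1.
move=> /(congr1 (fun x => (`|a|^-1 ^+ k)%:E * x)); rewrite !muleA -!EFinM.
by rewrite -exprMn mulVf ?normr_eq0// expr1n mul1e -exprSr.
Qed.

Lemma gmom_gauss : (normal_peak 1)%:E * gmom 0 = 1.
Proof.
have <- : N01 setT = 1 by exact: probability_setT.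
rewrite /gmom -ge0_integralZl//.
- apply: eq_integral => t _; rewrite -EFinM expr0 mul1r; congr EFin.
  exact: esym (gdensE t).
- by apply: eq_mfun (mgmom 1%R 0) => t; rewrite mul1r.
- by rewrite lee_fin normal_peak_ge0.
Qed.

Lemma gmom_lty k : gmom k < +oo.
Proof.
(* Raise x / n <= exp (x / n) to the power k, with n = 4 (k + 1) so that k / n <= 1 / 4. *)
have bnd (x : R) : (0 <= x)%R -> (x ^+ k <= (4 * k.+1)%:R ^+ k * expR (x / 4))%R.
  move=> x0; set n := (4 * k.+1)%:R%R.
  have n0 : (0 < n :> R)%R by rewrite ltr0n.
  have xn : (x / n <= expR (x / n))%R by apply: le_trans (expR_ge1Dx _); rewrite lerDr.
  have : ((x / n) ^+ k <= expR (x / n) ^+ k)%R.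
    by apply: lerXn2r xn; rewrite nnegrE ?expR_ge0// divr_ge0// ltW.
  rewrite expr_div_n ler_pdivrMr ?exprn_gt0// mulrC => /le_trans; apply.
  rewrite ler_pM2l ?exprn_gt0// -expRM_natl ler_expR.
  rewrite mulrCA ler_wpM2l// ler_pdivrMr// /n natrM mulrA mulVf ?pnatr_eq0// mul1r.
  by rewrite ler_nat.
have g0 : gmom 0 < +oo.
  rewrite ltey; apply/eqP => g0y; have := gmom_gauss; rewrite g0y gt0_muley//.
  by rewrite lte_fin normal_peak_gt0 ?oner_eq0.
(* The factor sqrt (1/2) makes the exponent - t^2 / 4: what remains of - t^2 / 2 when [bnd], taken
   at 1 + t^2 >= |t|, has used up t^2 / 4. *)
have i2 : \int[leb]_t (expR (- ((Num.sqrt (2^-1) * t) ^+ 2 / 2)))%:E < +oo.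
  have s0 : Num.sqrt (2^-1 : R) != 0%R by rewrite sqrtr_eq0 -ltNge invr_gt0.
  have := gmom_scale 0 s0.
  under eq_integral do rewrite expr0 mul1r.
  move=> ->; rewrite lte_mul_pinfty// ?lee_fin ?exprn_ge0//.
apply: le_lt_trans (_ : \int[leb]_t (((4 * k.+1)%:R ^+ k * expR (4^-1))%:E *
  (expR (- ((Num.sqrt (2^-1) * t) ^+ 2 / 2)))%:E) < _).
  apply: ge0_le_integral => //.
  - by apply: eq_mfun (mgmom 1%R k) => t; rewrite mul1r.
  - apply: emeasurable_funM => //; apply/measurable_EFinP; exact: measurable_expR_sq.
  - move=> t _; rewrite -EFinM lee_fin exprMn sqr_sqrtr ?invr_ge0//.
    have t1 : (`|t| ^+ k <= (4 * k.+1)%:R ^+ k * expR ((1 + t ^+ 2) / 4))%R.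
      apply: le_trans (bnd _ _); last by rewrite addr_ge0// sqr_ge0.
      apply: lerXn2r; rewrite ?nnegrE ?addr_ge0 ?sqr_ge0//.
      by rewrite -(real_normK (num_real t)); have := sqr_ge0 (`|t| - 1)%R; nra.
    apply: le_trans (ler_wpM2r (expR_ge0 _) t1) _.
    rewrite -!mulrA ler_wpM2l ?exprn_ge0// -!expRD ler_expR.
    by rewrite le_eqVlt; apply/orP; left; apply/eqP; field.
rewrite ge0_integralZl.
- by rewrite lte_mul_pinfty// lee_fin mulr_ge0 ?exprn_ge0 ?expR_ge0.
- exact: measurableT.
- apply/measurable_EFinP; exact: measurable_expR_sq.
- by move=> t _; rewrite lee_fin expR_ge0.
- by rewrite lee_fin mulr_ge0 ?exprn_ge0 ?expR_ge0.
Qed.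

(** On [1, 2] the integrand is at least exp (- 2). *)
Lemma gmom_gt0 k : 0 < gmom k.
Proof.
have mg : measurable_fun setT (fun t : measurableTypeR R => (`|t| ^+ k * expR (- (t ^+ 2 / 2)))%:E : \bar R).
  by apply: eq_mfun (mgmom 1%R k) => t; rewrite mul1r.
have g0 (t : R) : 0 <= (`|t| ^+ k * expR (- (t ^+ 2 / 2)))%:E.
  by have := gmom0 1%R k t; rewrite mul1r.
apply: (@lt_le_trans _ _ (\int[leb]_(t in `[1%R, 2%R]) (expR (- 2))%:E)).
  rewrite integral_cst//= lebesgue_measure_itv/= lte_fin ltr1n -EFinD -EFinM lte_fin.
  by rewrite mulr_gt0 ?expR_gt0//; lra.
apply: (@le_trans _ _ (\int[leb]_(t in `[1%R, 2%R]) (`|t| ^+ k * expR (- (t ^+ 2 / 2)))%:E)).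
  apply: ge0_le_integral => //.
  - exact: measurable_funTS mg.
  - move=> t /=; rewrite in_itv/= => /andP[t1 t2]; rewrite lee_fin.
    rewrite -[leLHS]mul1r ler_pM ?expR_ge0//.
      by rewrite exprn_ege1// ger0_norm// (le_trans _ t1).
    by rewrite ler_expR; nra.
exact: ge0_subset_integral.
Qed.

Lemma measurable_sqrt :
  measurable_fun setT (fun x : measurableTypeR R => Num.sqrt x : measurableTypeR R).
Proof. by apply: continuous_measurable_fun; exact: sqrt_continuous. Qed.

(** Together with the Gaussian density the exponent is - (1 + t^2) |y|^2 / 2; scaling y by sqrt (1 +
    t^2) brings back the standard one. *)
Lemma integral_gauss_expR m (t : R) :
  \int[gauss R m]_y (expR (- (t ^+ 2 * sqn y / 2)))%:E =
  ((Num.sqrt (1 + t ^+ 2))^-1 ^+ m)%:E.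
Proof.
set l := Num.sqrt _.
have l2 : (l ^+ 2 = 1 + t ^+ 2)%R by rewrite sqr_sqrtr// addr_ge0// sqr_ge0.
have l0 : (0 < l)%R by rewrite sqrtr_gt0 ltr_pwDl// sqr_ge0.
have mexp : measurable_fun setT (fun v : 'rV[R]_m => (expR (- (sqn v / 2)))%:E : \bar R).
  apply/measurable_EFinP; apply: measurableT_comp => //; apply: measurableT_comp => //.
  by apply: measurable_funM => //; exact: measurable_sqn.
have := @cv_scalar R m l l0 _ mexp (fun v => expR_ge0 _).
have -> : jint (fun v : 'rV[R]_m => (expR (- (sqn v / 2)))%:E) = 1.
  have <- : gauss R m setT = 1 by exact: probability_setT.
  rewrite -[RHS]mul1e -integral_cst// gauss_jint; congr jint.
  by apply/funext => v; rewrite mul1e.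
rewrite mule1 => <-; rewrite gauss_jint; congr jint; apply/funext => v.
rewrite -EFinM -expRD mul_mx_scalar; congr (expR _)%:E.
have -> : (sqn (l *: v) = l ^+ 2 * sqn v)%R.
  by rewrite /sqn mulr_sumr; apply: eq_bigr => i _; rewrite mxE exprMn.
by rewrite l2; ring.
Qed.

(* With [M_k = gmom k], write [M_p |y|^-(p+1)] as the integral of
   [|t|^p exp (- t^2 |y|^2 / 2)] over t, integrate over y, and expand
   [M_(p+1) (1 + t^2)^-((p+2)/2)] in the same way; the remaining double integral
   is [M_0 M_p]. *)
Lemma gauss_inverse_moment p :
  gmom p.+1 * \int[gauss R p.+2]_y ((Num.sqrt (sqn y))^-1 ^+ p.+1)%:E <= gmom 0.
Proof.
have [a a0 aE] : exists2 a : R, (0 < a)%R & gmom p = a%:E.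
  by have := gmom_gt0 p; have := gmom_lty p; case: (gmom p) => // a; rewrite lte_fin; exists a.
have [b b0 bE] : exists2 b : R, (0 < b)%R & gmom p.+1 = b%:E.
  by have := gmom_gt0 p.+1; have := gmom_lty p.+1; case: (gmom p.+1) => // b; rewrite lte_fin; exists b.
have msq : measurable_fun setT (fun y : 'rV[R]_p.+2 => (Num.sqrt (sqn y))^-1 : measurableTypeR R)%R.
  apply: (measurableT_comp (@measurable_invr R)).
  exact: (measurableT_comp measurable_sqrt (@measurable_sqn R p.+2)).
pose I := \int[gauss R p.+2]_y ((Num.sqrt (sqn y))^-1 ^+ p.+1)%:E.
have ge01 (c : R) k (t : R) : 0 <= (`|t| ^+ k * expR c)%:E :> \bar R.
  by rewrite lee_fin mulr_ge0 ?exprn_ge0 ?expR_ge0//.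
have m1 : measurable_fun setT (fun yt : 'rV[R]_p.+2 * measurableTypeR R =>
    (`|yt.2| ^+ p * expR (- (yt.2 ^+ 2 * sqn yt.1 / 2)))%:E : \bar R).
  apply/measurable_EFinP; apply: measurable_funM.
    exact: (measurableT_comp (measurable_normX p) measurable_snd).
  apply: measurableT_comp => //; apply: measurableT_comp => //.
  apply: measurable_funM => //; apply: measurable_funM.
    by apply: measurable_funX; exact: measurable_snd.
  exact: (measurableT_comp (@measurable_sqn R p.+2) measurable_fst).
have le1 : a%:E * I <= \int[gauss R p.+2]_y \int[leb]_t (`|t| ^+ p * expR (- (t ^+ 2 * sqn y / 2)))%:E.
  rewrite /I -ge0_integralZl; first last.
  - by rewrite lee_fin ltW.
  - by move=> y _; rewrite lee_fin exprn_ge0// invr_ge0 sqrtr_ge0.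
  - by apply/measurable_EFinP; exact: measurable_funX.
  - exact: measurableT.
  apply: ge0_le_integral.
  - exact: measurableT.
  - by move=> y _; apply: mule_ge0; rewrite lee_fin ?(ltW a0)// exprn_ge0// invr_ge0 sqrtr_ge0.
  - by apply: emeasurable_funM => //; apply/measurable_EFinP; exact: measurable_funX.
  - by apply: (measurable_fun_fubini_tonelli_F _ m1) => yt; exact: ge01.
  (* At y = 0 the inverse norm is 0 by convention, so only an inequality holds there; it is in the
     needed direction. *)
  move=> y _; have [->|y0] := eqVneq y 0%R.
    rewrite (_ : sqn 0 = 0%R); last by apply/eqP; rewrite sqn_eq0.
    rewrite sqrtr0 invr0 expr0n mule0; apply: integral_ge0 => t _; exact: ge01.
  have r0 : Num.sqrt (sqn y) != 0%R by rewrite sqrtr_eq0 -ltNge sqn_gt0.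
  have := gmom_scale p r0; rewrite aE (ger0_norm (sqrtr_ge0 _)) muleC => <-.
  apply: ge0_le_integral.
  - exact: measurableT.
  - by move=> t _; exact: ge01.
  - exact: mgmom.
  - exact: (measurableT_comp m1 (pair1_measurable y)).
  - by move=> t _; rewrite exprMn sqr_sqrtr ?sqn_ge0// (mulrC (sqn y)).
have e2 : \int[gauss R p.+2]_y \int[leb]_t (`|t| ^+ p * expR (- (t ^+ 2 * sqn y / 2)))%:E =
    \int[leb]_t (`|t| ^+ p * (Num.sqrt (1 + t ^+ 2))^-1 ^+ p.+2)%:E.
  rewrite (fubini_tonelli (fun yt : 'rV[R]_p.+2 * measurableTypeR R =>
    (`|yt.2| ^+ p * expR (- (yt.2 ^+ 2 * sqn yt.1 / 2)))%:E : \bar R) m1); last first.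
    by move=> yt; exact: ge01.
  apply: eq_integral => t _ /=; rewrite EFinM -integral_gauss_expR -ge0_integralZl.
  - by apply: eq_integral => y _; rewrite -EFinM.
  - exact: measurableT.
  - apply/measurable_EFinP; apply: measurableT_comp => //; apply: measurableT_comp => //.
    by apply: measurable_funM => //; apply: measurable_funM => //; exact: measurable_sqn.
  - by move=> y _; rewrite lee_fin expR_ge0.
  - by rewrite lee_fin exprn_ge0.
have ml : measurable_fun setT (fun t : measurableTypeR R =>
    (`|t| ^+ p * (Num.sqrt (1 + t ^+ 2))^-1 ^+ p.+2)%:E : \bar R).
  apply/measurable_EFinP; apply: measurable_funM; first exact: measurable_normX.
  apply: measurable_funX; apply: (measurableT_comp (@measurable_invr R)).
  apply: (measurableT_comp measurable_sqrt).
  by apply: measurable_funD => //; exact: measurable_funX.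
(* The exponent p + 2, inherited from the dimension of y, is exactly the one that [gmom_scale]
   produces for the moment of order p + 1. *)
have e3 : b%:E * \int[leb]_t (`|t| ^+ p * (Num.sqrt (1 + t ^+ 2))^-1 ^+ p.+2)%:E =
    \int[leb]_t \int[leb]_s (`|t| ^+ p * (`|s| ^+ p.+1 * expR (- (s ^+ 2 * (1 + t ^+ 2) / 2))))%:E.
  rewrite -ge0_integralZl; first last.
  - by rewrite lee_fin ltW.
  - by move=> t _; rewrite lee_fin mulr_ge0// exprn_ge0// invr_ge0 sqrtr_ge0.
  - exact: ml.
  - exact: measurableT.
  apply: eq_integral => t _.
  have l0 : (0 < Num.sqrt (1 + t ^+ 2))%R by rewrite sqrtr_gt0 ltr_pwDl// sqr_ge0.
  have := gmom_scale p.+1 (lt0r_neq0 l0); rewrite bE (gtr0_norm l0) => e.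
  rewrite EFinM muleCA (muleC b%:E) -e -ge0_integralZl.
  - apply: eq_integral => s _; rewrite -EFinM exprMn sqr_sqrtr ?addr_ge0 ?sqr_ge0//.
    by rewrite (mulrC (1 + _)%R).
  - exact: measurableT.
  - exact: mgmom.
  - by move=> s _; exact: ge01.
  - by rewrite lee_fin exprn_ge0.
have m4 : measurable_fun setT (fun ts : measurableTypeR R * measurableTypeR R =>
    (`|ts.1| ^+ p * (`|ts.2| ^+ p.+1 * expR (- (ts.2 ^+ 2 * (1 + ts.1 ^+ 2) / 2))))%:E : \bar R).
  apply/measurable_EFinP; apply: measurable_funM.
    exact: (measurableT_comp (measurable_normX p) measurable_fst).
  apply: measurable_funM.
    exact: (measurableT_comp (measurable_normX p.+1) measurable_snd).
  apply: measurableT_comp => //; apply: measurableT_comp => //.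
  apply: measurable_funM => //; apply: measurable_funM.
    by apply: measurable_funX; exact: measurable_snd.
  by apply: measurable_funD => //; apply: measurable_funX; exact: measurable_fst.
have le4 : \int[leb]_t \int[leb]_s
    (`|t| ^+ p * (`|s| ^+ p.+1 * expR (- (s ^+ 2 * (1 + t ^+ 2) / 2))))%:E <= a%:E * gmom 0.
  rewrite (fubini_tonelli (fun ts : measurableTypeR R * measurableTypeR R =>
    (`|ts.1| ^+ p * (`|ts.2| ^+ p.+1 * expR (- (ts.2 ^+ 2 * (1 + ts.1 ^+ 2) / 2))))%:E : \bar R) m4); last first.
    by move=> ts; rewrite lee_fin !mulr_ge0 ?exprn_ge0 ?expR_ge0//.
  rewrite /gmom -ge0_integralZl; first last.
  - by rewrite lee_fin ltW.
  - by move=> s _; exact: ge01.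
  - by apply: eq_mfun (mgmom 1%R 0) => t; rewrite mul1r.
  - exact: measurableT.
  apply: ge0_le_integral.
  - exact: measurableT.
  - by move=> s _; apply: integral_ge0 => t _; rewrite lee_fin !mulr_ge0 ?exprn_ge0 ?expR_ge0//.
  - apply: (measurable_fun_fubini_tonelli_G _ m4) => ts.
    by rewrite lee_fin !mulr_ge0 ?exprn_ge0 ?expR_ge0//.
  - apply: emeasurable_funM => //.
    by apply: eq_mfun (mgmom 1%R 0) => t; rewrite mul1r.
  move=> s _ /=; have [->|s0] := eqVneq s 0%R.
    rewrite integral0_eq; first by rewrite mule_ge0 ?lee_fin ?ltW// mulr_gt0 ?expR_gt0.
    by move=> t _; rewrite normr0 expr0n mul0r mulr0.
  have := gmom_scale p s0; rewrite aE => e.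
  (* The inner integral is |s|^-(p+1) times the moment of order p, so the power of s cancels and exp
     (- s^2 / 2) alone remains. *)
  rewrite (_ : \int[leb]_t _ = (`|s| ^+ p.+1 * expR (- (s ^+ 2 / 2)))%:E *
     \int[leb]_t (`|t| ^+ p * expR (- ((s * t) ^+ 2 / 2)))%:E).
    rewrite e -!EFinM lee_fin expr0 le_eqVlt; apply/orP; left; apply/eqP.
    by rewrite mulrACA -exprMn mulfV ?normr_eq0// expr1n !mul1r mulrC.
  rewrite -ge0_integralZl.
  - apply: eq_integral => t _; rewrite -EFinM; congr EFin.
    have -> : expR (- (s ^+ 2 * (1 + t ^+ 2) / 2)) =
        (expR (- (s ^+ 2 / 2)) * expR (- ((s * t) ^+ 2 / 2)))%R.
      by rewrite -expRD; congr expR; ring.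
    by rewrite (mulrA (`|s| ^+ p.+1)%R) mulrCA.
  - exact: measurableT.
  - exact: mgmom.
  - by move=> t _; exact: ge01.
  - by rewrite lee_fin mulr_ge0 ?exprn_ge0 ?expR_ge0//.
have aI : a%:E * (b%:E * I) <= a%:E * gmom 0.
  apply: le_trans le4; rewrite -e3 -e2 muleCA; apply: lee_wpmul2l => //.
  by rewrite lee_fin ltW.
by rewrite bE -/I -(@lee_pmul2l _ a%:E)// lte_fin.
Qed.

End gaussian_moments.

(** * Gaussian matrices *)

Section gaussian_law.
Local Open Scope ereal_scope.
Variable R : realType.
Notation N01 := (normal_prob (0%R : R) 1%R : probability (measurableTypeR R) R).

Definition box m (B : 'I_m -> set R) : set 'rV[R]_m := [set v | forall k, B k (v ord0 k)].

Lemma measurable_box m (B : 'I_m -> set R) :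
  (forall k, measurable (B k : set (measurableTypeR R))) -> measurable (box B).
Proof.
move=> mB; rewrite (_ : box B = \bigcap_(k in [set: 'I_m]) [set v | B k (v ord0 k)]).
  apply: fin_bigcap_measurable => // k _.
  have mk : measurable_fun setT (fun v : 'rV[R]_m => (v ord0 k : measurableTypeR R)).
    exact: measurable_entry.
  by have := mk measurableT _ (mB k); rewrite setTI.
by apply/seteqP; split => v /= h k; [move=> _; exact: h|exact: (h k I)].
Qed.

Lemma gauss_box m (B : 'I_m -> set R) :
  (forall k, measurable (B k : set (measurableTypeR R))) ->
  gauss R m (box B) = \prod_(k < m) N01 (B k).
Proof.
elim: m B => [|m IH] B mB.
  rewrite big_ord0 (_ : box B = setT); first exact: probability_setT.
  by apply/seteqP; split => // v _ [].
rewrite big_ord_recl -(IH (fun k => B (lift ord0 k)))//.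
have mb : measurable (box (fun k => B (lift ord0 k))) by exact: measurable_box.
rewrite -[RHS](@product_measure1E _ _ _ _ _ N01 (gauss R m))// [LHS]/=.
rewrite /distribution /pushforward; congr (product_measure1 _ _ _).
apply/seteqP; split => -[x v] /=.
  move=> h; split => [|k] /=.
    have := h ord0; rewrite /row_cons mxE; case: splitP => // j _.
    by rewrite mxE !ord1 eqxx mulr1n.
  have := h (lift ord0 k); rewrite /row_cons mxE; case: splitP => j /=.
    by rewrite ord1.
  by rewrite /bump leq0n !add1n => -[/val_inj ->].
move=> [h0 h] k; rewrite /row_cons mxE; case: splitP => j kj.
  by rewrite mxE !ord1 eqxx mulr1n; rewrite (_ : k = ord0)//; apply/val_inj; rewrite /= kj ord1.
by rewrite (_ : k = lift ord0 j); [exact: h|apply/val_inj].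
Qed.

Context d (T : measurableType d) (P : probability T R) (n N : nat).
Variable Om : T -> 'M[R]_(n, N).
Hypothesis gOm : gaussian_matrix P Om.

Definition entries m (e : 'I_m -> 'I_n * 'I_N) (w : T) : 'rV[R]_m :=
  \row_k Om w (e k).1 (e k).2.

Lemma measurable_entries m (e : 'I_m -> 'I_n * 'I_N) : measurable_fun setT (entries e).
Proof.
have [mO _ _] := gOm; apply/measurable_mxP => i k.
apply: (@eq_mfun _ _ _ _ _ (fun w => Om w (e k).1 (e k).2)); last exact: mO.
by move=> w; rewrite mxE.
Qed.

Lemma entries_box m (e : 'I_m -> 'I_n * 'I_N) (B : 'I_m -> set R) : injective e ->
  (forall k, measurable (B k : set (measurableTypeR R))) ->
  P (entries e @^-1` box B) = \prod_(k < m) N01 (B k).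
Proof.
move=> ie mB; have [_ dO iO] := gOm.
(* Independence asks for one set per matrix entry; entries that [e] does not list get the whole
   line. *)
pose A ij := if [pick k | e k == ij] is Some k then B k else setT.
have AE k : A (e k) = B k.
  by rewrite /A; case: pickP => [l /eqP/ie -> //|/(_ k)]; rewrite eqxx.
have mA ij : measurable (A ij : set (measurableTypeR R)).
  by rewrite /A; case: pickP.
have := iO [set e k | k in 'I_m]%SET A mA.
rewrite big_imset/=; last by move=> k l _ _; exact: ie.
have -> : \prod_(i in 'I_m) P ((fun w => Om w (e i).1 (e i).2) @^-1` A (e i)) =
    \prod_(k < m) N01 (B k).
  by apply: eq_bigr => k _; rewrite AE; apply: dO; exact: mB.
move=> <-; congr (P _); apply/seteqP; split => w /=.
  by move=> h ij /imsetP[k _ ->]; have := h k; rewrite AE mxE.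
by move=> h k; have := h (e k); rewrite AE mxE; apply; apply: imset_f.
Qed.

(** Boxes form a generating system closed under intersection, and on them both measures are the same
    product by independence. *)
Lemma gaussian_law m (e : 'I_m -> 'I_n * 'I_N) (F : 'rV[R]_m -> \bar R) : injective e ->
  measurable_fun setT F -> (forall v, 0 <= F v) ->
  \int[P]_w F (entries e w) = \int[gauss R m]_v F v.
Proof.
move=> ie mF F0; have me := measurable_entries e.
pose G := [set A | exists B : 'I_m -> set R,
  (forall k, measurable (B k : set (measurableTypeR R))) /\ A = box B].
have lawE A : measurable A -> gauss R m A = pushforward P (entries e) A.
  move=> mA; apply: (@measure_unique _ _ _ G (fun=> setT)) => //.
  - apply/seteqP; split; last first.
      apply: smallest_sub; first exact: sigma_algebra_measurable.
      by move=> _ [B [mB ->]]; exact: measurable_box.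
    apply: smallest_sub; first exact: smallest_sigma_algebra.
    move=> _ [[i j] _] [B mB <-]; apply: sub_sigma_algebra.
    exists (fun k => if k == j then B else setT); split.
      by move=> k; case: ifP.
    apply/seteqP; split => v /=.
      by move=> [_]; rewrite (ord1 i) => Bv k /=; case: ifP => // /eqP ->.
    by move=> /(_ j); rewrite eqxx (ord1 i).
  - move=> _ _ [B [mB ->]] [C [mC ->]].
    exists (fun k => B k `&` C k); split; first by move=> k; exact: measurableI.
    apply/seteqP; split => v /=; first by move=> [b c] k; split.
    by move=> h; split => k; have [] := h k.
  - move=> _; exists (fun=> setT); split => //.
    by apply/seteqP; split.
  - by rewrite bigcup_const.
  - by move=> _ [B [mB ->]]; have /= -> := gauss_box mB; rewrite -(entries_box ie mB).
  - by move=> _; rewrite (le_lt_trans (probability_le1 _ _))// ltry.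
have := @ge0_integral_pushforward _ _ _ _ _ _ me P setT F measurableT mF (fun v _ => F0 v).
rewrite preimage_setT => <-.
by apply: eq_measure_integral => A mA _; exact/esym/lawE.
Qed.

(** Left multiplication by [V] preserves tr (M^T M), so it is an isometry of the vectorized
    matrices. *)
Lemma gaussian_matrix_rotate (V : 'M[R]_n) (F : 'M[R]_(n, N) -> \bar R) : orthomx V ->
  measurable_fun setT F -> (forall M, 0 <= F M) ->
  \int[P]_w F (V *m Om w) = \int[P]_w F (Om w).
Proof.
move=> oV mF F0.
pose e (k : 'I_(n * N)) : 'I_n * 'I_N := enum_val (cast_ord (esym (mxvec_cast n N)) k).
have ie : injective e by move=> k l /enum_val_inj/cast_ord_inj.
have mvec : measurable_fun setT (@vec_mx R n N) by exact: measurable_vec_mx.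
have vecE w : mxvec (Om w) = entries e w.
  apply/rowP => k; rewrite mxE; case/mxvec_indexP: k => i j.
  by rewrite mxvecE /e /mxvec_index cast_ordK enum_rankK.
have sqn_mxvec (M : 'M[R]_(n, N)) : sqn (mxvec M) = (\tr (M^T *m M))%R.
  rewrite /sqn (reindex _ (curry_mxvec_bij _ _)) /=.
  transitivity (\sum_i \sum_j mxvec M ord0 (mxvec_index i j) ^+ 2)%R.
    by rewrite pair_bigA; apply: eq_bigr => -[].
  rewrite exchange_big /=; apply: eq_bigr => j _; rewrite mxE.
  by apply: eq_bigr => i _; rewrite mxvecE mxE expr2.
have iso (v : 'rV[R]_(n * N)) : sqn (v *m lin_mulmx V) = sqn v.
  rewrite -(vec_mxK v) mul_vec_lin !sqn_mxvec trmx_mul -mulmxA (mulmxA V^T).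
  by rewrite (orthomxT oV) mul1mx.
have mG : measurable_fun setT (F \o @vec_mx R n N) by exact: measurableT_comp.
transitivity (\int[gauss R (n * N)]_v F (vec_mx v)); last first.
  rewrite -(gaussian_law (e := e) ie mG)//; last by move=> v; exact: F0.
  by apply: eq_integral => w _; rewrite /= -vecE mxvecK.
have mH : measurable_fun setT (fun v : 'rV[R]_(n * N) => F (vec_mx (v *m lin_mulmx V))).
  by apply: (measurableT_comp mG); exact: measurable_mulmx.
rewrite -(integral_gauss_isometry iso mG)//; last by move=> v; exact: F0.
rewrite -(gaussian_law (e := e) ie mH (fun v => F0 _)).
by apply: eq_integral => w _; rewrite /= -vecE mul_vec_lin mxvecK.
Qed.

End gaussian_law.

(** * Linear functionals of a Gaussian vector *)

Section linear_functional.
Local Open Scope ereal_scope.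
Variable R : realType.
Notation leb := (@lebesgue_measure R).
Notation N01 := (normal_prob (0%R : R) 1%R : probability (measurableTypeR R) R).

(** Rotating [g] onto the first axis turns z g into its norm times the first coordinate of z. *)
Lemma integral_gauss_linear m (g : 'cV[R]_m.+1) (H : R -> \bar R) :
  measurable_fun setT (H : measurableTypeR R -> \bar R) -> (forall x, 0 <= H x) ->
  \int[gauss R m.+1]_z H ((z *m g) ord0 ord0) = \int[N01]_x H (x * Num.sqrt (sqn g^T))%R.
Proof.
move=> mH H0; have [Q oQ gQ] := householder_e0 (g^T : 'rV[R]_(1 + m)).
have mF : measurable_fun setT (fun z : 'rV[R]_m.+1 => H ((z *m g) ord0 ord0)).
  apply: (measurableT_comp mH); apply: (measurableT_comp (measurable_entry _ _)).
  exact: measurable_mulmx.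
rewrite -(integral_gauss_orthomx (orthomx_tr oQ) mF)//.
have mF' : measurable_fun setT (fun z : 'rV[R]_m.+1 => H ((z *m Q^T *m g) ord0 ord0)).
  by apply: (measurableT_comp mF); exact: measurable_mulmx.
rewrite integral_gaussS//; apply: eq_integral => x _.
have E (v : 'rV[R]_m) : H ((row_cons (x, v) *m Q^T *m g) ord0 ord0) = H (x * Num.sqrt (sqn g^T))%R.
  congr H; rewrite -mulmxA (_ : Q^T *m g = col_mx (Num.sqrt (sqn g^T))%:M 0); last first.
    by rewrite -[LHS]trmxK trmx_mul trmxK gQ tr_row_mx tr_scalar_mx trmx0.
  rewrite /row_cons (@mul_row_col R 1 1 m 1) mulmx0 addr0 -scalar_mxM mxE eqxx mulr1n.
  by [].
under eq_integral do rewrite E.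
by rewrite integral_cst//= -[X in _ * X]/(gauss R m setT) probability_setT mule1.
Qed.

Lemma gauss_linear_moment m (g : 'cV[R]_m.+1) k :
  \int[gauss R m.+1]_z (`|(z *m g) ord0 ord0| ^+ k)%:E =
  (Num.sqrt (sqn g^T) ^+ k)%:E * ((normal_peak 1)%:E * gmom R k).
Proof.
have mk : measurable_fun setT (fun x : measurableTypeR R => (`|x| ^+ k)%:E).
  by apply/measurable_EFinP; exact: measurable_normX.
rewrite (integral_gauss_linear g (H := fun x => (`|x| ^+ k)%:E))//.
have mk' c : measurable_fun setT (fun x : measurableTypeR R => (`|x * c| ^+ k)%:E).
  by apply: (measurableT_comp mk); exact: measurable_funM.
rewrite integral_N01//; last exact: mk'.
rewrite muleA -EFinM /gmom -ge0_integralZl//.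
- apply: eq_integral => x _; rewrite -!EFinM; congr EFin.
  rewrite normrM exprMn gdensE (ger0_norm (sqrtr_ge0 _)).
  by rewrite -!mulrA [LHS]mulrCA; congr (_ * _)%R; rewrite mulrCA.
- apply/measurable_EFinP; apply: measurable_funM; first exact: measurable_normX.
  by apply: eq_mfun (measurable_expR_sq 1%R) => x; rewrite mul1r.
- by rewrite lee_fin mulr_ge0// ?exprn_ge0 ?sqrtr_ge0// normal_peak_ge0.
Qed.

(** The variable z g is a nonzero multiple of a standard normal one, whose law has a density. *)
Lemma gauss_linear_null m (g : 'cV[R]_m.+1) : g != 0%R ->
  gauss R m.+1 [set z : 'rV[R]_m.+1 | (z *m g) ord0 ord0 = 0%R] = 0.
Proof.
move=> g0.
have s0 : Num.sqrt (sqn g^T) != 0%R.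
  by rewrite gt_eqF// sqrtr_gt0 sqn_gt0 trmx_eq0.
pose H (x : measurableTypeR R) : \bar R := (\1_[set 0%R] x)%:E.
have mH : measurable_fun setT H.
  by apply/measurable_EFinP; exact: measurable_indic.
have := integral_gauss_linear g mH.
rewrite (_ : (fun z => _) = EFin \o \1_[set z : 'rV[R]_m.+1 | (z *m g) ord0 ord0 = 0%R]); last first.
  apply/funext => z; rewrite /H /= !indicE; congr EFin; congr (_ : nat)%:R%R.
rewrite integral_indic//; last first.
  have ml : measurable_fun setT (fun z : 'rV[R]_m.+1 => ((z *m g) ord0 ord0 : measurableTypeR R)).
    by apply: (measurableT_comp (measurable_entry _ _)); exact: measurable_mulmx.
  by have := ml measurableT _ (measurable_set1 (0%R : R)); rewrite setTI.
rewrite setIT => ->; last by move=> x; rewrite /H lee_fin.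
rewrite (_ : (fun z => _) = EFin \o \1_[set 0%R : measurableTypeR R]); last first.
  apply/funext => x; rewrite /H /= !indicE; congr (_%:R%:E); congr nat_of_bool.
  apply/idP/idP => /set_mem /= xs; apply/mem_set => /=; last by rewrite xs mul0r.
  by apply/eqP; move/eqP: xs; rewrite mulf_eq0 (negbTE s0) orbF.
rewrite integral_indic// setIT.
have /null_content_dominatesP dom := @normal_prob_dominates R 0%R 1%R.
by apply: dom => //; exact: lebesgue_measure_set1.
Qed.

End linear_functional.

(** * Columns of the pseudoinverse as dual vectors *)

Section dual_vector.
Variable R : realType.

Definition insert_row r N (j : 'I_r.+1) (y : 'rV[R]_N) (O : 'M[R]_(r, N)) : 'M[R]_(r.+1, N) :=
  \matrix_(i, c) if unlift j i is Some k then O k c else y 0 c.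

Lemma row_insert_row r N j (y : 'rV[R]_N) (O : 'M[R]_(r, N)) :
  row j (insert_row j y O) = y.
Proof. by apply/rowP => c; rewrite !mxE unlift_none. Qed.

Lemma rowsub_insert_row r N j (y : 'rV[R]_N) (O : 'M[R]_(r, N)) :
  rowsub (lift j) (insert_row j y O) = O.
Proof. by apply/matrixP => k c; rewrite !mxE liftK. Qed.

Lemma insert_rowK r N j (M : 'M[R]_(r.+1, N)) :
  insert_row j (row j M) (rowsub (lift j) M) = M.
Proof. by apply/matrixP => i c; rewrite mxE; case: unliftP => [k ->|->]; rewrite mxE. Qed.

(** Column j of T^+ lies in the row space of [T], is orthogonal to [O] and has product 1 with y. It
    is therefore u / |u|^2 for u the part of y orthogonal to the rows of [O], whose coordinates
    after rotation by [Q] are the last D. *)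
Lemma sqn_dual_vector r D (j : 'I_r.+1) (y : 'rV[R]_(r + D)) (O : 'M[R]_(r, r + D))
    (Q : 'M[R]_(r + D)) (T := insert_row j y O) :
  orthomx Q -> (forall i (k : 'I_(r + D)), (r <= k)%N -> (O *m Q) i k = 0) -> row_free T ->
  sqn (col j (T^T *m invmx (T *m T^T)))^T = (sqn (rsubmx (y *m Q)))^-1.
Proof.
move=> oQ OQ0 fT; have uT : T *m T^T \in unitmx by rewrite -row_free_gram_unit.
pose X := T^T *m invmx (T *m T^T).
have TX : T *m X = 1%:M by rewrite mulmxA mulmxV.
set g := col j _.
have Tg : T *m g = col j 1%:M by rewrite /g colE mulmxA TX -colE.
have OE : O = rowsub (lift j) T by rewrite rowsub_insert_row.
have yg : y *m g = 1%:M.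
  rewrite -(row_insert_row j y O) -row_mul Tg; apply/matrixP => a b.
  by rewrite !mxE !ord1 !eqxx.
have Og : O *m g = 0.
  rewrite OE mul_rowsub_mx Tg; apply/matrixP => a b.
  by rewrite !mxE eq_sym (negbTE (neq_lift _ _)).
pose h := Q^T *m g; pose c := invmx (T *m T^T) *m col j 1%:M.
have gE : g = T^T *m c by rewrite /g /c !colE mul1mx mulmxA.
have LE : O *m Q = row_mx (lsubmx (O *m Q)) 0.
  rewrite -[LHS]hsubmxK; congr row_mx; apply/matrixP => i k.
  by rewrite mxE OQ0 ?mxE//= leq_addr.
set L := lsubmx (O *m Q) in LE.
(* A right inverse of [T] restricts to one of [O], which makes the square block [L] invertible; O g
   = 0 then kills the first r coordinates of h. *)
have OX : exists B, O *m B = 1%:M.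
  exists (X *m (rowsub (lift j) 1%:M)^T).
  rewrite mulmxA OE mul_rowsub_mx TX; apply/matrixP => a b; rewrite mxE (bigD1 (lift j a))//=.
  rewrite !mxE eqxx mul1r big1 ?addr0; last by move=> i ia; rewrite !mxE eq_sym (negbTE ia) mul0r.
  by rewrite (inj_eq lift_inj) eq_sym.
have uL : L \in unitmx.
  have [Y OY] := OX; have : L *m usubmx (Q^T *m Y) = 1%:M.
    rewrite -OY -[in RHS](mulmx1 O) -oQ mulmxA -(mulmxA _ Q^T) LE -[in RHS](vsubmxK (Q^T *m Y)).
    by rewrite mul_row_col mul0mx addr0.
  by case/mulmx1_unit.
have hu : usubmx h = 0.
  rewrite -(mulKmx uL (usubmx h)); have -> : L *m usubmx h = 0; last by rewrite mulmx0.
  rewrite -Og -(mulmx1 O) -oQ mulmxA -(mulmxA _ Q^T) LE -/h -[in RHS](vsubmxK h).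
  by rewrite mul_row_col mul0mx addr0.
set u := rsubmx (y *m Q).
(* The rows of [O] have no component in the last coordinates, so only the coefficient of row j
   survives in g = T^T c. *)
have hd : dsubmx h = c j 0 *: u^T.
  have -> : dsubmx h = (rsubmx (T *m Q))^T *m c.
    by rewrite /h gE mulmxA -trmx_mul -mul_dsub_mx trmx_rsub.
  apply/matrixP => a b; rewrite mxE (bigD1 j)//= big1 => [|i]; last first.
    rewrite eq_sym => /unlift_some[k -> _]; rewrite mxE [X in X * _]mxE.
    have -> : (T *m Q) (lift j k) (rshift r a) = (O *m Q) k (rshift r a).
      by rewrite [in RHS]OE mul_rowsub_mx [in RHS]mxE.
    by rewrite OQ0 ?mul0r//= leq_addr.
  rewrite addr0 mulrC ord1 [RHS]mxE; congr (_ * _); rewrite [LHS]mxE [LHS]mxE [RHS]mxE [RHS]mxE.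
  by rewrite -[in RHS](row_insert_row j y O) -row_mul [RHS]mxE.
have cu : c j 0 * sqn u = 1.
  have : (y *m g) 0 0 = 1 by rewrite yg mxE.
  rewrite -(mulmx1 y) -oQ mulmxA -(mulmxA _ Q^T) -/h -(hsubmxK (y *m Q)) -(vsubmxK h).
  by rewrite mul_row_col hu mulmx0 add0r hd -scalemxAr mxE sqnE.
have -> : sqn g^T = sqn (row_mx (0 : 'rV_r) (c j 0 *: u)).
  rewrite -(sqn_orthomx _ oQ) -[g^T *m Q]trmxK trmx_mul trmxK -/h -(vsubmxK h) hu hd.
  by rewrite tr_col_mx trmx0 linearZ /= trmxK.
rewrite sqn_row_mx {1}/sqn big1 ?add0r => [|i _]; last by rewrite mxE expr0n.
have u0 : sqn u != 0 by apply: contra_eq_neq cu => ->; rewrite mulr0 eq_sym oner_eq0.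
have -> : sqn (c j 0 *: u) = c j 0 ^+ 2 * sqn u.
  by rewrite /sqn mulr_sumr; apply: eq_bigr => i _; rewrite mxE exprMn.
by rewrite expr2 -mulrA cu mulr1 -[LHS]mulr1 -(mulfV u0) mulrA cu mul1r.
Qed.

End dual_vector.

(** The vector [c] witnesses that y is not in the span of the rows of [O]. *)
Lemma row_free_insert_row (R : realType) r N (j : 'I_r.+1) (y : 'rV[R]_N) (O : 'M[R]_(r, N))
    (c : 'cV[R]_N) :
  row_free O -> O *m c = 0 -> (y *m c) 0 0 != 0 -> row_free (insert_row j y O).
Proof.
move=> fO Oc yc; apply: inj_row_free => v vT.
have vE : v *m insert_row j y O = v 0 j *: y + (\row_k v 0 (lift j k)) *m O.
  apply/rowP => k; rewrite !mxE (bigD1_ord j)//= !mxE unlift_none; congr (_ + _).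
  by apply: eq_bigr => l _; rewrite !mxE liftK.
have vj : v 0 j = 0.
  have : (v *m insert_row j y O *m c) 0 0 = 0 by rewrite vT mul0mx mxE.
  rewrite vE mulmxDl -mulmxA Oc mulmx0 addr0 -scalemxAl mxE => /eqP.
  by rewrite mulf_eq0 (negbTE yc) orbF => /eqP.
move: vE; rewrite vT vj scale0r add0r => /esym/eqP; rewrite mulmx_free_eq0// => /eqP v0.
apply/rowP => i; rewrite mxE; case: (unliftP j i) => [k ->|-> //].
by move/rowP: v0 => /(_ k); rewrite !mxE.
Qed.

Section gaussian_rows.
Local Open Scope ereal_scope.
Context (R : realType) d (T : measurableType d) (P : probability T R) (n N : nat).
Variable Om : T -> 'M[R]_(n, N).
Hypothesis gOm : gaussian_matrix P Om.

Lemma measurable_gaussian_matrix : measurable_fun setT Om.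
Proof. by have [mO _ _] := gOm; apply/measurable_mxP => i j; exact: mO. Qed.

Lemma measurable_insert_row d' (T' : measurableType d') q (j : 'I_q.+1)
    (f : T' -> 'rV[R]_N) (g : T' -> 'M[R]_(q, N)) :
  measurable_fun setT f -> measurable_fun setT g ->
  measurable_fun setT (fun w => insert_row j (f w) (g w)).
Proof.
move=> mf mg; apply/measurable_mxP => i c.
case: (unliftP j i) => [k ->|->].
  apply: (@eq_mfun _ _ _ _ _ (fun w => g w k c)); first by move=> w; rewrite mxE liftK.
  exact: (measurable_mxP _).1.
apply: (@eq_mfun _ _ _ _ _ (fun w => f w 0 c)%R); first by move=> w; rewrite mxE unlift_none.
exact: (measurable_mxP _).1.
Qed.

(** Conditioning on all selected rows but row j: the entries are enumerated with row j last, so that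
    [integral_gaussD] splits it off. *)
Lemma gaussian_matrix_row q (s : 'I_q.+1 -> 'I_n) (j : 'I_q.+1)
    (F : 'M[R]_(q.+1, N) -> \bar R) : injective s ->
  measurable_fun setT F -> (forall M, 0 <= F M) ->
  \int[P]_w F (rowsub s (Om w)) =
  \int[P]_w \int[gauss R N]_y F (insert_row j y (rowsub (s \o lift j) (Om w))).
Proof.
move=> inj_s mF F0.
pose e1 (a : 'I_(q * N)) : 'I_n * 'I_N :=
  let p := enum_val (cast_ord (esym (mxvec_cast q N)) a) in (s (lift j p.1), p.2).
pose e (k : 'I_(q * N + N)) := match fintype.split k with inl a => e1 a | inr c => (s j, c) end.
have el a : e (lshift N a) = e1 a by rewrite /e (unsplitK (inl a)).
have er c : e (rshift (q * N) c) = (s j, c) by rewrite /e (unsplitK (inr c)).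
have ie1 : injective e1.
  move=> a b; rewrite /e1; case Ea: (enum_val _) => [a1 a2]; case Eb: (enum_val _) => [b1 b2] /=.
  move=> [/inj_s/lift_inj ab1 ab2].
  apply: (@cast_ord_inj _ _ (esym (mxvec_cast q N))); apply: enum_val_inj.
  by rewrite Ea Eb ab1 ab2.
have ie : injective e.
  move=> k l; case: (split_ordP k) => a ->; case: (split_ordP l) => b ->; rewrite ?el ?er.
  - by move=> /ie1 ->.
  - by move=> [/inj_s/eqP]; rewrite eq_sym (negbTE (neq_lift _ _)).
  - by move=> [/inj_s/eqP]; rewrite (negbTE (neq_lift _ _)).
  - by move=> [->].
have vecE w : entries Om e1 w = mxvec (rowsub (s \o lift j) (Om w)).
  apply/rowP => k; rewrite mxE; case/mxvec_indexP: k => a b.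
  by rewrite mxvecE mxE /e1 /mxvec_index cast_ordK enum_rankK.
have rowE w : entries Om e w = row_mx (mxvec (rowsub (s \o lift j) (Om w))) (row (s j) (Om w)).
  apply/rowP => k; case: (split_ordP k) => a ->; rewrite mxE ?el ?er.
    by rewrite row_mxEl -vecE mxE.
  by rewrite row_mxEr mxE.
have mvec : measurable_fun setT (@vec_mx R q N) by exact: measurable_vec_mx.
have ml : measurable_fun setT (@lsubmx R 1 (q * N) N) by exact: measurable_lsubmx.
have mr : measurable_fun setT (@rsubmx R 1 (q * N) N) by exact: measurable_rsubmx.
pose G (v : 'rV[R]_(q * N + N)) := F (insert_row j (rsubmx v) (vec_mx (lsubmx v))).
have mG : measurable_fun setT G.
  apply: (measurableT_comp mF); apply: measurable_insert_row => //.
  exact: (measurableT_comp mvec ml).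
have G0 v : 0 <= G v by exact: F0.
transitivity (\int[P]_w G (entries Om e w)).
  apply: eq_integral => w _; rewrite rowE /G row_mxKl row_mxKr mxvecK; congr F.
  by rewrite -[LHS](insert_rowK j); congr insert_row; apply/matrixP => a b; rewrite !mxE.
rewrite (gaussian_law gOm ie mG G0) (integral_gaussD mG G0).
have mH : measurable_fun setT (fun o : 'rV[R]_(q * N) => \int[gauss R N]_y G (row_mx o y)).
  apply: (@measurable_fun_fubini_tonelli_F _ _ _ _ _ _ (fun oy => G (row_mx oy.1 oy.2))) => //.
  by apply: (measurableT_comp mG); exact: measurable_row_mx.
rewrite -(gaussian_law gOm ie1 mH); last by move=> v; apply: integral_ge0 => y _; exact: F0.
by apply: eq_integral => w _; apply: eq_integral => y _; rewrite vecE /G row_mxKl row_mxKr mxvecK.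
Qed.

(** Real-valued so that it can multiply an integrand and discard the matrices on which [invmx] has
    no meaning. *)
Definition row_freeb q (M : 'M[R]_(q, N)) : R := (row_free M)%:R.

Lemma measurable_row_free q : measurable_fun setT (@row_freeb q : _ -> measurableTypeR R).
Proof.
apply: (@eq_mfun _ _ _ (measurableTypeR R) _ (fun M : 'M[R]_(q, N) =>
  if \det (M *m M^T) == 0 then 0 else 1)%R).
  by move=> M; rewrite /row_freeb row_free_gram_unit unitmxE unitfE; case: eqP.
have md : measurable_fun setT (fun M : 'M[R]_(q, N) => (\det (M *m M^T) : measurableTypeR R)%R).
  by apply: measurable_det; apply: measurable_mulmx => //; exact: measurable_trmx.
apply: measurable_fun_ifT => //.
exact: measurable_fun_eqr.
Qed.

(** Induction on the rows: fewer than N rows leave a nonzero vector c orthogonal to all of them, and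
    the new row falls in the hyperplane orthogonal to c with probability 0. Failure is measured by
    the integral of its indicator. *)
Lemma gaussian_row_free q (s : 'I_q -> 'I_n) : injective s -> (q <= N)%N ->
  {ae P, forall w, row_free (rowsub s (Om w))}.
Proof.
pose N1 k (M : 'M[R]_(k, N)) : \bar R := (1 - row_freeb M)%:E.
have N10 k (M : 'M[R]_(k, N)) : 0 <= N1 k M.
  by rewrite /N1 /row_freeb lee_fin subr_ge0; case: row_free; rewrite ?ler01.
have N11 k (M : 'M[R]_(k, N)) : N1 k M <= 1.
  by rewrite /N1 /row_freeb lee_fin gerBl; case: row_free.
have mN1 k : measurable_fun setT (N1 k).
  apply/measurable_EFinP; apply: measurable_funB => //; exact: measurable_row_free.
suff : injective s -> (q <= N)%N -> \int[P]_w N1 q (rowsub s (Om w)) = 0.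
  move=> + inj_s qN => /(_ inj_s qN) i0.
  have mf : measurable_fun setT (fun w => N1 q (rowsub s (Om w))).
    by apply: (measurableT_comp (mN1 _)); apply: measurable_mxsub; exact: measurable_gaussian_matrix.
  have /(ae_eq_integral_abs P measurableT mf) : \int[P]_w `|N1 q (rowsub s (Om w))| = 0.
    by rewrite -i0; apply: eq_integral => w _; rewrite gee0_abs.
  apply: filterS => w /(_ I); rewrite /N1 /row_freeb; case: row_free => //= -[/eqP].
  by rewrite subr0 oner_eq0.
elim: q s => [|q IH] s inj_s qN.
  apply: integral0_eq => w _; rewrite /N1 /row_freeb (_ : row_free _) ?subrr//.
  by rewrite /row_free eqn_leq rank_leq_row.
rewrite (gaussian_matrix_row ord0 inj_s (mN1 _) (N10 _)).
apply/eqP; rewrite eq_le; apply/andP; split; last first.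
  by apply: integral_ge0 => w _; apply: integral_ge0.
have inj_sl : injective (s \o lift ord0) by apply: inj_comp => //; exact: lift_inj.
rewrite -(IH (s \o lift ord0) inj_sl (ltnW qN)).
apply: ge0_le_integral => //.
- by move=> w _; exact: integral_ge0.
- apply: (@measurable_fun_fubini_tonelli_F _ _ _ _ _ _
    (fun wy => N1 q.+1 (insert_row ord0 wy.2 (rowsub (s \o lift ord0) (Om wy.1))))) => //.
  apply: (measurableT_comp (mN1 _)); apply: measurable_insert_row => //.
  by apply: measurable_mxsub; exact: (measurableT_comp measurable_gaussian_matrix).
- by apply: (measurableT_comp (mN1 _)); apply: measurable_mxsub; exact: measurable_gaussian_matrix.
move=> w _; set O := rowsub _ _.
have mT : measurable_fun setT (fun y => N1 q.+1 (insert_row ord0 y O)).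
  by apply: (measurableT_comp (mN1 _)); exact: measurable_insert_row.
have [fO|nfO] := boolP (row_free O); last first.
  rewrite {2}/N1 /row_freeb (negbTE nfO) subr0.
  have gT : gauss R N setT = 1 by exact: probability_setT.
  apply: (@le_trans _ _ (\int[gauss R N]_(y in setT) cst 1 y)).
    by apply: ge0_le_integral => //.
  by rewrite integral_cst// [X in _ * X]gT mule1.
have [c c0 Oc] : exists2 c : 'cV[R]_N, c != 0%R & (O *m c = 0)%R.
  have : cokermx O != 0%R.
    by rewrite -mxrank_eq0 mxrank_coker -lt0n subn_gt0 (leq_ltn_trans (rank_leq_row _)).
  rewrite -(inj_eq trmx_inj) trmx0 => /rowV0Pn[v /submxP[u ->] u0].
  exists (cokermx O *m u^T)%R; last by rewrite mulmxA mulmx_coker mul0mx.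
  by apply: contraNneq u0 => e0; rewrite -[X in X *m _]trmxK -trmx_mul e0 trmx0.
have -> : N1 q O = 0 by rewrite /N1 /row_freeb fO subrr.
have [N' NE] : exists N', N = N'.+1 by case: (N) qN => // N' _; exists N'.
have gc0 : gauss R N [set y : 'rV[R]_N | (y *m c) ord0 ord0 = 0%R] = 0.
  by move: c c0 {Oc}; rewrite NE => c c0; exact: gauss_linear_null.
have mA : measurable [set y : 'rV[R]_N | (y *m c) ord0 ord0 = 0%R].
  have ml : measurable_fun setT (fun z : 'rV[R]_N => ((z *m c) ord0 ord0 : measurableTypeR R)).
    by apply: (measurableT_comp (measurable_entry _ _)); exact: measurable_mulmx.
  by have := ml measurableT _ (measurable_set1 (0%R : R)); rewrite setTI.
rewrite -gc0 -(setIT [set y | _]) -integral_indic//; apply: ge0_le_integral => //.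
  by apply/measurable_EFinP; exact: measurable_indic.
move=> y _; rewrite indicE; case: (boolP (y \in _)) => [_|/negP ny]; first exact: N11.
rewrite /N1 /row_freeb (@row_free_insert_row _ _ _ _ _ _ c)// ?subrr//.
by apply/eqP => yc; apply: ny; exact: mem_set.
Qed.

End gaussian_rows.

Section lstsq_moment.
Local Open Scope ereal_scope.
Context (R : realType) d (T : measurableType d) (P : probability T R).

Lemma gauss_cst m (k : \bar R) : \int[gauss R m]_v k = k.
Proof.
have gT : gauss R m setT = 1 by exact: probability_setT.
by rewrite integral_cst// [X in _ * X]gT mule1.
Qed.

(** The p-th absolute moment of a standard normal variable. *)
Let K p : \bar R := (normal_peak 1)%:E * gmom R p.

Let K0 p : 0 <= K p.
Proof. by rewrite /K mule_ge0 ?lee_fin ?normal_peak_ge0// ltW// gmom_gt0. Qed.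

Let phi r0 p (v : 'rV[R]_(r0 + p.+2)) : \bar R :=
  ((Num.sqrt (sqn (rsubmx v)))^-1 ^+ p.+1)%:E.

Let mphi r0 p : measurable_fun setT (@phi r0 p).
Proof.
apply/measurable_EFinP; apply: measurable_funX; apply: (measurableT_comp (@measurable_invr R)).
apply: (measurableT_comp (@measurable_sqrt R)); apply: (measurableT_comp (@measurable_sqn R _)).
exact: measurable_rsubmx.
Qed.

Let phi0 r0 p v : 0 <= @phi r0 p v.
Proof. by rewrite lee_fin exprn_ge0// invr_ge0 sqrtr_ge0. Qed.

(** Rotation invariance removes [Q] and the first r0 coordinates integrate to 1;
    [gauss_inverse_moment] then turns the constant into that of order 0, which is 1. *)
Let integral_phi r0 p (Q : 'M[R]_(r0 + p.+2)) : orthomx Q ->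
  \int[gauss R (r0 + p.+2)]_y (phi (y *m Q) * K p.+1) <= 1.
Proof.
move=> oQ; pose f (y : 'rV[R]_(r0 + p.+2)) := K p.+1 * phi y.
have mf : measurable_fun setT f by apply: emeasurable_funM => //; exact: mphi.
have f0 y : 0 <= f y by rewrite mule_ge0.
have -> : \int[gauss R (r0 + p.+2)]_y (phi (y *m Q) * K p.+1) = \int[gauss R (r0 + p.+2)]_y f (y *m Q).
  by apply: eq_integral => y _; rewrite muleC.
rewrite (integral_gauss_orthomx oQ mf f0) /f ge0_integralZl//; last exact: mphi.
rewrite (integral_gaussD (@mphi _ _) (@phi0 _ _)).
under eq_integral do under eq_integral do rewrite /phi row_mxKr.
rewrite gauss_cst /K -muleA -[leRHS](gmom_gauss R) lee_pmul2l//.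
  exact: gauss_inverse_moment.
by rewrite lte_fin normal_peak_gt0.
Qed.

Definition dual_norm r N (j : 'I_r) (W : 'M[R]_(r, N)) : R :=
  (row_freeb W * Num.sqrt (sqn (col j (W^T *m invmx (W *m W^T)))^T))%R.

Lemma measurable_dual_norm r N (j : 'I_r) :
  measurable_fun setT (@dual_norm r N j : _ -> measurableTypeR R).
Proof.
apply: measurable_funM; first exact: measurable_row_free.
apply: (measurableT_comp (@measurable_sqrt R)); apply: (measurableT_comp (@measurable_sqn R _)).
apply: measurable_trmx; apply: (@eq_mfun _ _ _ _ _ (fun W : 'M[R]_(r, N) =>
  mxsub id (fun=> j) (W^T *m invmx (W *m W^T)))%R).
  by move=> W; apply/matrixP => a b; rewrite !mxE.
apply: measurable_mxsub; apply: measurable_mulmx; first exact: measurable_trmx.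
by apply: measurable_invmx; apply: measurable_mulmx => //; exact: measurable_trmx.
Qed.

(** The rotation [Q] depends on [O] alone, so it is fixed while row j is integrated. *)
Lemma integral_dual_norm r0 p (j : 'I_r0.+1) (O : 'M[R]_(r0, r0 + p.+2)) :
  \int[gauss R (r0 + p.+2)]_y ((dual_norm j (insert_row j y O) ^+ p.+1)%:E * K p.+1) <= 1.
Proof.
have [Q oQ OQ0] := lower_triangularize O (leq_addr _ _).
apply: le_trans (integral_phi oQ); apply: ge0_le_integral => //.
- by move=> y _; rewrite mule_ge0// lee_fin exprn_ge0// mulr_ge0 ?sqrtr_ge0// /row_freeb; case: row_free.
- apply: emeasurable_funM => //; apply/measurable_EFinP; apply: measurable_funX.
  by apply: (measurableT_comp (@measurable_dual_norm _ _ _)); exact: measurable_insert_row.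
- by apply: emeasurable_funM => //; apply: (measurableT_comp (@mphi _ _)); exact: measurable_mulmx.
move=> y _; apply: lee_wpmul2r => //; rewrite lee_fin /dual_norm /row_freeb.
case: (boolP (row_free _)) => fT; last by rewrite mul0r expr0n exprn_ge0// invr_ge0 sqrtr_ge0.
by rewrite mul1r (sqn_dual_vector oQ OQ0 fT) sqrtrV ?sqn_ge0.
Qed.

(** Two successive conditionings: row i of W2 given W1, which leaves the norm of column j of W1^+,
    then row j of W1 given its other rows. Here r = r0 + 1 and N = r0 + p + 2, so the order p + 1 is
    N - r. *)
Lemma lstsq_moment r0 p m (Om : T -> 'M[R]_(r0.+1 + m, r0 + p.+2)) (i : 'I_m) (j : 'I_r0.+1) :
  gaussian_matrix P Om ->
  \int[P]_w (row_freeb (usubmx (Om w)) *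
    `|lstsq (usubmx (Om w)) (dsubmx (Om w)) i j| ^+ p.+1)%:E <= 1.
Proof.
move=> gOm; set N := (r0 + p.+2)%N in Om gOm *.
have N0 : (0 < N)%N by rewrite /N addnS.
pose X (W : 'M[R]_(r0.+1, N)) := W^T *m invmx (W *m W^T).
pose H (M : 'M[R]_(r0.+2, N)) : \bar R := (row_freeb (rowsub (lift ord0) M) *
  `|(row ord0 M *m X (rowsub (lift ord0) M)) ord0 j| ^+ p.+1)%:E.
have H0 M : 0 <= H M by rewrite lee_fin mulr_ge0// /row_freeb; case: row_free.
have mH : measurable_fun setT H.
  apply/measurable_EFinP; apply: measurable_funM.
    by apply: (measurableT_comp (@measurable_row_free R _ _)); exact: measurable_mxsub.
  apply: (measurableT_comp (@measurable_normX R p.+1)); apply: (measurableT_comp (measurable_entry _ _)).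
  apply: measurable_mulmx.
    by apply: (measurable_reindex_mx (s := fun _ _ => ord0)) => M a b; rewrite mxE.
  apply: measurable_mulmx; first by apply: measurable_trmx; exact: measurable_mxsub.
  apply: measurable_invmx; apply: measurable_mulmx; first exact: measurable_mxsub.
  by apply: measurable_trmx; exact: measurable_mxsub.
(* Row i of W2 is listed first, then the rows of W1. *)
pose s (k : 'I_r0.+2) : 'I_(r0.+1 + m) :=
  if unlift ord0 k is Some l then lshift m l else rshift r0.+1 i.
have s0 : s ord0 = rshift r0.+1 i by rewrite /s unlift_none.
have sl l : s (lift ord0 l) = lshift m l by rewrite /s liftK.
have inj_s : injective s.
  move=> k l; case: (unliftP ord0 k) => [k' ->|->]; case: (unliftP ord0 l) => [l' ->|->];
    rewrite ?sl ?s0 //.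
  - by move=> /lshift_inj ->.
  - by move=> /eqP; rewrite eq_lrshift.
  - by move=> /eqP; rewrite eq_rlshift.
have rsE w : rowsub (s \o lift ord0) (Om w) = usubmx (Om w).
  by apply/matrixP => a b; rewrite !mxE /= sl.
have -> : \int[P]_w (row_freeb (usubmx (Om w)) *
    `|lstsq (usubmx (Om w)) (dsubmx (Om w)) i j| ^+ p.+1)%:E = \int[P]_w H (rowsub s (Om w)).
  apply: eq_integral => w _; rewrite /H.
  have -> : rowsub (lift ord0) (rowsub s (Om w)) = usubmx (Om w).
    by rewrite -rsE; apply/matrixP => a b; rewrite !mxE.
  have -> : row ord0 (rowsub s (Om w)) = row i (dsubmx (Om w)).
    by apply/matrixP => a b; rewrite !mxE s0.
  by rewrite -row_mul [in RHS]mxE.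
rewrite (gaussian_matrix_row gOm ord0 inj_s mH H0).
pose H1 (W : 'M[R]_(r0.+1, N)) : \bar R := (dual_norm j W ^+ p.+1)%:E * K p.+1.
have inner W : \int[gauss R N]_y H (insert_row ord0 y W) = H1 W.
  have HE y : H (insert_row ord0 y W) =
      (row_freeb W)%:E * (`|(y *m col j (X W)) ord0 ord0| ^+ p.+1)%:E.
    by rewrite /H row_insert_row rowsub_insert_row -EFinM (colE j) mulmxA -colE [in RHS]mxE.
  under eq_integral do rewrite HE.
  rewrite ge0_integralZl//; last 2 first.
  - apply/measurable_EFinP; apply: (measurableT_comp (@measurable_normX R p.+1)).
    by apply: (measurableT_comp (measurable_entry _ _)); exact: measurable_mulmx.
  - by rewrite lee_fin /row_freeb; case: row_free.
  have -> : \int[gauss R N]_y (`|(y *m col j (X W)) ord0 ord0| ^+ p.+1)%:E =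
      (Num.sqrt (sqn (col j (X W))^T) ^+ p.+1)%:E * K p.+1.
    by move: (col j (X W)); rewrite -(prednK N0) => g; exact: gauss_linear_moment.
  rewrite muleA -EFinM /H1 /dual_norm exprMn; congr ((_ * _)%:E * _).
  by rewrite /row_freeb; case: row_free; rewrite ?expr1n ?expr0n.
have H10 W : 0 <= H1 W.
  by rewrite mule_ge0// lee_fin exprn_ge0// mulr_ge0 ?sqrtr_ge0// /row_freeb; case: row_free.
have mH1 : measurable_fun setT H1.
  apply: emeasurable_funM => //; apply/measurable_EFinP; apply: measurable_funX.
  exact: measurable_dual_norm.
under eq_integral do rewrite inner.
have inj_s1 : injective (s \o lift ord0) by apply: inj_comp => //; exact: lift_inj.
rewrite (gaussian_matrix_row gOm j inj_s1 mH1 H10).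
have mO := measurable_gaussian_matrix gOm.
apply: (@le_trans _ _ (\int[P]_(w in setT) cst 1 w)).
  apply: ge0_le_integral => //.
  - by move=> w _; apply: integral_ge0.
  - apply: (@measurable_fun_fubini_tonelli_F _ _ _ _ _ _
      (fun wy => H1 (insert_row j wy.2 (rowsub ((s \o lift ord0) \o lift j) (Om wy.1))))) => //.
    apply: (measurableT_comp mH1); apply: measurable_insert_row => //.
    by apply: measurable_mxsub; exact: (measurableT_comp mO).
  - by move=> w _; exact: integral_dual_norm.
by rewrite integral_cst// [X in _ * X]probability_setT mule1.
Qed.

End lstsq_moment.

(** * Moments of the Nystrom error *)

Section half_power.
Variable R : realType.
Implicit Types (k : nat) (x y : R).

(* x ^ (k / 2), which avoids real exponents. *)
Definition hpow k x : R := Num.sqrt x ^+ k.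

Lemma hpow_ge0 k x : 0 <= hpow k x.
Proof. by rewrite exprn_ge0 ?sqrtr_ge0. Qed.

Lemma hpowM k x y : 0 <= x -> hpow k (x * y) = hpow k x * hpow k y.
Proof. by move=> x0; rewrite /hpow sqrtrM// exprMn. Qed.

Lemma hpow0 k : hpow k.+1 0 = 0.
Proof. by rewrite /hpow sqrtr0 expr0n. Qed.

Lemma hpow1 k : hpow k 1 = 1.
Proof. by rewrite /hpow sqrtr1 expr1n. Qed.

Lemma hpow_sqr k x : hpow k (x ^+ 2) = `|x| ^+ k.
Proof. by rewrite /hpow sqrtr_sqr. Qed.

Lemma hpow_sqrX k x : 0 <= x -> hpow k x ^+ 2 = x ^+ k.
Proof. by move=> x0; rewrite /hpow -exprM mulnC exprM sqr_sqrtr. Qed.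

Lemma le_hpow k x y : x <= y -> hpow k x <= hpow k y.
Proof. by move=> xy; apply: lerXn2r; rewrite ?nnegrE ?sqrtr_ge0// ler_wsqrtr. Qed.

Lemma hpow_gt0 k x : 0 < x -> 0 < hpow k x.
Proof. by move=> x0; rewrite exprn_gt0// sqrtr_gt0. Qed.

Lemma measurable_hpow k : measurable_fun setT (hpow k : measurableTypeR R -> measurableTypeR R).
Proof. by apply: measurable_funX; exact: measurable_sqrt. Qed.

(** The tangent at 1 of a convex function. In y = sqrt x it is a polynomial inequality, proved from
    k = 2 and k = 3 by induction in steps of 2. *)
Lemma hpow_tangent k x : (2 <= k)%N -> 0 <= x -> 1 + k%:R / 2 * (x - 1) <= hpow k x.
Proof.
move=> k2 x0; rewrite -[in leLHS](sqr_sqrtr x0) /hpow; set y := Num.sqrt x.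
have y0 : 0 <= y by exact: sqrtr_ge0.
suff : 0 <= y ^+ k - 1 - k%:R / 2 * (y ^+ 2 - 1) by lra.
elim/ltn_ind: k k2 => -[|[|[|[|k]]]]// IH _.
- by rewrite divff// mul1r; lra.
- have -> : y ^+ 3 - 1 - 3 / 2 * (y ^+ 2 - 1) = (y - 1) ^+ 2 * (y + 1 / 2) by field.
  by rewrite mulr_ge0 ?sqr_ge0//; lra.
have := IH k.+2 (leqnSn _) isT; set u := k.+2.
have -> : (u.+2)%:R = u%:R + 2 :> R by rewrite -addn2 natrD.
move=> h; rewrite (_ : _ - _ = y ^+ 2 * (y ^+ u - 1 - u%:R / 2 * (y ^+ 2 - 1)) +
   u%:R / 2 * (y ^+ 2 - 1) ^+ 2); last by rewrite -addn2 exprD; field.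
by rewrite addr_ge0// mulr_ge0// ?sqr_ge0// divr_ge0.
Qed.

(** Sum the tangent inequality at the weighted mean [mu]; its linear part averages out. *)
Lemma hpow_jensen k (I : finType) (w x : I -> R) : (2 <= k)%N ->
  (forall i, 0 <= w i) -> (forall i, 0 <= x i) ->
  hpow k (\sum_i w i * x i) <= hpow k (\sum_i w i) * \sum_i w i / (\sum_j w j) * hpow k (x i).
Proof.
move=> k2 w0 x0; set W := \sum_i w i; set m := \sum_i w i * x i.
have W0 : 0 <= W by exact: sumr_ge0.
have m0 : 0 <= m by apply: sumr_ge0 => i _; exact: mulr_ge0.
have R0 : 0 <= hpow k W * \sum_i w i / W * hpow k (x i).
  by rewrite mulr_ge0 ?hpow_ge0// sumr_ge0// => i _; rewrite mulr_ge0 ?hpow_ge0// divr_ge0.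
(* This also covers a zero total weight. *)
have [me|mn] := eqVneq m 0; first by rewrite me; case: k k2 R0 => // k _; rewrite hpow0.
have mp : 0 < m by rewrite lt0r mn.
have Wp : 0 < W.
  rewrite lt0r W0 andbT; apply: contra_neq mn => We; rewrite /m big1// => i _.
  have /eqP := We; rewrite psumr_eq0// => /allP/(_ i); rewrite mem_index_enum => /(_ isT)/eqP ->.
  by rewrite mul0r.
pose mu := m / W; have mup : 0 < mu by exact: divr_gt0.
have -> : hpow k m = hpow k W * hpow k mu by rewrite -hpowM// /mu mulrC divfK// gt_eqF.
apply: ler_wpM2l; first exact: hpow_ge0.
have h i : hpow k mu * (1 + k%:R / 2 * (x i / mu - 1)) <= hpow k (x i).
  have -> : hpow k (x i) = hpow k mu * hpow k (x i / mu).
    by rewrite -hpowM ?ltW// mulrC divfK// gt_eqF.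
  by apply: ler_wpM2l; rewrite ?hpow_ge0// hpow_tangent// divr_ge0// ltW.
apply: (@le_trans _ _ (\sum_i w i / W * (hpow k mu * (1 + k%:R / 2 * (x i / mu - 1))))).
  rewrite le_eqVlt; apply/orP; left; apply/eqP.
  have -> : \sum_i w i / W * (hpow k mu * (1 + k%:R / 2 * (x i / mu - 1))) =
    hpow k mu * ((1 - k%:R / 2) * (\sum_i w i) / W + k%:R / 2 * (\sum_i w i * x i) / W / mu).
    rewrite mulrDr !mulr_sumr !mulr_suml !mulr_sumr -big_split/=.
    by apply: eq_bigr => i _; ring.
  rewrite -/W -/m /mu; field.
  by rewrite !gt_eqF.
by apply: ler_sum => i _; apply: ler_wpM2l => //; rewrite divr_ge0.
Qed.

End half_power.

Lemma measurable_tr_nystrom d (T : measurableType d) (R : realType) n N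
    (f : T -> 'M[R]_n) (g : T -> 'M[R]_(n, N)) :
  measurable_fun setT f -> measurable_fun setT g -> (forall w, symmetric_psd (f w)) ->
  measurable_fun setT (fun w => \tr (nystrom (f w) (g w)) : measurableTypeR R).
Proof.
move=> mf mg pf.
have mtr p (h : T -> 'M[R]_p) : measurable_fun setT h ->
    measurable_fun setT (fun w => \tr (h w) : measurableTypeR R).
  by move=> /measurable_mxP mh; apply: measurable_sum => i; exact: mh.
pose h k w := \tr ((f w *m g w) *m invmx ((g w)^T *m f w *m g w + (k.+1%:R^-1)%:M) *m (f w *m g w)^T).
apply: (@measurable_fun_cvg _ _ _ _ h) => [k|w _]; last exact: nystrom_regularized_cvg.
have mfg : measurable_fun setT (fun w => f w *m g w) by exact: measurable_mulmx.
apply: mtr; apply: measurable_mulmx; last exact: measurable_trmx.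
apply: measurable_mulmx => //; apply: measurable_invmx; apply: measurable_addmx => //.
by apply: measurable_mulmx => //; apply: measurable_mulmx => //; exact: measurable_trmx.
Qed.
Section nystrom_gap_moment.
Local Open Scope ereal_scope.
Context (R : realType) d (T : measurableType d) (P : probability T R).

Definition nystrom_gap n N (M : 'M[R]_n) (Om : 'M[R]_(n, N)) : R :=
  (\tr M - \tr (nystrom M Om))%R.

(** Rotation invariance applied to the indicator of the exceptional set. *)
Lemma gaussian_ae_rotate n N (Om : T -> 'M[R]_(n, N)) (V : 'M[R]_n) (A : set 'M[R]_(n, N)) :
  gaussian_matrix P Om -> orthomx V -> measurable A ->
  {ae P, forall w, A (Om w)} -> {ae P, forall w, A (V *m Om w)}.
Proof.
move=> gOm oV mA; have mO := measurable_gaussian_matrix gOm.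
have mVO : measurable_fun setT (fun w => V *m Om w) by exact: measurable_mulmx.
have mC (f : T -> 'M[R]_(n, N)) : measurable_fun setT f -> measurable (f @^-1` (~` A)).
  by move=> mf; rewrite -[X in measurable X]setTI; apply: mf => //; exact: measurableC.
have intC (f : T -> 'M[R]_(n, N)) : measurable_fun setT f ->
    \int[P]_w (\1_(~` A) (f w))%:E = P (f @^-1` (~` A)).
  move=> mf; transitivity (\int[P]_w (\1_(f @^-1` (~` A)) w)%:E); last first.
    by rewrite integral_indic ?setIT//; exact: mC.
  by apply: eq_integral => w _; rewrite !indicE.
move=> /(@negligibleP _ _ _ P (Om @^-1` (~` A)) (mC _ mO)) O0.
apply/(@negligibleP _ _ _ P ((fun w => V *m Om w) @^-1` (~` A)) (mC _ mVO)).
rewrite -[LHS](intC _ mVO).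
rewrite (gaussian_matrix_rotate gOm (F := fun M => (\1_(~` A) M)%:E) oV) ?(intC _ mO)//.
by apply/measurable_EFinP; apply: measurable_indic; exact: measurableC.
Qed.

Lemma nystrom_gap_moment_split r0 p m (M : 'M[R]_(r0.+1 + m))
    (Om : T -> 'M[R]_(r0.+1 + m, r0 + p.+2)) :
  (0 < p)%N -> symmetric_psd M -> gaussian_matrix P Om ->
  \int[P]_w (hpow p.+1 (nystrom_gap M (Om w)))%:E <=
  (hpow p.+1 ((1 + r0.+1%:R) * \sum_(i < r0.+1 + m | (r0.+1 <= i)%N) sigma M i))%:E.
Proof.
move=> p0 pM gOm; have [V oV [l ME [l0 sl]]] := spectral_psd pM.
set r := r0.+1 in M Om pM gOm V oV l ME l0 sl *.
have -> : (\sum_(i < r + m | (r <= i)%N) sigma M i = \sum_(i < m) l 0 (rshift r i))%R.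
  rewrite big_split_ord/= big_pred0 ?add0r => [|i]; last by rewrite leqNgt ltn_ord.
  by apply: eq_big => [i|i _]; rewrite ?leq_addr.
(* In the second index [ord0] stands for the summand 1 and the other values for the x_ij^2. Each of
   these 1 + r terms carries the same eigenvalue, so the total weight is (1 + r) times the tail
   sum. *)
pose wt (io : 'I_m * 'I_r.+1) := l 0%R (rshift r io.1).
have wt0 io : (0 <= wt io)%R by exact: l0.
have sum_pair (F : 'I_m -> 'I_r.+1 -> R) :
    (\sum_io F io.1 io.2 = \sum_i (F i ord0 + \sum_j F i (lift ord0 j)))%R.
  rewrite -(pair_bigA _ F) /=; apply: eq_bigr => i _.
  by rewrite big_ord_recl.
have sum_wt : (\sum_io wt io = (1 + r%:R) * \sum_(i < m) l 0 (rshift r i))%R.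
  rewrite (sum_pair (fun i _ => l 0%R (rshift r i))) mulr_sumr; apply: eq_bigr => i _.
  by rewrite sumr_const card_ord mulrDl mul1r mulr_natl.
rewrite -sum_wt; set S := (\sum_io wt io)%R.
pose a i j w := lstsq (usubmx (V *m Om w)) (dsubmx (V *m Om w)) i j.
pose x w (io : 'I_m * 'I_r.+1) : R := if unlift ord0 io.2 is Some j then (a io.1 j w ^+ 2)%R else 1%R.
have x0 w io : (0 <= x w io)%R by rewrite /x; case: (unlift ord0 io.2) => // j; exact: sqr_ge0.
(* Equal to [hpow] of [x] almost surely; the indicator gives it the form that [lstsq_moment] bounds
   by 1. *)
pose b (io : 'I_m * 'I_r.+1) w : R :=
  if unlift ord0 io.2 is Some j then (row_freeb (usubmx (V *m Om w)) * `|a io.1 j w| ^+ p.+1)%R else 1%R.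
have rf01 q (W : 'M[R]_(q, r0 + p.+2)) : (0 <= row_freeb W)%R by rewrite /row_freeb; case: row_free.
have b0 io w : (0 <= b io w)%R.
  by rewrite /b; case: (unlift ord0 io.2) => // j; rewrite mulr_ge0// exprn_ge0.
have mO := measurable_gaussian_matrix gOm.
pose g (i : 'I_m) (j : 'I_r) (W : 'M[R]_(r + m, r0 + p.+2)) : \bar R :=
  (row_freeb (usubmx W) * `|lstsq (usubmx W) (dsubmx W) i j| ^+ p.+1)%:E.
have mu : measurable_fun setT (@usubmx R r m (r0 + p.+2)).
  exact: measurable_usubmx.
have md : measurable_fun setT (@dsubmx R r m (r0 + p.+2)).
  exact: measurable_dsubmx.
have mrf : measurable_fun setT (fun W : 'M[R]_(r + m, r0 + p.+2) => row_freeb (usubmx W) : measurableTypeR R).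
  exact: (measurableT_comp (@measurable_row_free R _ _)).
have mg i j : measurable_fun setT (g i j).
  apply/measurable_EFinP; apply: measurable_funM => //.
  apply: (measurableT_comp (@measurable_normX R p.+1)); apply: (measurableT_comp (measurable_entry _ _)).
  apply: measurable_mulmx => //; apply: measurable_mulmx; first exact: measurable_trmx.
  by apply: measurable_invmx; apply: measurable_mulmx => //; exact: measurable_trmx.
have mb io : measurable_fun setT (fun w => (b io w)%:E).
  rewrite /b; case: (unlift ord0 io.2) => [j|]; last exact: measurable_cst.
  by apply: (measurableT_comp (mg _ _)); exact: measurable_mulmx.
have ib io : \int[P]_w (b io w)%:E <= 1.
  rewrite /b; case: (unlift ord0 io.2) => [j|]; last first.
    by rewrite integral_cst// [X in _ * X]probability_setT mule1.
  rewrite (gaussian_matrix_rotate gOm (F := g io.1 j) oV)//; first exact: lstsq_moment.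
  by move=> W; rewrite lee_fin mulr_ge0// exprn_ge0.
apply: (@le_trans _ _ (\int[P]_w ((hpow p.+1 S)%:E * \sum_io ((wt io / S)%:E * (b io w)%:E)))).
  apply: ae_ge0_le_integral => //.
  - by move=> w _; rewrite lee_fin hpow_ge0.
  - apply/measurable_EFinP; apply: (measurableT_comp (@measurable_hpow R _)).
    by apply: measurable_funB => //; exact: measurable_tr_nystrom.
  - move=> w _; rewrite mule_ge0 ?lee_fin ?hpow_ge0// sume_ge0// => io _.
    by rewrite mule_ge0// lee_fin ?divr_ge0// sumr_ge0.
  - apply: emeasurable_funM => //; apply: emeasurable_sum => io _.
    by apply: emeasurable_funM.
  have /(gaussian_ae_rotate gOm oV) : {ae P, forall w, [set W | row_free (usubmx W)] (Om w)}.
    have rN : (r <= r0 + p.+2)%N by rewrite /r addnS ltnS leq_addr.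
    have := gaussian_row_free gOm (@lshift_inj r m) rN.
    apply: filterS => w /=; congr (is_true (row_free _)).
    by apply/matrixP => i j; rewrite !mxE.
  have mrf' : measurable [set W : 'M[R]_(r + m, r0 + p.+2) | row_free (usubmx W)].
    rewrite (_ : [set W | _] = (fun W : 'M[R]_(r + m, r0 + p.+2) => row_freeb (usubmx W)) @^-1` [set 1%R]).
      by rewrite -[X in measurable X]setTI; apply: mrf.
    apply/seteqP; split => W /=; rewrite /row_freeb; first by move=> ->.
    by case: row_free => // /eqP; rewrite eq_sym oner_eq0.
  move=> /(_ mrf'); apply: filterS => w /= rfW _.
  under eq_bigr do rewrite -EFinM.
  rewrite sumEFin -EFinM lee_fin.
  have xb io : hpow p.+1 (x w io) = b io w.
    rewrite /x /b; case: (unlift _ _) => [j|]; last by rewrite hpow1.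
    by rewrite hpow_sqr /row_freeb rfW mul1r.
  under eq_bigr do rewrite -xb.
  apply: (le_trans _ (hpow_jensen _ wt0 (x0 w))) => //; apply: le_hpow.
  have xE : (\sum_io wt io * x w io = \sum_i l 0 (rshift r i) * (1 + \sum_j a i j w ^+ 2))%R.
    rewrite (sum_pair (fun i o => l 0 (rshift r i) * (if unlift ord0 o is Some j then a i j w ^+ 2 else 1)))%R.
    apply: eq_bigr => i _; rewrite unlift_none mulrDr mulr_sumr; congr (_ + _)%R.
    by apply: eq_bigr => j _; rewrite liftK.
  rewrite xE /nystrom_gap ME; apply: nystrom_gap_lstsq => //.
  by rewrite -ME.
rewrite ge0_integralZl//; last 3 first.
- by apply: emeasurable_sum => io; apply: emeasurable_funM.
- by move=> w _; apply: sume_ge0 => io _; rewrite -EFinM lee_fin mulr_ge0// divr_ge0// sumr_ge0.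
- by rewrite lee_fin hpow_ge0.
rewrite -[leRHS]mule1; apply: lee_wpmul2l; first by rewrite lee_fin hpow_ge0.
rewrite ge0_integral_sum//; last 2 first.
- by move=> io; apply: emeasurable_funM.
- by move=> io w _; rewrite -EFinM lee_fin mulr_ge0// divr_ge0// sumr_ge0.
apply: (@le_trans _ _ (\sum_io (wt io / S)%:E)).
  apply: lee_sum => io _; rewrite ge0_integralZl//; last 2 first.
  - by move=> w _; rewrite lee_fin.
  - by rewrite lee_fin divr_ge0// sumr_ge0.
  by rewrite -[leRHS]mule1; apply: lee_wpmul2l => //; rewrite lee_fin divr_ge0// sumr_ge0.
rewrite sumEFin lee_fin -mulr_suml -/S.
(* For a zero total weight the division yields 0, and the bound by 1 still holds. *)
have [->|S0] := eqVneq S 0%R; first by rewrite mul0r ler01.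
by rewrite divff.
Qed.

End nystrom_gap_moment.

(** * From moments to the tail of the integral *)

Section tail_bound.
Local Open Scope ereal_scope.

(* ge0_le_integral without measurability, as the integral is a supremum over
   simple functions below the integrand. *)
Lemma ge0_le_lower_integral d (T : measurableType d) (R : realType)
    (mu : {measure set T -> \bar R}) (D : set T) (f g : T -> \bar R) :
  (forall x, D x -> 0 <= f x) -> (forall x, D x -> f x <= g x) ->
  \int[mu]_(x in D) f x <= \int[mu]_(x in D) g x.
Proof.
move=> f0 fg; have g0 x : D x -> 0 <= g x by move=> Dx; exact: le_trans (f0 _ Dx) (fg _ Dx).
rewrite integral_mkcond [leRHS]integral_mkcond !ge0_integralTE.
- apply: ub_ereal_sup => _ [h /= hf <-]; apply: ereal_sup_ubound; exists h => // x /=.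
  apply: le_trans (hf x) _; rewrite !patchE; case: ifPn => // /set_mem; exact: fg.
- by move=> x; rewrite patchE; case: ifPn => // /set_mem; exact: g0.
- by move=> x; rewrite patchE; case: ifPn => // /set_mem; exact: f0.
Qed.

Context (R : realType) d (T : measurableType d) (P : probability T R).
Notation leb := (@lebesgue_measure R).
Variables (D : set R) (X : R -> T -> R) (k : nat).
Hypothesis mD : measurable (D : set (measurableTypeR R)).
Hypothesis X0 : forall t w, (0 <= X t w)%R.
Hypothesis XD : forall t w, ~ D t -> X t w = 0%R.
Hypothesis mX : measurable_fun setT (fun tw : measurableTypeR R * T => X tw.1 tw.2 : measurableTypeR R).
Hypothesis k2 : (2 <= k)%N.

Let M w : \bar R := \int[leb]_t (X t w)%:E.

Lemma measurable_path_integral : measurable_fun setT M.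
Proof.
apply: (@measurable_fun_fubini_tonelli_G _ _ _ _ _ leb (fun tw => (X tw.1 tw.2)%:E)) => //.
- exact/measurable_EFinP.
- by move=> tw; rewrite lee_fin.
Qed.

Lemma path_integral_mkcond w : \int[leb]_(t in D) (X t w)%:E = M w.
Proof.
rewrite integral_mkcond; apply: eq_integral => t _; rewrite patchE.
by case: ifPn => // /negP nD; rewrite XD// => Dt; apply: nD; exact: mem_set.
Qed.

Let mpsi : measurable_fun setT (fun tw : measurableTypeR R * T => hpow k (X tw.1 tw.2) : measurableTypeR R).
Proof. exact: (measurableT_comp (@measurable_hpow R k)). Qed.

(** Markov's inequality is applied not to a power of [M] but to [A], the integral of c_t (X_t /
    c_t)^(k/2), whose mean is at most C. Convexity shows that [A] is at least g^k C wherever [M] is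
    at least g^2 C. *)
Lemma path_integral_tail (c : R -> R) (g : R) :
  measurable_fun setT (c : measurableTypeR R -> measurableTypeR R) ->
  (forall t, 0 < c t)%R -> 0 < \int[leb]_(t in D) (c t)%:E -> \int[leb]_(t in D) (c t)%:E < +oo ->
  (forall t, D t -> \int[P]_w (hpow k (X t w))%:E <= (hpow k (c t))%:E) -> (0 < g)%R ->
  P [set w | (g ^+ 2)%:E * \int[leb]_(t in D) (c t)%:E <= M w] <= ((g ^+ k)^-1)%:E.
Proof.
move=> mc c0 C0 Coo Ec g0; set C := \int[leb]_(t in D) _ in C0 Coo *.
have Cfin : C \is a fin_num by rewrite ge0_fin_numE// ltW.
pose q t w := (c t / hpow k (c t) * hpow k (X t w))%R.
have q0 t w : (0 <= q t w)%R by rewrite mulr_ge0 ?hpow_ge0// divr_ge0 ?hpow_ge0// ltW.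
have mq : measurable_fun setT (fun tw : measurableTypeR R * T => (q tw.1 tw.2)%:E).
  apply/measurable_EFinP; apply: measurable_funM => //; apply: measurable_funM.
    exact: (measurableT_comp mc).
  apply: (measurableT_comp (@measurable_invr R)).
  by apply: (measurableT_comp (@measurable_hpow R k)); exact: (measurableT_comp mc).
pose A w := \int[leb]_t (q t w)%:E.
have mA : measurable_fun setT A.
  apply: (@measurable_fun_fubini_tonelli_G _ _ _ _ _ leb (fun tw => (q tw.1 tw.2)%:E)) => //.
  by move=> tw; rewrite lee_fin.
have A0 w : 0 <= A w by apply: integral_ge0 => t _; rewrite lee_fin.
have ED t : D t -> (hpow k (c t) != 0)%R by move=> _; rewrite gt_eqF ?hpow_gt0.
have qD t w : ~ D t -> q t w = 0%R.
  by move=> nD; rewrite /q XD//; case: k k2 => // k' _; rewrite hpow0 mulr0.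
have mpsit t : measurable_fun setT (fun w => (hpow k (X t w))%:E).
  by apply/measurable_EFinP; exact: (measurableT_comp mpsi (pair1_measurable t)).
have EA : \int[P]_w A w <= C.
  have <- : \int[leb]_t \int[P]_w (q t w)%:E = \int[P]_w A w.
    apply: (@fubini_tonelli _ _ _ _ _ leb P (fun tw => (q tw.1 tw.2)%:E)) => //.
    by move=> tw; rewrite lee_fin.
  rewrite [leRHS]integral_mkcond; apply: ge0_le_lower_integral => [t _|t _].
    by apply: integral_ge0 => w _; rewrite lee_fin.
  rewrite patchE; case: ifPn => [/set_mem Dt|/negP nD]; last first.
    by rewrite integral0_eq// => w _; rewrite qD// => Dt; apply: nD; exact: mem_set.
  under eq_integral do rewrite EFinM.
  rewrite ge0_integralZl//; last 2 first.
  - by move=> w _; rewrite lee_fin hpow_ge0.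
  - by rewrite lee_fin divr_ge0 ?hpow_ge0// ltW.
  apply: (@le_trans _ _ ((c t / hpow k (c t))%:E * (hpow k (c t))%:E)).
    by apply: lee_wpmul2l; [rewrite lee_fin divr_ge0 ?hpow_ge0// ltW|exact: Ec].
  by rewrite -EFinM divfK// ED.
have mXw w : measurable_fun setT (fun t : measurableTypeR R => X t w : measurableTypeR R).
  exact: (measurableT_comp mX (pair2_measurable w)).
have mqw w : measurable_fun setT (fun t : measurableTypeR R => (q t w)%:E).
  exact: (measurableT_comp mq (pair2_measurable w)).
(* The tangent of hpow k at the t-independent ratio X t w / c t = g ^ 2. *)
have key w : (g ^+ 2)%:E * C <= M w -> (g ^+ k)%:E * C <= A w.
  move=> gM; pose al := (g ^+ k * (k%:R / 2))%R.
  have gk0 : (0 < g ^+ k)%R by exact: exprn_gt0.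
  have al0 : (0 <= al)%R by exact: (mulr_ge0 (ltW gk0) (divr_ge0 (ler0n _ _) (ler0n _ 2))).
  have be0 : (0 <= al / g ^+ 2)%R by rewrite divr_ge0// exprn_ge0// ltW.
  have AE : A w = \int[leb]_(t in D) (q t w)%:E.
    rewrite [RHS]integral_mkcond; apply: eq_integral => t _; rewrite patchE.
    by case: ifPn => // /negP nD; rewrite qD// => Dt; apply: nD; exact: mem_set.
  have mcD : measurable_fun D (fun t : measurableTypeR R => (c t)%:E).
    by apply/measurable_EFinP; exact: measurable_funTS.
  have mXD : measurable_fun D (fun t : measurableTypeR R => (X t w)%:E).
    by apply/measurable_EFinP; exact: (measurable_funTS (mXw w)).
  have mqD : measurable_fun D (fun t : measurableTypeR R => (q t w)%:E) by exact: (measurable_funTS (mqw w)).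
  (* Stated with sums of nonnegative terms only, as [M w] and [A w] may be infinite. *)
  have h : (g ^+ k)%:E * C + (al / g ^+ 2)%:E * M w <= A w + al%:E * C.
    rewrite AE -path_integral_mkcond /C -!ge0_integralZl//;
      try by move=> t _; rewrite lee_fin// ltW.
    2: by rewrite lee_fin ltW.
    rewrite -!ge0_integralD//;
      try by move=> t _; rewrite ?mule_ge0// lee_fin// ltW.
    all: try by apply: emeasurable_funM.
    apply: ge0_le_lower_integral => t Dt.
      by rewrite -!EFinM -EFinD lee_fin addr_ge0// mulr_ge0// ltW.
    rewrite -!EFinM -!EFinD lee_fin.
    have gc0 : (0 < g ^+ 2 * c t)%R by rewrite mulr_gt0// exprn_gt0.
    have qE : q t w = (g ^+ k * c t * hpow k (X t w / (g ^+ 2 * c t)))%R.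
      have XE : hpow k (X t w) = (g ^+ k * hpow k (c t) * hpow k (X t w / (g ^+ 2 * c t)))%R.
        rewrite -[in LHS](mulfVK (lt0r_neq0 gc0) (X t w)) mulrC.
        by rewrite (hpowM _ _ (ltW gc0)) (hpowM _ _ (sqr_ge0 _)) hpow_sqr gtr0_norm.
      by rewrite /q XE; field; exact: ED.
    have hq := ler_wpM2l (ltW (mulr_gt0 gk0 (c0 t))) (hpow_tangent k2 (divr_ge0 (X0 t w) (ltW gc0))).
    rewrite qE -lerBlDr; apply: le_trans hq; rewrite le_eqVlt; apply/orP; left; apply/eqP.
    by rewrite /al; field; rewrite !gt_eqF.
  have : (g ^+ k)%:E * C + al%:E * C <= A w + al%:E * C.
    apply: le_trans h; rewrite leeD2l//.
    apply: (@le_trans _ _ ((al / g ^+ 2)%:E * ((g ^+ 2)%:E * C))).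
      by rewrite muleA -EFinM divfK// gt_eqF// exprn_gt0.
    exact: lee_wpmul2l.
  by rewrite leeD2rE// fin_numM.
have mge (y : \bar R) (f : T -> \bar R) : measurable_fun setT f -> measurable [set w | y <= f w :> \bar R].
  by move=> mf; have := measurable_lee measurableT (measurable_cst y) mf; rewrite setTI.
have mS : measurable [set w | (g ^+ k)%:E * C <= A w] by exact: mge.
have mS' : measurable [set w | (g ^+ 2)%:E * C <= M w].
  by apply: mge; exact: measurable_path_integral.
apply: (@le_trans _ _ (P [set w | (g ^+ k)%:E * C <= A w])).
  by apply: le_measure; [exact: mem_set mS'|exact: mem_set mS|exact: key].
set S := [set w | _] in mS *.
have : (g ^+ k)%:E * C * P S <= C.
  apply: le_trans EA; rewrite -integral_cst//.
  apply: (@le_trans _ _ (\int[P]_(w in S) A w)).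
    by apply: ge0_le_lower_integral => w //= _; rewrite mule_ge0// ?lee_fin ?exprn_ge0// ltW.
  by apply: ge0_subset_integral.
have PSfin : P S \is a fin_num by exact: fin_num_measure.
rewrite -(fineK Cfin) -(fineK PSfin) -!EFinM !lee_fin => h.
have c1 : (0 < fine C)%R by rewrite fine_gt0// C0.
rewrite -(ler_pM2l (mulr_gt0 (exprn_gt0 k g0) c1)); apply: le_trans h _.
by rewrite mulrAC divff ?mul1r// gt_eqF// exprn_gt0.
Qed.

(** Here [s] need not be measurable, so [path_integral_tail] is run with a measurable minorant of K
    s that is read off from the moments of X. *)
Lemma path_integral_bound (s : R -> R) (g K : R) (I := K%:E * \int[leb]_(t in D) (s t)%:E) :
  (forall t, D t -> 0 <= s t)%R -> (0 < K)%R -> 0 < leb D -> leb D < +oo ->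
  (forall t, D t -> \int[P]_w (hpow k (X t w))%:E <= (hpow k (K * s t))%:E) -> (0 < g)%R ->
  measurable [set w | M w <= (g ^+ 2)%:E * I] /\
  (1 - (g ^+ k)^-1)%:E <= P [set w | M w <= (g ^+ 2)%:E * I].
Proof.
move=> s0 K0 D0 Doo Ec0 g0.
have mM := measurable_path_integral.
have mS y : measurable [set w | M w <= y].
  by have := measurable_lee measurableT mM (measurable_cst y); rewrite setTI.
split=> //.
have gk0 : (0 <= (g ^+ k)^-1)%R by rewrite invr_ge0 exprn_ge0// ltW.
have I0 : 0 <= I.
  apply: mule_ge0; first by rewrite lee_fin ltW.
  by apply: integral_ge0 => t Dt; rewrite lee_fin s0.
have [Ioo|Ifin] := eqVneq I +oo.
  rewrite Ioo gt0_muley ?lte_fin ?exprn_gt0// (_ : [set w | _] = setT).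
    by rewrite probability_setT lee_fin gerBl.
  by apply/seteqP; split => // w _ /=; rewrite leey.
have {Ifin} Ifin : I \is a fin_num by rewrite ge0_fin_numE// lt_neqAle Ifin leey.
have Dfin : leb D \is a fin_num by rewrite ge0_fin_numE// ltW.
pose e t := \int[P]_w (hpow k (X t w))%:E.
have e0 t : 0 <= e t by apply: integral_ge0 => w _; rewrite lee_fin hpow_ge0.
have me : measurable_fun setT (e : measurableTypeR R -> \bar R).
  apply: (@measurable_fun_fubini_tonelli_F _ _ _ _ _ P (fun tw => (hpow k (X tw.1 tw.2))%:E)) => //.
    exact/measurable_EFinP.
  by move=> tw; rewrite lee_fin hpow_ge0.
have k0 : (k != 0)%N by case: k k2.
(* The value whose k/2-th power is the moment [e t]; its measurability comes from Tonelli's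
   theorem. *)
pose c t := (fine (e t) `^ (2 / k%:R))%R.
have mc : measurable_fun setT (c : measurableTypeR R -> measurableTypeR R).
  apply: (measurableT_comp (measurable_powR _)).
  exact: (measurableT_comp _ me).
have cc t : (0 <= c t)%R by exact: powR_ge0.
have psic t : hpow k (c t) = fine (e t).
  apply/eqP; rewrite -(@eqrXn2 _ 2)// ?hpow_ge0 ?fine_ge0// hpow_sqrX//.
  rewrite -powR_mulrn// /c -powRrM divfK ?pnatr_eq0//.
  by rewrite (powR_mulrn 2)// fine_ge0.
have efin t : D t -> e t = (fine (e t))%:E.
  by move=> Dt; rewrite fineK// ge0_fin_numE// (le_lt_trans (Ec0 _ Dt))// ltry.
have cc0 t : D t -> (c t <= K * s t)%R.
  move=> Dt; rewrite leNgt; apply/negP => lt_c.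
  have : (hpow k (K * s t) < hpow k (c t))%R.
    rewrite /hpow ltrXn2r ?nnegrE ?sqrtr_ge0 ?k0//= ltr_sqrt//.
    by rewrite (le_lt_trans _ lt_c)// mulr_ge0 ?s0// ltW.
  by rewrite psic ltNge => /negP; apply; rewrite -lee_fin -efin//; exact: Ec0.
have mcD : measurable_fun D (fun t : measurableTypeR R => (c t)%:E).
  by apply/measurable_EFinP; exact: (measurable_funTS mc).
have cI : \int[leb]_(t in D) (c t)%:E <= I.
  (* K is taken out of the integral of [c], which is measurable, because that is not justified for
     the integral of [s]. *)
  have -> : \int[leb]_(t in D) (c t)%:E = K%:E * \int[leb]_(t in D) (K^-1 * c t)%:E.
    rewrite -ge0_integralZl//.
    - by apply: eq_integral => t _; rewrite -EFinM mulVKf// gt_eqF.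
    - by under eq_fun do rewrite EFinM; exact: emeasurable_funM.
    - by move=> t _; rewrite lee_fin mulr_ge0// invr_ge0 ltW.
    - by rewrite lee_fin ltW.
  apply: lee_wpmul2l; first by rewrite lee_fin ltW.
  apply: ge0_le_lower_integral => t Dt.
    by rewrite lee_fin mulr_ge0// invr_ge0 ltW.
  by rewrite lee_fin ler_pdivrMl// cc0.
(* The added 1 / (n + 1) gives the strict positivity that [path_integral_tail] asks for. *)
pose cn (n : nat) t := (c t + n.+1%:R^-1)%R.
have cnE n : \int[leb]_(t in D) (cn n t)%:E =
    \int[leb]_(t in D) (c t)%:E + n.+1%:R^-1%:E * leb D.
  rewrite -integral_cst// -ge0_integralD//; first by move=> t _; rewrite lee_fin.
  by move=> t _; rewrite /= lee_fin.
pose y (n : nat) := (g ^+ 2)%:E * (I + n.+1%:R^-1%:E * leb D).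
(* The thresholds [y n] decrease to the bound without reaching it, so these events increase to the
   strict failure event and continuity of P from below applies. *)
pose F (n : nat) := [set w | y n <= M w].
have mF n : measurable (F n).
  by have := measurable_lee measurableT (measurable_cst (y n)) mM; rewrite setTI.
have PF n : P (F n) <= ((g ^+ k)^-1)%:E.
  have Cle : \int[leb]_(t in D) (cn n t)%:E <= I + n.+1%:R^-1%:E * leb D.
    by rewrite cnE leeD2r.
  apply: (@le_trans _ _ (P [set w | (g ^+ 2)%:E * \int[leb]_(t in D) (cn n t)%:E <= M w])).
    apply: le_measure; [exact: mem_set|apply: mem_set|].
      have := measurable_lee measurableT (measurable_cst ((g ^+ 2)%:E * \int[leb]_(t in D) (cn n t)%:E)) mM.
      by rewrite setTI.
    move=> w /=; apply: le_trans; apply: lee_wpmul2l => //.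
    by rewrite lee_fin sqr_ge0.
  apply: path_integral_tail => //.
  - exact: measurable_funD.
  - by move=> t; rewrite ltr_wpDl.
  - rewrite cnE; apply: (@lt_le_trans _ _ (n.+1%:R^-1%:E * leb D)).
      by rewrite mule_gt0// lte_fin.
    by rewrite leeDr// integral_ge0// => t _; rewrite lee_fin.
  - by rewrite (le_lt_trans Cle)// -(fineK Ifin) -(fineK Dfin) -EFinM -EFinD ltry.
  - move=> t Dt; rewrite [leLHS]efin// lee_fin -psic; apply: le_hpow.
    by rewrite lerDl.
have ndF : nondecreasing_seq F.
  move=> i j ij; apply/subsetPset => w /=; apply: le_trans.
  apply: lee_wpmul2l; first by rewrite lee_fin sqr_ge0.
  rewrite leeD2l// lee_wpmul2r// lee_fin lef_pV2 ?posrE// ler_nat ltnS//.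
have UF : \bigcup_n F n = ~` [set w | M w <= (g ^+ 2)%:E * I].
  have [l lE] : exists l, leb D = l%:E by exists (fine (leb D)); rewrite fineK.
  have l0 : (0 < l)%R by rewrite -lte_fin -lE.
  have g20 : (0 < g ^+ 2)%R by exact: exprn_gt0.
  have yE n : y n = (g ^+ 2 * (fine I + n.+1%:R^-1 * l))%:E.
    by rewrite /y lE -{1}(fineK Ifin).
  have gIE : (g ^+ 2)%:E * I = (g ^+ 2 * fine I)%:E by rewrite -{1}(fineK Ifin).
  apply/seteqP; split => w /=.
    move=> [n _]; rewrite /F /= yE gIE => yn MI; have := le_trans yn MI.
    by rewrite lee_fin ler_pM2l// gerDl leNgt mulr_gt0.
  move=> /negP; rewrite -ltNge gIE => gM; rewrite /F /=.
  case E : (M w) => [m| |]; last first.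
  - by move: gM; rewrite E ltNge leNye.
  - by exists 0%N => //=; rewrite E leey.
  move: gM; rewrite E lte_fin => gm.
  have /ltr_add_invr[n] : (0 < (m / g ^+ 2 - fine I) / l)%R.
    by rewrite divr_gt0// subr_gt0 ltr_pdivlMr// mulrC.
  rewrite add0r ltr_pdivlMr// => /ltW hn; exists n => //=.
  by rewrite E yE lee_fin mulrC -ler_pdivlMr// -lerBrDl.
have mU : measurable (\bigcup_n F n) by exact: bigcup_measurable.
have PU : P (\bigcup_n F n) <= ((g ^+ k)^-1)%:E.
  have cvgF := nondecreasing_cvg_mu (mu := P) mF mU ndF.
  rewrite -(cvg_lim _ cvgF)//; apply: lime_le; first by apply/cvg_ex; exists (P (\bigcup_n F n)).
  by apply: nearW => n; exact: PF.
rewrite -[X in P X]setCK -UF probability_setC// EFinB leeB//.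
Qed.

End tail_bound.

Section nystrom_gap_moment_general.
Local Open Scope ereal_scope.
Context (R : realType) d (T : measurableType d) (P : probability T R).

(** A right inverse of [Om], used as competitor, makes the upper bound zero. *)
Lemma nystrom_gap_full_rank n N (M : 'M[R]_n) (Om : 'M[R]_(n, N)) :
  symmetric_psd M -> row_free Om -> nystrom_gap M Om = 0%R.
Proof.
move=> pM /row_freeP[Y OY]; apply/eqP; rewrite eq_le (nystrom_gap_ge0 _ pM) andbT.
have := nystrom_gap_le Om pM Y.
by rewrite OY subrr mulmx0 mxtrace0.
Qed.

Lemma nystrom_gap_moment n r N (M : 'M[R]_n) (Om : T -> 'M[R]_(n, N)) :
  (0 < r)%N -> (r + 2 <= N)%N -> symmetric_psd M -> gaussian_matrix P Om ->
  \int[P]_w (hpow (N - r) (nystrom_gap M (Om w)))%:E <=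
  (hpow (N - r) ((1 + r%:R) * \sum_(i < n | (r <= i)%N) sigma M i))%:E.
Proof.
(* If n < r the tail sum is empty, but then n <= N, so the Gaussian matrix has full row rank almost
   surely and the gap vanishes. *)
move=> r0 rN pM gOm; have [rn|nr] := leqP r n; last first.
  have nN : (n <= N)%N by rewrite (leq_trans (ltnW nr))// (leq_trans _ rN)// leq_addr.
  apply: (@le_trans _ _ (\int[P]_w (cst 0 w))); last first.
    by rewrite integral0 lee_fin hpow_ge0.
  apply: ae_ge0_le_integral => //.
  - by move=> w _; rewrite lee_fin hpow_ge0.
  - apply/measurable_EFinP; apply: (measurableT_comp (@measurable_hpow R _)).
    apply: measurable_funB => //; apply: measurable_tr_nystrom => //.
    exact: measurable_gaussian_matrix gOm.
  apply: filterS (gaussian_row_free gOm (@inj_id _) nN) => w fO _.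
  rewrite nystrom_gap_full_rank//; last by move: fO; rewrite mxsub_id.
  by rewrite lee_fin; case: (N - r)%N (subn_gt0 r N) => [|k _]; rewrite ?hpow0//; lia.
case: r r0 rN rn => // r _ rN rn.
have [m nE] : exists m, n = (r.+1 + m)%N by exists (n - r.+1)%N; rewrite subnKC.
(* As [r] now stands for one less than the rank, the order N - r.+1 is p + 2, at least 2 as
   convexity requires. *)
have [p NE] : exists p, N = (r + p.+3)%N.
  by exists (N - r.+1 - 2)%N; lia.
subst n N; rewrite (_ : r + p.+3 - r.+1 = p.+2)%N; last by lia.
exact: nystrom_gap_moment_split.
Qed.

End nystrom_gap_moment_general.

Section measurable_continuous_matrix.
Context (R : realType) (n : nat) (a b : R) (B : R -> 'M[R]_n).

Lemma measurable_patch_matrix : {within `[a, b], continuous B} ->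
  measurable_fun setT (fun t : measurableTypeR R => if t \in `[a, b] then B t else 0).
Proof.
move=> cB; apply/measurable_mxP => i j.
have cBij : {within `[a, b], continuous (fun t => B t i j)}.
  move=> t; apply: (@continuous_comp _ _ _ (B : subspace `[a, b] -> _) (fun M : 'M[R]_n => M i j)).
    exact: cB.
  exact: coord_continuous.
have mab : measurable (`[a, b]%classic : set (measurableTypeR R)) by exact: measurable_itv.
have := subspace_continuous_measurable_fun mab cBij.
move=> /(measurable_restrictT _ mab); apply: eq_mfun => t.
rewrite patchE mem_setE; case: ifP => //; by rewrite mxE.
Qed.

End measurable_continuous_matrix.

Theorem theorem2p3 (R : realType) (n r nOmega : nat) (a b : R)
    (B : R -> 'M[R]_n)
    (d : measure_display) (T : measurableType d) (P : probability T R)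
    (Omega : T -> 'M[R]_(n, nOmega))
    (hab : a < b)
    (hBpsd : forall t, t \in `[a, b] -> symmetric_psd (B t))
    (hBcont : {within `[a, b], continuous B})
    (hr : (2 <= r)%N) (hnOmega : (r + 4 <= nOmega)%N)
    (hOmega : gaussian_matrix P Omega)
    (gamma : R) (hgamma : 1 <= gamma) :
  let bound_holds := [set w : T |
    (\int[lebesgue_measure]_(t in `[a, b])
        (`| \tr (B t) - \tr (nystrom (B t) (Omega w)) |)%:E
     <= (gamma ^+ 2 * (1 + r%:R))%:E *
        \int[lebesgue_measure]_(t in `[a, b])
          (\sum_(i < n | (r <= i)%N) sigma (B t) i)%:E)%E] in
  measurable bound_holds /\
  ((1 - gamma ^- (nOmega - r))%:E <= P bound_holds)%E.
Proof.
(* Extended by 0, the family is measurable and positive semi-definite on the whole line, and its gap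
   is 0 outside the interval. *)
pose B' t := if t \in `[a, b] then B t else 0.
have pB' t : symmetric_psd (B' t).
  rewrite /B'; case: ifP => [/hBpsd//|_]; split; first exact: trmx0.
  by move=> x; rewrite mulmx0 mul0mx mxE.
pose X t w := nystrom_gap (B' t) (Omega w).
have mO := measurable_gaussian_matrix hOmega.
have mB : measurable_fun setT (fun t : measurableTypeR R => B' t) by exact: measurable_patch_matrix.
have X0 t w : 0 <= X t w by exact: nystrom_gap_ge0.
pose D : set R := `[a, b]%classic.
have inD t : D t -> t \in `[a, b] by [].
have BE t : D t -> B' t = B t by move=> /inD h; rewrite /B' h.
have XD t w : ~ D t -> X t w = 0.
  move=> nD; rewrite /X /B' ifF; last by apply/negP.
  by rewrite /nystrom_gap /nystrom !mul0mx mxtrace0 subr0.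
have mX : measurable_fun setT (fun tw : measurableTypeR R * T => X tw.1 tw.2 : measurableTypeR R).
  have mf : measurable_fun setT (fun tw : measurableTypeR R * T => B' tw.1).
    exact: (measurableT_comp mB measurable_fst).
  have mg : measurable_fun setT (fun tw : measurableTypeR R * T => Omega tw.2).
    exact: (measurableT_comp mO measurable_snd).
  apply: measurable_funB; last by apply: measurable_tr_nystrom.
  have /measurable_mxP mfe := mf.
  by apply: measurable_sum => i; exact: mfe.
pose s t := \sum_(i < n | (r <= i)%N) sigma (B t) i.
have s0 t : D t -> 0 <= s t.
  move=> /inD/hBpsd/spectral_psd[V _ [l _ [l0 sl]]].
  by apply: sumr_ge0 => i _; rewrite sl.
have mD : measurable (D : set (measurableTypeR R)) by exact: measurable_itv.
have leD : lebesgue_measure D = (b - a)%:E.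
  by rewrite /D lebesgue_measure_itv/= lte_fin hab EFinB.
have Ec t : D t -> (\int[P]_w (hpow (nOmega - r) (X t w))%:E <=
    (hpow (nOmega - r) ((1 + r%:R) * s t))%:E)%E.
  move=> Dt; rewrite /s -(BE t Dt); apply: nystrom_gap_moment => //.
    exact: ltnW.
  by apply: leq_trans hnOmega; rewrite leq_add2l.
have k2 : (2 <= nOmega - r)%N by lia.
have D0 : (0 < lebesgue_measure D)%E by rewrite leD lte_fin subr_gt0.
have Doo : (lebesgue_measure D < +oo)%E by rewrite leD ltry.
have K0 : 0 < 1 + r%:R :> R by rewrite ltr_pwDl.
have g0 : 0 < gamma by exact: lt_le_trans hgamma.
have ME w : (\int[lebesgue_measure]_(t in `[a, b]) (`| \tr (B t) - \tr (nystrom (B t) (Omega w)) |)%:E =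
    \int[lebesgue_measure]_t (X t w)%:E)%E.
  rewrite -(path_integral_mkcond XD); apply: eq_integral => t /set_mem Dt.
  by rewrite -(BE t Dt) ger0_norm//; exact: X0.
move=> bound_holds; rewrite [bound_holds](_ : _ = [set w |
    (\int[lebesgue_measure]_t (X t w)%:E <= (gamma ^+ 2)%:E *
      ((1 + r%:R)%:E * \int[lebesgue_measure]_(t in D) (s t)%:E))%E]).
  exact: (path_integral_bound mD X0 XD mX k2 s0 K0 D0 Doo Ec g0).
by apply/seteqP; split => w; rewrite /bound_holds /= ME EFinM muleA.
Qed.
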